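(* Let $(R,\mathfrak m,k)$ be a local domain of prime characteristic $p$ which is $F$-finite and $F$-coherent, and let $I$ be an ideal of $R$ of finite colength. If $R$ is Cohen–Macaulay, then the Hilbert–Kunz multiplicity $e_{HK}(I,R)$ is a rational number.
   Context: Local rings are noetherian. Let $F:R\to R$, $x\mapsto x^p$, be the Frobenius map. $R$ is $F$-finite if $R$, viewed as an $R$-module via $F$, is finitely generated. The perfect closure of $R$ is $R^\infty=\varinjlim(R\xrightarrow{F}R\xrightarrow{F}\cdots)$, and $R$ is $F$-coherent if $R^\infty$ is a coherent ring (every finitely generated ideal is finitely presented). An ideal $I$ has finite colength if $R/I$ has finite length. The Hilbert–Kunz multiplicity is $e_{HK}(I,R)=\lim_{n\to\infty}\ell(F^n(R/I))/p^{n\dim(R)}$, where $\ell$ is length and $F^n(-)$ is the $n$-th Peskine–Szpiro (Frobenius) functor, i.e. base change along the $n$-th iterate of Frobenius, so that $F^n(R/I)=R/I^{[p^n]}$ with $I^{[p^n]}$ generated by the $p^n$-th powers of elements of $I$. *)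

(* Defs.v *)
From HB Require Import structures.
From mathcomp Require Import all_boot all_order all_algebra.
From mathcomp Require Import zify.
From mathcomp Require Import all_classical all_reals all_analysis.

Set Implicit Arguments.
Unset Strict Implicit.
Unset Printing Implicit Defensive.

Import Order.TTheory GRing.Theory Num.Theory.
Import numFieldNormedType.Exports.

Local Open Scope ring_scope.

(* The greatest element of P if there is one, and the junk value 0 otherwise
   (P empty or unbounded). *)
Definition nat_sup (P : set nat) : nat :=
  xget 0%N (fun n => P n /\ forall k, P k -> (k <= n)%N).

Section Modules.
Variables (R : comNzRingType) (V : lmodType R).

Definition submod_span_pred (X : set V) : {pred V} :=
  fun v => `[< forall N : submodClosed V, (forall x, X x -> x \in N) ->
               v \in N >].

Lemma submod_span_pred_submod X : subsemimod_closed (submod_span_pred X).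
Proof.
split; first split.
- by apply/asboolP => N _; exact: rpred0.
- move=> u v /asboolP Xu /asboolP Xv; apply/asboolP => N XN.
  by apply: rpredD; [exact: Xu | exact: Xv].
- by move=> a v /asboolP Xv; apply/asboolP => N XN; exact/rpredZ/Xv.
Qed.

HB.instance Definition _ X :=
  GRing.isSubSemiModClosed.Build R V (submod_span_pred X) (submod_span_pred_submod X).

Definition submod_span (X : set V) : submodClosed V := submod_span_pred X.

Definition finitely_generated : Prop :=
  exists s : seq V, forall v, v \in submod_span [set` s].

Definition finitely_generated_sub (N : submodClosed V) : Prop :=
  exists s : seq V, N =i submod_span [set` s].

Definition properly_contained (M N : submodClosed V) : Prop :=
  {subset M <= N} /\ ~ {subset N <= M}.

Definition submodule_chain (n : nat) : Prop :=
  exists C : nat -> submodClosed V,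
    forall i, (i < n)%N -> properly_contained (C i) (C i.+1).

Definition finite_length : Prop :=
  exists b : nat, forall n, submodule_chain n -> (n <= b)%N.

(* Only meaningful for modules of finite length. *)
Definition module_length : nat := nat_sup submodule_chain.

End Modules.

Section LinearKernel.
Variables (R : comNzRingType) (U V : lmodType R) (f : {linear U -> V}).

Definition lin_ker_pred : {pred U} := fun u => f u == 0.

Lemma lin_ker_pred_submod : subsemimod_closed lin_ker_pred.
Proof.
split; first split.
- by rewrite unfold_in /lin_ker_pred linear0.
- move=> u v; rewrite !unfold_in /lin_ker_pred linearD.
  by move=> /eqP-> /eqP->; rewrite addr0.
- move=> a u; rewrite !unfold_in /lin_ker_pred linearZ.
  by move=> /eqP->; rewrite /= scaler0.
Qed.

HB.instance Definition _ :=
  GRing.isSubSemiModClosed.Build R U lin_ker_pred lin_ker_pred_submod.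

Definition lin_ker : submodClosed U := lin_ker_pred.

End LinearKernel.

(* A surjection R^n -> N is given as a linear map R^n -> V with image N. *)
Definition finitely_presented_sub (R : comNzRingType) (V : lmodType R)
    (N : submodClosed V) : Prop :=
  exists (n : nat) (f : {linear 'rV[R]_n -> V}),
    (forall v, v \in N <-> exists u, f u = v) /\ finitely_generated_sub (lin_ker f).

Section QuotientModule.
Variables (R : comNzRingType) (V : lmodType R) (N : submodClosed V).

(* For modules over a ring, submodClosed does not inherit from zmodClosed. *)
Definition submod_carrier : {pred V} := N.

Lemma submod_carrier_zmod : zmod_closed submod_carrier.
Proof.
split=> [|u v Nu Nv]; first exact: (rpred0 N).
by apply: (rpredD Nu); rewrite -scaleN1r; exact: (@rpredZ _ _ N).
Qed.

HB.instance Definition _ :=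
  GRing.isZmodClosed.Build V submod_carrier submod_carrier_zmod.

Local Open Scope quotient_scope.

Definition quotient_module : Type := Quotient.quot submod_carrier.

HB.instance Definition _ := GRing.Zmodule.on quotient_module.
HB.instance Definition _ := Quotient.on quotient_module.

Definition quotient_scale (a : R) (x : quotient_module) : quotient_module :=
  \pi_quotient_module (a *: repr x).

Lemma quotient_piP (u v : V) :
  (\pi_quotient_module u = \pi_quotient_module v) <-> u - v \in N.
Proof.
have E : (u - v \in N) = (\pi_quotient_module u == \pi_quotient_module v) :=
  Quotient.idealrBE submod_carrier u v.
by split=> [h | h]; [rewrite E h | apply/eqP; rewrite -E].
Qed.

Lemma quotient_scale_pi a (v : V) :
  quotient_scale a (\pi_quotient_module v) = \pi_quotient_module (a *: v).
Proof.
apply/quotient_piP; rewrite -scalerBr; apply: (@rpredZ _ _ N).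
by apply/quotient_piP; rewrite reprK.
Qed.

Lemma quotient_piD (u v : V) :
  \pi_quotient_module (u + v) =
  \pi_quotient_module u + \pi_quotient_module v.
Proof. exact: (Quotient.pi_add submod_carrier). Qed.

Lemma quotient_pi_surj x : exists v : V, x = \pi_quotient_module v.
Proof. by exists (repr x); rewrite reprK. Qed.

Lemma quotient_scaleA a b x :
  quotient_scale a (quotient_scale b x) = quotient_scale (a * b) x.
Proof.
by case: (quotient_pi_surj x) => v ->; rewrite !quotient_scale_pi scalerA.
Qed.

Lemma quotient_scale1 : left_id 1 quotient_scale.
Proof.
move=> x; case: (quotient_pi_surj x) => v ->.
by rewrite quotient_scale_pi scale1r.
Qed.

Lemma quotient_scaleDr : right_distributive quotient_scale +%R.
Proof.
move=> a x y; case: (quotient_pi_surj x) => u ->.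
case: (quotient_pi_surj y) => v ->.
by rewrite -quotient_piD !quotient_scale_pi scalerDr quotient_piD.
Qed.

Lemma quotient_scaleDl x : {morph quotient_scale^~ x : a b / a + b}.
Proof.
move=> a b; case: (quotient_pi_surj x) => v ->.
by rewrite !quotient_scale_pi scalerDl quotient_piD.
Qed.

HB.instance Definition _ := GRing.Zmodule_isLmodule.Build R quotient_module
  quotient_scaleA quotient_scale1 quotient_scaleDr quotient_scaleDl.

End QuotientModule.

(* S as an R-module via f; the alias keeps f so that instance resolution can
   find the action. *)
Definition restrict_scalars (R S : comNzRingType) (f : {rmorphism R -> S})
  : Type := S.

Section RestrictScalars.
Variables (R S : comNzRingType) (f : {rmorphism R -> S}).
Local Notation fS := (restrict_scalars f).

HB.instance Definition _ := GRing.Zmodule.copy fS S.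

Definition restrict_scale (a : R) (x : fS) : fS := f a * (x : S).

Lemma restrict_scaleA a b x :
  restrict_scale a (restrict_scale b x) = restrict_scale (a * b) x.
Proof. by rewrite /restrict_scale rmorphM mulrA. Qed.

Lemma restrict_scale1 : left_id 1 restrict_scale.
Proof. by move=> x; rewrite /restrict_scale rmorph1 mul1r. Qed.

Lemma restrict_scaleDr : right_distributive restrict_scale +%R.
Proof. by move=> a x y; exact: (@mulrDr S). Qed.

Lemma restrict_scaleDl x : {morph restrict_scale^~ x : a b / a + b}.
Proof. by move=> a b; rewrite /restrict_scale rmorphD; exact: (@mulrDl S). Qed.

HB.instance Definition _ := GRing.Zmodule_isLmodule.Build R fS
  restrict_scaleA restrict_scale1 restrict_scaleDr restrict_scaleDl.

End RestrictScalars.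

(* An ideal, possibly the unit ideal, unlike the library's idealr. *)
Notation ideal R := (submodClosed (R : comNzRingType)^o).

Section Rings.
Variable R : comNzRingType.
Implicit Types I P m : ideal R.

Definition noetherian_ring : Prop := forall I, finitely_generated_sub I.

Definition coherent_ring : Prop :=
  forall I, finitely_generated_sub I -> finitely_presented_sub I.

Definition prime_ideal P : Prop :=
  (1 : R) \notin P /\ prime_idealr_closed (P : {pred R}).

Definition maximal_ideal m : Prop :=
  (1 : R) \notin m /\
  forall I, (1 : R) \notin I -> {subset m <= I} -> {subset I <= m}.

Definition local_ring m : Prop :=
  [/\ noetherian_ring, maximal_ideal m & forall m', maximal_ideal m' -> m' =i m].

Definition prime_chain (n : nat) : Prop :=
  exists C : nat -> ideal R,
    (forall i, (i <= n)%N -> prime_ideal (C i)) /\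
    (forall i, (i < n)%N -> properly_contained (C i) (C i.+1)).

(* Only meaningful for rings of finite dimension, such as noetherian local
   rings. *)
Definition krull_dim : nat := nat_sup prime_chain.

Definition regular_sequence (s : seq R) : Prop :=
  (1 : R) \notin submod_span ([set` s] : set R^o) /\
  forall i, (i < size s)%N ->
    forall v : quotient_module (submod_span ([set` take i s] : set R^o)),
      s`_i *: v = 0 -> v = 0.

Definition depth m : nat :=
  nat_sup (fun n => exists s : seq R,
    [/\ size s = n, {subset s <= m} & regular_sequence s]).

Definition cohen_macaulay m : Prop := depth m = krull_dim.

End Rings.

Section PerfectClosureRelation.
Variables (R : comNzRingType) (p : nat).

(* The element x of the n-th copy of R in R -F-> R -F-> ...; it becomes equal
   to y in the m-th copy when the two agree in some copy of index k + n + m. *)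
Definition perf_rel (u v : nat * R) : bool :=
  `[< exists k, u.2 ^+ (p ^ (k + v.1)) = v.2 ^+ (p ^ (k + u.1)) >].

Let frobX (x : R) a b : (x ^+ (p ^ a)) ^+ (p ^ b) = x ^+ (p ^ (a + b)).
Proof. by rewrite -exprM -expnD. Qed.

Lemma perf_relP (u v : nat * R) :
  reflect (exists k, u.2 ^+ (p ^ (k + v.1)) = v.2 ^+ (p ^ (k + u.1)))
          (perf_rel u v).
Proof. exact: asboolP. Qed.

Lemma perf_rel_equiv : equiv_class_of perf_rel.
Proof.
split=> [u|u v|v u w].
- by apply/perf_relP; exists 0%N.
- by apply/perf_relP/perf_relP => -[k h]; exists k.
move=> /perf_relP[k huv] /perf_relP[l hvw]; apply/perf_relP.
exists (k + l + v.1)%N.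
have -> : (k + l + v.1 + w.1 = (k + v.1) + (l + w.1))%N by lia.
rewrite -frobX huv frobX.
have -> : (k + u.1 + (l + w.1) = (l + w.1) + (k + u.1))%N by lia.
by rewrite -frobX hvw frobX; congr (_ ^+ (p ^ _)); lia.
Qed.

Canonical perf_equiv := EquivRelPack perf_rel_equiv.
Canonical perf_encModRel := defaultEncModRel perf_rel.

End PerfectClosureRelation.

(* The characteristic is kept as an argument because the ring structure
   depends on it. *)
Definition perfect_closure (R : comNzRingType) (p : nat)
  (chR : p \in [pchar R]) : Type := {eq_quot (@perf_rel R p)}%qT.

Section PerfectClosure.
Variables (R : comNzRingType) (p : nat) (chR : p \in [pchar R]).

Local Open Scope quotient_scope.
Local Notation Rinf := (perfect_closure chR).

HB.instance Definition _ := Choice.copy Rinf {eq_quot (@perf_rel R p)}.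
HB.instance Definition _ := EqQuotient.copy Rinf {eq_quot (@perf_rel R p)}.

Let frobX (x : R) a b : (x ^+ (p ^ a)) ^+ (p ^ b) = x ^+ (p ^ (a + b)).
Proof. by rewrite -exprM -expnD. Qed.

Lemma frobD (x y : R) n :
  (x + y) ^+ (p ^ n) = x ^+ (p ^ n) + y ^+ (p ^ n).
Proof.
apply: exprDn_pchar; rewrite pnatX; apply/orP; left.
by rewrite pnatE ?(pcharf_prime chR).
Qed.

Lemma frobN (x : R) n : (- x) ^+ (p ^ n) = - x ^+ (p ^ n).
Proof.
apply: exprNn_pchar; rewrite pnatX; apply/orP; left.
by rewrite pnatE ?(pcharf_prime chR).
Qed.

Lemma frob0 n : (0 : R) ^+ (p ^ n) = 0.
Proof. by rewrite expr0n expn_eq0 gtn_eqF // prime_gt0 // (pcharf_prime chR). Qed.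

Definition to_perf (n : nat) (x : R) : Rinf :=
  \pi_Rinf (n, x).

Lemma to_perfP n m x y : reflect
  (exists k, x ^+ (p ^ (k + m)) = y ^+ (p ^ (k + n)))
  (to_perf n x == to_perf m y).
Proof. by rewrite /to_perf eqmodE; exact: perf_relP (n, x) (m, y). Qed.

Lemma to_perf_surj u : exists n x, u = to_perf n x.
Proof. by exists (repr u).1, (repr u).2; rewrite /to_perf -surjective_pairing reprK. Qed.

Lemma to_perfS n k x : to_perf n x = to_perf (n + k) (x ^+ (p ^ k)).
Proof.
by apply/eqP/to_perfP; exists 0%N; rewrite frobX; congr (_ ^+ (p ^ _)); lia.
Qed.

Definition perf_opp (u : Rinf) := to_perf (repr u).1 (- (repr u).2).
Definition perf_add (u v : Rinf) :=
  let: (n, x) := repr u in let: (m, y) := repr v in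
  to_perf (n + m) (x ^+ (p ^ m) + y ^+ (p ^ n)).
Definition perf_mul (u v : Rinf) :=
  let: (n, x) := repr u in let: (m, y) := repr v in
  to_perf (n + m) (x ^+ (p ^ m) * y ^+ (p ^ n)).

Lemma repr_to_perf n x : to_perf (repr (to_perf n x)).1 (repr (to_perf n x)).2
  = to_perf n x.
Proof. by rewrite {1}/to_perf -surjective_pairing reprK. Qed.

Lemma perf_oppE n x : perf_opp (to_perf n x) = to_perf n (- x).
Proof.
rewrite /perf_opp; case/eqP/to_perfP: (repr_to_perf n x) => k h.
by apply/eqP/to_perfP; exists k; rewrite !frobN h.
Qed.

Lemma perf_add_subproof n m x y :
  perf_add (to_perf n x) (to_perf m y) =
  to_perf (n + m) (x ^+ (p ^ m) + y ^+ (p ^ n)).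
Proof.
rewrite /perf_add.
have := repr_to_perf n x; case: (repr _) => n' x' /= /eqP/to_perfP[k hx].
have := repr_to_perf m y; case: (repr _) => m' y' /= /eqP/to_perfP[l hy].
apply/eqP/to_perfP; exists (k + l)%N; rewrite !frobD !frobX.
congr (_ + _).
  rewrite (_ : m' + _ = (k + n) + (l + m + m'))%N; last by lia.
  by rewrite -frobX hx frobX; congr (_ ^+ (p ^ _)); lia.
rewrite (_ : n' + _ = (l + m) + (k + n + n'))%N; last by lia.
by rewrite -frobX hy frobX; congr (_ ^+ (p ^ _)); lia.
Qed.

Lemma perf_mul_subproof n m x y :
  perf_mul (to_perf n x) (to_perf m y) =
  to_perf (n + m) (x ^+ (p ^ m) * y ^+ (p ^ n)).
Proof.
rewrite /perf_mul.
have := repr_to_perf n x; case: (repr _) => n' x' /= /eqP/to_perfP[k hx].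
have := repr_to_perf m y; case: (repr _) => m' y' /= /eqP/to_perfP[l hy].
apply/eqP/to_perfP; exists (k + l)%N; rewrite !exprMn !frobX.
congr (_ * _).
  rewrite (_ : m' + _ = (k + n) + (l + m + m'))%N; last by lia.
  by rewrite -frobX hx frobX; congr (_ ^+ (p ^ _)); lia.
rewrite (_ : n' + _ = (l + m) + (k + n + n'))%N; last by lia.
by rewrite -frobX hy frobX; congr (_ ^+ (p ^ _)); lia.
Qed.

Lemma perf_addE n x y :
  perf_add (to_perf n x) (to_perf n y) = to_perf n (x + y).
Proof. by rewrite perf_add_subproof -frobD -to_perfS. Qed.

Lemma perf_mulE n x y :
  perf_mul (to_perf n x) (to_perf n y) = to_perf n (x * y).
Proof. by rewrite perf_mul_subproof -exprMn -to_perfS. Qed.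

Lemma perf_common2 u v : exists n x y, u = to_perf n x /\ v = to_perf n y.
Proof.
case: (to_perf_surj u) => n [x ->]; case: (to_perf_surj v) => m [y ->].
exists (n + m)%N, (x ^+ (p ^ m)), (y ^+ (p ^ n)).
by rewrite -to_perfS addnC -to_perfS.
Qed.

Lemma perf_common3 u v w : exists n x y z,
  [/\ u = to_perf n x, v = to_perf n y & w = to_perf n z].
Proof.
case: (perf_common2 u v) => n [x [y [-> ->]]].
case: (to_perf_surj w) => m [z ->].
exists (n + m)%N, (x ^+ (p ^ m)), (y ^+ (p ^ m)), (z ^+ (p ^ n)).
by rewrite -!to_perfS addnC -to_perfS.
Qed.

Lemma to_perf0 n : to_perf n 0 = to_perf 0 0.
Proof. by rewrite (to_perfS 0 n) frob0. Qed.

Lemma to_perf1 n : to_perf n 1 = to_perf 0 1.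
Proof. by rewrite (to_perfS 0 n) expr1n. Qed.

Lemma perf_addA : associative perf_add.
Proof.
move=> u v w; case: (perf_common3 u v w) => n [x [y [z [-> -> ->]]]].
by rewrite !perf_addE addrA.
Qed.

Lemma perf_addC : commutative perf_add.
Proof.
move=> u v; case: (perf_common2 u v) => n [x [y [-> ->]]].
by rewrite !perf_addE addrC.
Qed.

Lemma perf_add0 : left_id (to_perf 0 0) perf_add.
Proof.
move=> u; case: (to_perf_surj u) => n [x ->].
by rewrite -(to_perf0 n) perf_addE add0r.
Qed.

Lemma perf_addN : left_inverse (to_perf 0 0) perf_opp perf_add.
Proof.
move=> u; case: (to_perf_surj u) => n [x ->].
by rewrite perf_oppE perf_addE addNr to_perf0.
Qed.

HB.instance Definition _ := GRing.isZmodule.Build Rinf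
  perf_addA perf_addC perf_add0 perf_addN.

Lemma perf_mulA : associative perf_mul.
Proof.
move=> u v w; case: (perf_common3 u v w) => n [x [y [z [-> -> ->]]]].
by rewrite !perf_mulE mulrA.
Qed.

Lemma perf_mulC : commutative perf_mul.
Proof.
move=> u v; case: (perf_common2 u v) => n [x [y [-> ->]]].
by rewrite !perf_mulE mulrC.
Qed.

Lemma perf_mul1 : left_id (to_perf 0 1) perf_mul.
Proof.
move=> u; case: (to_perf_surj u) => n [x ->].
by rewrite -(to_perf1 n) perf_mulE mul1r.
Qed.

Lemma perf_mulDl : left_distributive perf_mul +%R.
Proof.
move=> u v w; case: (perf_common3 u v w) => n [x [y [z [-> -> ->]]]].
by rewrite /GRing.add /= !(perf_mulE, perf_addE) mulrDl.
Qed.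

Lemma perf_one_neq0 : to_perf 0 1 != 0.
Proof.
apply/to_perfP => -[k]; rewrite addn0 expr1n frob0.
by apply/eqP; exact: oner_neq0.
Qed.

HB.instance Definition _ := GRing.Zmodule_isComNzRing.Build Rinf
  perf_mulA perf_mulC perf_mul1 perf_mulDl perf_one_neq0.

Lemma to_perf_zmod n : zmod_morphism (to_perf n).
Proof. by move=> x y; rewrite {2}/GRing.add {2}/GRing.opp /= perf_oppE perf_addE. Qed.

Lemma to_perf_monoid n : monoid_morphism (to_perf n).
Proof.
split; first exact: to_perf1.
by move=> x y; rewrite {2}/GRing.mul /= perf_mulE.
Qed.

HB.instance Definition _ n :=
  GRing.isZmodMorphism.Build R Rinf (to_perf n) (to_perf_zmod n).
HB.instance Definition _ n :=
  GRing.isMonoidMorphism.Build R Rinf (to_perf n)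
    (to_perf_monoid n).

Lemma to_perf_frob n x : to_perf n.+1 (pFrobenius_aut chR x) = to_perf n x.
Proof. by rewrite (to_perfS n 1) addn1. Qed.

End PerfectClosure.

Section Frobenius.
Variables (R : comNzRingType) (p : nat) (chR : p \in [pchar R]).

Definition F_finite : Prop :=
  finitely_generated (restrict_scalars (pFrobenius_aut chR)).

Definition F_coherent : Prop := coherent_ring (perfect_closure chR).

End Frobenius.

Section HilbertKunz.
Variables (R : comNzRingType) (p : nat).

Definition frobenius_power (I : ideal R) (n : nat) : ideal R :=
  submod_span (fun y : R^o => exists2 x : R, x \in I & y = x ^+ (p ^ n)).

Definition HK_sequence (K : realType) (I : ideal R) (n : nat) : K :=
  (module_length (quotient_module (frobenius_power I n)))%:R
    / (p ^ (n * krull_dim R))%:R.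

Definition HK_multiplicity (K : realType) (I : ideal R) : K :=
  limn (HK_sequence K I).

End HilbertKunz.

(* Main.v *)
From HB Require Import structures.
Require Import Defs.
From mathcomp Require Import all_boot all_order all_algebra.
From mathcomp Require Import ring lra zify.
From mathcomp Require Import all_classical all_reals all_analysis.

Set Implicit Arguments.
Unset Strict Implicit.
Unset Printing Implicit Defensive.

Import Order.TTheory GRing.Theory Num.Theory.
Import numFieldNormedType.Exports.

Local Open Scope ring_scope.
Local Open Scope classical_set_scope.

(** Write q for p^n, d for the dimension, k for the residue field, and S for the
    perfect closure of R.  The Hilbert-Kunz function is, up to a negligible term, an
    Euler characteristic which obeys linear recurrences with integer coefficients.

    Perfection turns coherence into finiteness of resolutions.  Modulo the ideal of all
    p-power roots of one element the Tor-dimension of a perfect ring goes up by at most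
    one (tor_vanishing), so the residue field of S has finite Tor-dimension, and if S is
    coherent the minimal free resolution of S / I S is finite, with finitely generated
    terms (finite_free_resolution).  Its matrices have entries in a single copy of R
    inside S.  Read in that copy they form a finite free complex G over R with cokernel
    a quotient R / I^[q0], all of whose Frobenius twists G^(n) become exact over S
    (frobenius_exact_complex).

    For a finitely generated module N let chi_n(N) be the Euler characteristic of the
    lengths of the homology of G^(n) with coefficients in N.  It is additive in N, and
    the twist n + 1 with coefficients in N is, seen through Frobenius, the twist n with
    coefficients in the push-forward of N.  In a prime filtration of the push-forward of
    R / P there are rho_P copies of R / P, where rho_P is a rank, and copies of R / P'
    for primes P' strictly larger than P.  With kappa = [k : k^p] therefore
    kappa chi_(n+1)(R/P) = rho_P chi_n(R/P) + (a sum of chi_n(R/P') over larger primes).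
    If rho_P < kappa p^d for P <> 0 then, by noetherian induction, the series of the
    chi_n(R/P) / q^d converge to rational numbers (series_rational); and if
    rho_0 = kappa p^d then chi_n(R) / q^d is an initial value plus rational multiples of
    partial sums of such series (limit_rational).

    These facts on ranks are where R being Cohen-Macaulay is used.  A regular sequence x
    of length d makes R / (x_1^q, ..., x_d^q) a union of q^d copies of R / (x)
    (regular_cfilt), so the length of R / m^[q] is of exact order q^d.  Up to the factor
    kappa^n this is the number of generators of the n-th push-forward of R, which bounds
    ranks from above (rho_nonzero_bound, rho_zero_bound); rho_0 cannot be smaller because
    lengths would then grow more slowly than q^d (rho_zero).

    Finally chi_n(R) differs from the length of the cokernel R / I^[q q0] by homology in
    positive degrees.  A cycle of G^(n) becomes a boundary after further twists, so it is
    multiplied into the boundaries by an element c <> 0, independent of n, which is the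
    value at 1 of linear maps from every push-forward of R to R (frobenius_functionals,
    homology_killed).  Hence this homology is a quotient of homology with coefficients in
    R / c R, which involves nonzero primes only and is of smaller order than q^d. *)

(** * Frobenius-stable subgroups *)

Section Stable.
Variables (R : comNzRingType) (p : nat) (V : lmodType R).
Implicit Types (A B C D : set V) (e : nat).

(** The scalar r acts on V by r ^ (p ^ e), so a stable set at level e is a
    submodule of the e-fold Frobenius push-forward of V: pushing forward changes
    the level and not the type.  Submodules and subquotients are plain sets, and
    no quotient module is ever formed. *)
Definition stable e A : Prop :=
  [/\ A 0, forall u v, A u -> A v -> A (u - v)
    & forall r v, A v -> A (r ^+ (p ^ e) *: v)].

Definition addS A B : set V := fun v => exists a b, [/\ A a, B b & v = a + b].

Lemma stable0 e A : stable e A -> A 0. Proof. by case. Qed.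
Lemma stableB e A u v : stable e A -> A u -> A v -> A (u - v).
Proof. by case=> _ h _; exact: h. Qed.
Lemma stableZ e A r v : stable e A -> A v -> A (r ^+ (p ^ e) *: v).
Proof. by case=> _ _; exact. Qed.
Lemma stableN e A u : stable e A -> A u -> A (- u).
Proof. by move=> sA Au; rewrite -sub0r; apply: (stableB sA) => //; exact: (stable0 sA). Qed.
Lemma stableD e A u v : stable e A -> A u -> A v -> A (u + v).
Proof. by move=> sA Au Av; rewrite -(opprK v); apply: (stableB sA) => //; exact: stableN sA _. Qed.
Lemma stable_sum e A (I : Type) (r : seq I) (P : pred I) (F : I -> V) :
  stable e A -> (forall i, P i -> A (F i)) -> A (\sum_(i <- r | P i) F i).
Proof.
by move=> sA AF; elim/big_ind: _ => //; [exact: (stable0 sA) | move=> u v; exact: (stableD sA)].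
Qed.
Lemma stableS e k A : stable e A -> stable (e + k) A.
Proof.
by case=> A0 AB AZ; split=> // r v Av; rewrite addnC expnD exprM; exact: AZ.
Qed.

Lemma stable_addS e A B : stable e A -> stable e B -> stable e (addS A B).
Proof.
move=> sA sB; split.
- by exists 0, 0; rewrite addr0; split=> //; [exact: (stable0 sA) | exact: (stable0 sB)].
- move=> _ _ [a [b [Aa Bb ->]]] [a' [b' [Aa' Bb' ->]]].
  by exists (a - a'), (b - b'); split; [exact: (stableB sA)|exact: (stableB sB)|rewrite opprD addrACA].
- move=> r _ [a [b [Aa Bb ->]]]; exists (r ^+ (p ^ e) *: a), (r ^+ (p ^ e) *: b).
  by split; [exact: (stableZ _ sA)|exact: (stableZ _ sB)|rewrite scalerDr].
Qed.

Lemma stable_setI e A B : stable e A -> stable e B -> stable e (A `&` B).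
Proof.
move=> [A0 AB AZ] [B0 BB BZ]; split; first by [].
- by move=> u v [? ?] [? ?]; split; [exact: AB | exact: BB].
- by move=> r v [? ?]; split; [exact: AZ | exact: BZ].
Qed.

Lemma stable_setT e : stable e setT. Proof. by []. Qed.

Lemma stable_zero e : stable e [set 0].
Proof.
split=> [|u v /= -> ->|r v /= ->]; first by [].
- by rewrite subr0.
- by rewrite scaler0.
Qed.

Lemma addS_subr e A B : stable e A -> B `<=` addS A B.
Proof. by move=> sA b Bb; exists 0, b; rewrite add0r; split=> //; exact: (stable0 sA). Qed.
Lemma addS_subl e A B : stable e B -> A `<=` addS A B.
Proof. by move=> sB a Aa; exists a, 0; rewrite addr0; split=> //; exact: (stable0 sB). Qed.
Lemma addS_least e A B C : stable e C -> A `<=` C -> B `<=` C -> addS A B `<=` C.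
Proof.
by move=> sC subA subB _ [a [b [Aa Bb ->]]]; apply: (stableD sC); [exact: subA | exact: subB].
Qed.
Lemma addS_idl e A B : stable e A -> stable e B -> B `<=` A -> addS A B = A.
Proof.
move=> sA sB BA; apply/seteqP; split; last exact: (addS_subl sB).
exact: (addS_least sA).
Qed.

End Stable.

(** * Chains and lengths localized at a prime *)

Section Chain.
Variables (R : comNzRingType) (p : nat) (Q : set R) (e : nat).

(** For a prime Q this says that the subquotient A / B of the push-forward does
    not vanish after localization at Q. *)
Definition nontorsion (V : lmodType R) (A B : set V) : Prop :=
  exists2 v, A v & forall s, ~ Q s -> ~ B (s ^+ (p ^ e) *: v).

Fixpoint chain (V : lmodType R) (n : nat) (A B : set V) : Prop :=
  if n is k.+1 then
    exists C, [/\ stable p e C, chain k C B, C `<=` A & nontorsion A C]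
  else B `<=` A.

(** The length of the localization at Q of the e-fold push-forward of A / B, read
    off from chains so that no localization is constructed.  For the maximal ideal
    of a local ring it is the ordinary length; for Q = 0 it is a rank. *)
Definition finlen (V : lmodType R) (A B : set V) : Prop :=
  exists b, forall n, chain n A B -> (n <= b)%N.

Definition len (V : lmodType R) (A B : set V) : nat :=
  nat_sup (fun n => chain n A B).

Section One.
Variable V : lmodType R.
Implicit Types (A B C D : set V).
Hypothesis Qmul : forall s t, ~ Q s -> ~ Q t -> ~ Q (s * t).

Lemma nontorsion_sub A A' B B' :
  A `<=` A' -> B' `<=` B -> nontorsion A B -> nontorsion A' B'.
Proof.
move=> AA BB [v Av h]; exists v; first exact: AA.
by move=> s Qs /BB; exact: h.
Qed.

Lemma chain_sub n A B : chain n A B -> B `<=` A.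
Proof.
elim: n A => [//|n IH] A /= [C [_ /IH BC CA _]] v /BC; exact: CA.
Qed.

Lemma chain_mono n A A' B B' :
  A `<=` A' -> B' `<=` B -> chain n A B -> chain n A' B'.
Proof.
elim: n A A' => [|n IH] A A' AA BB /=; first by move=> BA v /BB /BA /AA.
move=> [C [sC hC CA nt]]; exists C; split=> //.
- exact: IH hC.
- by move=> v /CA /AA.
- exact: nontorsion_sub nt.
Qed.

Lemma chain_cat n k A B C : chain n A B -> chain k B C -> chain (n + k) A C.
Proof.
elim: n A => [|n IH] A /=; first by move=> BA; apply: chain_mono.
by move=> [D [sD hD DA nt]] kBC; exists D; split=> //; exact: IH.
Qed.

(** If both traces were torsion, a multiple s v of v would be d + b with d in D and
    b in both A and B, and a further multiple would put b in D as well. *)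
Lemma nontorsion_split A B D :
  stable p e A -> stable p e B -> stable p e D -> D `<=` A -> nontorsion A D ->
  nontorsion (addS A B) (addS D B) \/ nontorsion (A `&` B) (D `&` B).
Proof.
move=> sA sB sD DA [v Av h].
have [n1|n1] := EM (nontorsion (addS A B) (addS D B)); first by left.
have [s Qs [a [b [Da Bb E]]]] :
    exists2 s, ~ Q s & addS D B (s ^+ (p ^ e) *: v).
  apply: contrapT => nex; apply: n1; exists v; first exact: (addS_subl sB).
  by move=> s Qs Ds; apply: nex; exists s.
right; exists b.
  split=> //; rewrite (_ : b = s ^+ (p ^ e) *: v - a); last by rewrite E addrC addKr.
  apply: (stableB sA) (DA _ Da); exact: (stableZ _ sA).
move=> t Qt [Dtb _]; apply: (h (t * s)); first exact: Qmul.
rewrite exprMn -scalerA E scalerDr; apply: (stableD sD) => //; exact: (stableZ _ sD).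
Qed.

(** Additivity of length, by the modular law: each step of a chain from C to A
    survives in its image in (A + B) / B or in its trace on A :&: B. *)
Lemma chain_split n A B C :
  stable p e A -> stable p e B -> stable p e C -> C `<=` B -> chain n A C ->
  exists n1 n2, [/\ (n <= n1 + n2)%N, chain n1 (addS A B) B & chain n2 (A `&` B) C].
Proof.
move=> sA sB sC CB; elim: n A sA => [|n IH] A sA /=.
  move=> CA; exists 0%N, 0%N; split=> //=; last by move=> v Cv; split; [exact: CA|exact: CB].
  exact: (addS_subr sA).
move=> [D [sD hD DA nt]]; have [n1 [n2 [le1 c1 c2]]] := IH D sD hD.
have sDA : addS D B `<=` addS A B.
  by move=> _ [a [b [Da Bb ->]]]; exists a, b; split=> //; exact: DA.
have sDI : D `&` B `<=` A `&` B by move=> v [/DA].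
case: (nontorsion_split sA sB sD DA nt) => nt'.
- exists n1.+1, n2; split; first by rewrite addSn ltnS.
    by exists (addS D B); split=> //; exact: stable_addS.
  exact: chain_mono c2.
- exists n1, n2.+1; split; first by rewrite addnS ltnS.
    exact: chain_mono c1.
  by exists (D `&` B); split=> //; exact: stable_setI.
Qed.

Lemma lenP A B : B `<=` A -> finlen A B ->
  chain (len A B) A B /\ forall n, chain n A B -> (n <= len A B)%N.
Proof.
move=> BA [b hb]; rewrite /len /nat_sup.
have [n [hn mx]] : exists n, chain n A B /\ forall k, chain k A B -> (k <= n)%N.
  pose P n := `[< chain n A B >].
  have exP : exists n, P n by exists 0%N; apply/asboolP.
  have bP n : P n -> (n <= b)%N by move=> /asboolP; exact: hb.
  case: (ex_maxnP exP bP) => n /asboolP hn mx; exists n; split=> // k hk.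
  by apply: mx; apply/asboolP.
by case: xgetP => [m -> [? ?]|/(_ n)]; [split | case; split].
Qed.

Lemma len_max A B n : finlen A B -> chain n A B -> (n <= len A B)%N.
Proof. by move=> fl h; apply: (lenP (chain_sub h) fl).2. Qed.

Lemma len_le A B b : B `<=` A -> (forall n, chain n A B -> (n <= b)%N) -> (len A B <= b)%N.
Proof. by move=> BA h; have [c _] := lenP BA (ex_intro _ b h); exact: h. Qed.

Lemma finlen_mono A A' B B' : A `<=` A' -> B' `<=` B -> finlen A' B' -> finlen A B.
Proof. by move=> AA BB [b h]; exists b => n /(chain_mono AA BB); exact: h. Qed.

Lemma len_mono A A' B B' : A `<=` A' -> B' `<=` B -> B `<=` A -> finlen A' B' ->
  (len A B <= len A' B')%N.
Proof.
move=> AA BB BA fl; apply: len_le => // n /(chain_mono AA BB); exact: len_max.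
Qed.

Lemma len_add A B C :
  stable p e A -> stable p e B -> stable p e C -> C `<=` B -> B `<=` A ->
  finlen A B -> finlen B C -> finlen A C /\ len A C = (len A B + len B C)%N.
Proof.
move=> sA sB sC CB BA f1 f2.
have CA : C `<=` A by move=> v /CB /BA.
have ub n : chain n A C -> (n <= len A B + len B C)%N.
  move=> h; have [n1 [n2 [le1]]] := chain_split sA sB sC CB h.
  rewrite (addS_idl sA sB BA) (_ : A `&` B = B); last exact/setIidPr.
  by move=> c1 c2; apply: (leq_trans le1); apply: leq_add; exact: len_max.
have fl : finlen A C by exists (len A B + len B C)%N.
split=> //; apply/eqP; rewrite eqn_leq; apply/andP; split; first exact: len_le.
by apply: len_max => //; apply: (chain_cat (B := B)); apply: (lenP _ _).1.
Qed.

Lemma torsion_chain n A B : ~ nontorsion A B -> chain n A B -> n = 0%N.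
Proof.
case: n => //= n nt [C [_ /chain_sub BC CA h]]; exfalso; apply: nt.
exact: nontorsion_sub h.
Qed.

Lemma torsion_len A B : B `<=` A -> ~ nontorsion A B -> finlen A B /\ len A B = 0%N.
Proof.
move=> BA nt; have h n : chain n A B -> (n <= 0)%N by move=> /(torsion_chain nt) ->.
by split; [exists 0%N | apply/eqP; rewrite -leqn0; exact: len_le].
Qed.

Lemma nontorsion_len A B : stable p e B -> B `<=` A -> finlen A B -> nontorsion A B ->
  (0 < len A B)%N.
Proof. by move=> sB BA fl nt; apply: len_max => //; exists B; split. Qed.

End One.
End Chain.

Section Iso.
Variables (R : comNzRingType) (p : nat) (Q : set R) (V W : lmodType R) (e e' : nat).
Variable f : V -> W.
Hypothesis fB : forall u v, f (u - v) = f u - f v.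
Hypothesis fZ : forall r v, f (r ^+ (p ^ e) *: v) = r ^+ (p ^ e') *: f v.
Implicit Types (A Y C : set V) (B X : set W).

Let f0 : f 0 = 0. Proof. by rewrite -(subrr 0) fB subrr. Qed.

Lemma stable_preim A B : stable p e A -> stable p e' B -> stable p e (A `&` f @^-1` B).
Proof.
move=> sA sB; apply: stable_setI => //; split=> /=.
- by rewrite f0; exact: (stable0 sB).
- by move=> u v ? ?; rewrite fB; exact: (stableB sB).
- by move=> r v ?; rewrite fZ; exact: (stableZ _ sB).
Qed.

Lemma stable_image A : stable p e A -> stable p e' (f @` A).
Proof.
move=> sA; split; first by exists 0; rewrite ?f0 //; exact: (stable0 sA).
- by move=> _ _ [u Au <-] [v Av <-]; exists (u - v); rewrite ?fB //; exact: (stableB sA).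
- by move=> r _ [v Av <-]; exists (r ^+ (p ^ e) *: v); rewrite ?fZ //; exact: (stableZ _ sA).
Qed.

(** Y = A :&: f^-1 B and X = f A + B, stated through membership. *)
Definition iso_data A Y X B := [/\ stable p e A, stable p e' B & stable p e' X] /\
  [/\ forall a, A a -> X (f a), B `<=` X,
      forall x, X x -> exists2 a, A a & B (x - f a) &
      forall v, Y v <-> A v /\ B (f v)].

Lemma chain_image n A Y X B : iso_data A Y X B ->
  chain p Q e' n X B -> chain p Q e n A Y.
Proof.
move=> [[sA sB sX] [AX BX XA YE]].
have gen n' A' X' : stable p e A' -> stable p e' X' -> X' `<=` X ->
    (forall v, A' v <-> A v /\ X' (f v)) ->
    chain p Q e' n' X' B -> chain p Q e n' A' Y.
  elim: n' A' X' => [|k IH] A' X' sA' sX' XX A'E /=.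
    by move=> BX' v /YE [Av Bv]; apply/A'E; split=> //; exact: BX'.
  move=> [C [sC hC CX [w X'w nt]]].
  exists (A `&` f @^-1` C); split; first exact: stable_preim.
  - apply: (IH _ C) => //; [exact: stable_preim | by move=> v /CX /XX].
  - by move=> v [Av /CX ?]; apply/A'E.
  have BC := chain_sub hC; have [a Aa Ba] := XA _ (XX _ X'w).
  have Cwa := BC _ Ba.
  exists a.
    apply/A'E; split=> //; rewrite -(opprK (f a)) -[X' _]/(X' _).
    rewrite (_ : - - f a = w - (w - f a)); last by rewrite opprB addrC subrK opprK.
    by apply: (stableB sX') => //; exact: CX.
  move=> s Qs [_ /=]; rewrite fZ => Cfa; apply: (nt s Qs).
  rewrite -(subrK (f a) w) scalerDr; apply: (stableD sC) => //; exact: (stableZ _ sC).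
by apply: gen => // v; split=> [Av|[]//]; split=> //; exact: AX.
Qed.

Lemma chain_preim n A Y X B : iso_data A Y X B ->
  chain p Q e n A Y -> chain p Q e' n X B.
Proof.
move=> [[sA sB sX] [AX BX XA YE]].
clear XA; elim: n A sA X sX AX BX YE => [//|n IH] A sA X sX AX BX YE /=.
move=> [C [sC hC CA [a Aa nt]]]; have YC := chain_sub hC.
exists (addS (f @` C) B); split.
- by apply: stable_addS => //; exact: stable_image.
- apply: IH hC => //.
  + by apply: stable_addS => //; exact: stable_image.
  + by move=> c Cc; apply: (addS_subl sB); exists c.
  + by apply: addS_subr; exact: (stable_image sC).
  + by move=> v; split=> [Yv|[Cv Bv]]; [split; [exact: YC|apply (YE v).1]|apply/YE; split=> //; exact: CA].
- by apply: (addS_least sX) => // _ [c Cc <-]; exact/AX/CA.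
exists (f a); first exact: AX.
move=> s Qs [_ [b [[c Cc <-] Bb]]]; rewrite -fZ => E; apply: (nt s Qs).
rewrite -(subrK c (_ *: a)); apply: (stableD sC) => //; apply: YC; apply/YE; split.
  by apply: (stableB sA); [exact: (stableZ _ sA) | exact: CA].
by rewrite fB E addrC addKr.
Qed.

(** The isomorphism A / (A :&: f^-1 B) = (f A + B) / B, for f semilinear between two
    levels.  It serves as second isomorphism theorem (f the identity), for connecting
    homomorphisms (f a differential) and for Frobenius (f r = r ^ (p ^ e) u). *)
Lemma len_iso A Y X B : iso_data A Y X B ->
  len p Q e A Y = len p Q e' X B /\ (finlen p Q e A Y <-> finlen p Q e' X B).
Proof.
move=> h; have E : (fun n => chain p Q e n A Y) = (fun n => chain p Q e' n X B).
  by apply/funext => n; apply/propext; split; [exact: chain_preim | exact: chain_image].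
by split; [rewrite /len E | rewrite /finlen; split=> -[b hb]; exists b => n hn; apply: hb;
   [rewrite -[chain _ _ _ _ _ _]/((fun n => chain p Q e n A Y) n) E
   |rewrite -[chain _ _ _ _ _ _]/((fun n => chain p Q e' n X B) n) -E]].
Qed.

End Iso.

(** * Noetherian induction on Frobenius-stable subgroups *)

Section Noetherian.
Variables (R : comNzRingType) (p : nat) (chR : p \in [pchar R]).

Section Span.
Variables (V : lmodType R) (e : nat).
Implicit Types (A B : set V) (l : seq V).

Definition fspan l : set V := fun v =>
  forall B, stable p e B -> (forall u, u \in l -> B u) -> B v.

Lemma stable_fspan l : stable p e (fspan l).
Proof.
split=> [B sB _|u v hu hv B sB lB|r v hv B sB lB].
- exact: (stable0 sB).
- by apply: (stableB sB); [exact: hu | exact: hv].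
- by apply: (stableZ _ sB); exact: hv.
Qed.

Lemma mem_fspan l v : v \in l -> fspan l v.
Proof. by move=> lv B _; exact. Qed.

Lemma fspan_least l B : stable p e B -> (forall u, u \in l -> B u) -> fspan l `<=` B.
Proof. by move=> sB lB v; exact. Qed.

Lemma fspan_mono l l' : {subset l <= l'} -> fspan l `<=` fspan l'.
Proof. by move=> ll; apply: fspan_least; [exact: stable_fspan | move=> u /ll; exact: mem_fspan]. Qed.

Lemma stable_line_add A g : stable p e A ->
  stable p e (fun v => exists r, A (v - r ^+ (p ^ e) *: g)).
Proof.
move=> sA; split.
- by exists 0; rewrite (frob0 chR) scale0r subr0; exact: (stable0 sA).
- move=> u v [r hr] [s hs]; exists (r - s).
  rewrite (frobD chR) (frobN chR) scalerDl scaleNr opprD addrACA -opprD.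
  exact: (stableB sA).
- move=> r v [s hs]; exists (r * s); rewrite exprMn -scalerA -scalerBr; exact: (stableZ _ sA).
Qed.

Lemma fspan_consP g l v :
  fspan (g :: l) v <-> exists r, fspan l (v - r ^+ (p ^ e) *: g).
Proof.
split.
  apply: (fspan_least (B := fun v => exists r, fspan l (v - r ^+ (p ^ e) *: g))).
    by apply: stable_line_add; exact: stable_fspan.
  move=> u; rewrite inE => /orP[/eqP ->|lu].
    by exists 1; rewrite expr1n scale1r subrr; exact: (stable0 (stable_fspan _)).
  by exists 0; rewrite (frob0 chR) scale0r subr0; exact: mem_fspan.
move=> [r h]; rewrite -(subrK (r ^+ (p ^ e) *: g) v).
apply: (stableD (stable_fspan _)).
  by apply: (fspan_mono _ h) => u lu; rewrite inE lu orbT.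
by apply: (stableZ _ (stable_fspan _)); apply: mem_fspan; rewrite mem_head.
Qed.

Definition fgen A : Prop := exists l, A = fspan l.

Lemma fgenP A l : stable p e A -> (forall u, u \in l -> A u) -> A `<=` fspan l -> fgen A.
Proof. by move=> sA lA Al; exists l; apply/seteqP; split=> //; exact: fspan_least. Qed.

End Span.

Lemma scaler_regular (r x : R) : r *: (x : R^o) = r * x. Proof. by []. Qed.

Hypothesis noeth : forall J : set R^o, stable p 0 J -> fgen 0 J.

(** Induction on the generators: the coefficients of the first one along A form an
    ideal, and finitely many of them, together with generators of the part of A
    spanned by the others, generate A. *)
Theorem noetherian_span (V : lmodType R) e (l : seq V) (A : set V) :
  stable p e A -> A `<=` fspan e l -> fgen e A.
Proof.
elim: l A => [|g l IH] A sA Al.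
  by exists [::]; apply/seteqP; split=> //; exact: fspan_least.
pose A0 := A `&` fspan e l.
have sA0 : stable p e A0 by apply: stable_setI => //; exact: stable_fspan.
have [l0 E0] : fgen e A0 by apply: IH => // v [].
pose J : set R^o := fun r => exists2 a, A a & fspan e l (a - r ^+ (p ^ e) *: g).
have sl := @stable_fspan V e l.
have sJ : stable p 0 J.
  split.
  - by exists 0; [exact: (stable0 sA)|rewrite (frob0 chR) scale0r subr0; exact: (stable0 sl)].
  - move=> r s [a Aa ha] [b Ab hb]; exists (a - b); first exact: (stableB sA).
    rewrite (frobD chR) (frobN chR) scalerDl scaleNr opprD addrACA -opprD.
    exact: (stableB sl).
  - move=> r s [a Aa ha]; exists (r ^+ (p ^ e) *: a); first exact: (stableZ _ sA).
    by rewrite expn0 expr1 scaler_regular exprMn -scalerA -scalerBr; exact: (stableZ _ sl).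
have [lJ EJ] := noeth sJ.
have [l1 [hl1 hJ1]] : exists l1 : seq V, (forall u, u \in l1 -> A u) /\
    forall r, r \in lJ -> exists2 a, a \in l1 & fspan e l (a - r ^+ (p ^ e) *: g).
  have : forall r, r \in lJ -> J r by move=> r; rewrite EJ; exact: mem_fspan.
  elim: lJ {EJ} => [_|r lJ IHJ hlJ]; first by exists [::].
  have [l1 [h1 h2]] : exists l1 : seq V, (forall u, u \in l1 -> A u) /\
      forall r, r \in lJ -> exists2 a, a \in l1 & fspan e l (a - r ^+ (p ^ e) *: g).
    by apply: IHJ => s sl'; apply: hlJ; rewrite inE sl' orbT.
  have [a Aa ha] := hlJ r (mem_head _ _).
  exists (a :: l1); split=> [u|s]; rewrite inE => /orP[/eqP ->|] //; first exact: h1.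
    by exists a; rewrite ?mem_head.
  by move=> /h2[b bl hb]; exists b; rewrite // inE bl orbT.
apply: (fgenP (l := l0 ++ l1)) => //.
  move=> u; rewrite mem_cat => /orP[ul|]; last exact: hl1.
  by have [] : A0 u by rewrite E0; exact: mem_fspan.
have sT := @stable_fspan V e (l0 ++ l1).
have key : forall r, J r -> exists2 a, fspan e (l0 ++ l1) a & A a /\ fspan e l (a - r ^+ (p ^ e) *: g).
  move=> r; rewrite EJ; move: r; apply: fspan_least => [|r /hJ1[a al ha]].
    split.
    - by exists 0; [exact: (stable0 sT)|split; [exact: (stable0 sA)|rewrite (frob0 chR) scale0r subr0; exact: (stable0 sl)]].
    - move=> r s [a Ta [Aa ha]] [b Tb [Ab hb]]; exists (a - b); first exact: (stableB sT).
      split; first exact: (stableB sA).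
      by rewrite (frobD chR) (frobN chR) scalerDl scaleNr opprD addrACA -opprD; exact: (stableB sl).
    - move=> r s [a Ta [Aa ha]]; exists (r ^+ (p ^ e) *: a); first exact: (stableZ _ sT).
      split; first exact: (stableZ _ sA).
      by rewrite expn0 expr1 scaler_regular exprMn -scalerA -scalerBr; exact: (stableZ _ sl).
  exists a; first by apply: mem_fspan; rewrite mem_cat al orbT.
  by split=> //; exact: hl1.
move=> v Av; have [r hr] := (fspan_consP e g l v).1 (Al _ Av).
have [a Ta [Aa ha]] := key r (ex_intro2 _ _ v Av hr).
rewrite -(subrK a v); apply: (stableD sT) => //.
have : A0 (v - a).
  split; first exact: (stableB sA).
  rewrite -(subrKA (r ^+ (p ^ e) *: g)) -[r ^+ (p ^ e) *: g - a]opprB.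
  exact: (stableB sl).
by rewrite E0; apply: fspan_mono => u ul; rewrite mem_cat ul.
Qed.

Section Induction.
Variables (V : lmodType R) (e : nat) (l : seq V).
Hypothesis lT : forall v, fspan e l v.

Lemma no_ascending (F : nat -> set V) :
  (forall n, stable p e (F n)) -> (forall n, F n `<=` F n.+1) ->
  exists n, F n.+1 `<=` F n.
Proof.
move=> sF incF.
have mono n k : F n `<=` F (n + k)%N.
  by elim: k => [|k IH]; rewrite ?addn0 // addnS => v /IH; exact: incF.
pose U : set V := fun v => exists n, F n v.
have sU : stable p e U.
  split; first by exists 0%N; exact: (stable0 (sF _)).
  - move=> u v [n hn] [k hk]; exists (n + k)%N; apply: (stableB (sF _)); first exact: mono.
    by rewrite addnC; exact: mono.
  - by move=> r v [n hn]; exists n; exact: (stableZ _ (sF _)).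
have [lU EU] : fgen e U by apply: (noetherian_span (l := l)).
have [n hn] : exists n, forall u, u \in lU -> F n u.
  have : forall u, u \in lU -> U u by move=> u; rewrite EU; exact: mem_fspan.
  elim: lU {EU} => [_|u lU IH h]; first by exists 0%N.
  have [n hn] : exists n, forall u, u \in lU -> F n u.
    by apply: IH => v vl; apply: h; rewrite inE vl orbT.
  have [k hk] := h u (mem_head _ _).
  exists (n + k)%N => v; rewrite inE => /orP[/eqP ->|/hn]; last exact: mono.
  by rewrite addnC; exact: mono.
exists n => v hv; have : U v by exists n.+1.
by rewrite EU; exact: fspan_least.
Qed.

Lemma noeth_ind (P : set V -> Prop) :
  (forall N, stable p e N ->
     (forall N', stable p e N' -> N `<=` N' -> ~ N' `<=` N -> P N') -> P N) ->
  forall N, stable p e N -> P N.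
Proof.
move=> step N0 sN0; apply: contrapT => nP0.
pose T := {N : set V | stable p e N /\ ~ P N}.
have next (N : T) : exists N' : T, sval N `<=` sval N' /\ ~ sval N' `<=` sval N.
  case: N => N [sN nP] /=; apply: contrapT => h; apply: nP; apply: step => // N' sN' NN' nN'.
  by apply: contrapT => nP'; apply: h; exists (exist _ N' (conj sN' nP')).
pose nx (N : T) : T := sval (cid (next N)).
pose F n := sval (iter n nx (exist _ N0 (conj sN0 nP0))).
have FE n : F n `<=` F n.+1 /\ ~ F n.+1 `<=` F n by rewrite /F iterS /nx; case: cid.
have [|n] := @no_ascending F _ (fun n => (FE n).1); last by have [] := FE n.
by move=> n; rewrite /F; case: (iter n nx _) => ? [].
Qed.

End Induction.
End Noetherian.

(** * Prime filtrations *)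

Section PrimeFiltration.
Variables (R : comNzRingType) (p : nat) (chR : p \in [pchar R]).
Implicit Types (P Q J N : set R^o).
Local Notation chain := (@chain R p).
Local Notation nontorsion := (@nontorsion R p).
Local Notation finlen := (@finlen R p).
Local Notation len := (@len R p).

Definition primeS P : Prop :=
  [/\ stable p 0 P, ~ P 1 & forall a b : R, P (a * b) -> P a \/ P b].

Lemma prime_mul P : primeS P -> forall s t : R, ~ P s -> ~ P t -> ~ P (s * t).
Proof. by move=> [_ _ h] s t ns nt /h []. Qed.

Lemma prime_exp P : primeS P -> forall (s : R) n, P (s ^+ n) -> P s.
Proof.
move=> [_ P1 h] s; elim=> [|n IH]; first by rewrite expr0.
by rewrite exprS => /h [//|/IH].
Qed.

Lemma stable0M J : stable p 0 J -> forall a b : R, J b -> J (a * b).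
Proof. by move=> sJ a b Jb; have := stableZ a sJ Jb; rewrite expn0 expr1. Qed.

Lemma stable_ideal e J : stable p 0 J -> stable p e J.
Proof. exact: (@stableS _ _ _ 0). Qed.

Section Colon.
Variables (V : lmodType R) (e : nat).
Implicit Types (C : set V) (v : V).

(** The cyclic quotient (adjoin C v) / C is the push-forward of R / (colon C v). *)
Definition colon C v : set R^o := fun r => C (r ^+ (p ^ e) *: v).
Definition adjoin C v : set V := fun x => exists r : R, C (x - r ^+ (p ^ e) *: v).

Lemma stable_colon C v : stable p e C -> stable p 0 (colon C v).
Proof.
move=> sC; split; rewrite /colon.
- by rewrite (frob0 chR) scale0r; exact: (stable0 sC).
- move=> r s hr hs; rewrite (frobD chR) (frobN chR) scalerDl scaleNr; exact: (stableB sC).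
- move=> r s hs; rewrite expn0 expr1 scaler_regular exprMn -scalerA; exact: (stableZ _ sC).
Qed.

Lemma stable_adjoin C v : stable p e C -> stable p e (adjoin C v).
Proof. exact: stable_line_add. Qed.

Lemma sub_adjoin C v : C `<=` adjoin C v.
Proof. by move=> x Cx; exists 0; rewrite (frob0 chR) scale0r subr0. Qed.

Lemma mem_adjoin C v : stable p e C -> adjoin C v v.
Proof. by move=> sC; exists 1; rewrite expr1n scale1r subrr; exact: (stable0 sC). Qed.

Lemma len_adjoin Q k C v : stable p e C ->
  len Q k setT (colon C v) = len Q (k + e) (adjoin C v) C /\
  (finlen Q k setT (colon C v) <-> finlen Q (k + e) (adjoin C v) C).
Proof.
move=> sC; apply: (@len_iso R p Q R^o V k (k + e) (fun r => r ^+ (p ^ e) *: v)).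
- by move=> r s; rewrite (frobD chR) (frobN chR) scalerDl scaleNr.
- by move=> r s; rewrite scaler_regular exprMn -exprM -expnD scalerA.
split; first split=> //.
- by rewrite addnC; exact: stableS.
- by rewrite addnC; apply: stableS; exact: stable_adjoin.
split.
- by move=> r _; exists r; rewrite subrr; exact: (stable0 sC).
- exact: sub_adjoin.
- by move=> x [r hr]; exists r.
- by move=> r; split=> [|[]].
Qed.

End Colon.

Lemma len_prime Q : primeS Q -> finlen Q 0 setT Q /\ len Q 0 setT Q = 1%N.
Proof.
move=> pQ; have [sQ Q1 _] := pQ.
have ub n : chain Q 0 n setT Q -> (n <= 1)%N.
  case: n => [//|[//|n]] /= [C [sC [D [sD hD DC [v Cv nv]]] _ [w _ nw]]]; exfalso.
  have Qv : ~ Q v.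
    by move=> Qv; apply: (nv 1) => //; rewrite expr1n scale1r; exact: (chain_sub hD).
  by apply: (nw v Qv); rewrite expn0 expr1 scaler_regular mulrC; exact: stable0M.
have fl : finlen Q 0 setT Q by exists 1%N.
split=> //; apply/eqP; rewrite eqn_leq len_le //=; apply: len_max => //=.
exists Q; split=> //; exists 1 => // s nQs; rewrite expn0 expr1 scaler_regular mulr1 => /nQs; exact.
Qed.

Lemma torsion_ideal Q e J s : stable p 0 J -> J s -> ~ Q s ->
  ~ nontorsion Q e setT J.
Proof.
move=> sJ Js nQs [v _ /(_ s nQs)]; apply; rewrite scaler_regular mulrC.
rewrite -(prednK (n := p ^ e)%N); first by rewrite exprSr mulrA; exact: stable0M.
by rewrite expn_gt0 prime_gt0 // (pcharf_prime chR).
Qed.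

Lemma len_torsion_ideal Q e J s : stable p 0 J -> J s -> ~ Q s ->
  finlen Q e setT J /\ len Q e setT J = 0%N.
Proof. by move=> sJ Js Qs; apply: torsion_len => //; exact: torsion_ideal Js Qs. Qed.

(** A filtration of R / N, at level e, whose successive quotients are the
    push-forwards of the R / P for P in the list. *)
Fixpoint pfilt e N (l : seq (set R^o)) : Prop :=
  if l is P :: l' then
    exists u, [/\ P = colon e N u, primeS P & pfilt e (adjoin e N u) l']
  else N = setT.

Lemma pfilt_prime e N l P : pfilt e N l -> P \in l -> primeS P.
Proof.
elim: l N => [//|P' l IH] N /= [u [_ pP' hl]]; rewrite inE => /orP[/eqP -> //|].
exact: IH hl.
Qed.

Lemma pfilt_contains e N l P (r : R) : pfilt e N l -> P \in l ->
  (forall x : R^o, N (r ^+ (p ^ e) *: x)) -> P r.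
Proof.
elim: l N => [//|P' l IH] N /= [u [-> _ hl]]; rewrite inE => /orP[/eqP ->|lP] h; first exact: h.
by apply: IH hl lP _ => x; exact: sub_adjoin.
Qed.

Lemma pfilt_sup e J l P : pfilt e J l -> stable p 0 J -> P \in l -> J `<=` P.
Proof.
move=> hl sJ lP r Jr; apply: (pfilt_contains hl lP) => x.
rewrite scaler_regular mulrC -(prednK (n := p ^ e)%N); first by rewrite exprSr mulrA; exact: stable0M.
by rewrite expn_gt0 prime_gt0 // (pcharf_prime chR).
Qed.

Hypothesis noeth : forall J : set R^o, stable p 0 J -> fgen p 0 J.

Lemma regular_gen (v : R^o) : fspan p 0 [:: (1 : R^o)] v.
Proof.
rewrite -[v]mulr1 -scaler_regular -[v in v *: _]expr1 -(expn0 p).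
by apply: (stableZ _ (stable_fspan _ _ _)); apply: mem_fspan; rewrite mem_head.
Qed.

(** A maximal member among the annihilators colon e N u, u outside N, is prime. *)
Lemma prime_colon e N : stable p e N -> N != setT -> exists u, primeS (colon e N u).
Proof.
move=> sN NT; have [u0 Nu0] : exists u, ~ N u.
  apply: contrapT => h; move/eqP: NT; apply; apply/seteqP; split=> // u _.
  by apply: contrapT => nu; apply: h; exists u.
suff : forall J, stable p 0 J -> forall u, ~ N u -> colon e N u = J ->
    exists u, primeS (colon e N u).
  by move=> /(_ _ (stable_colon u0 sN) u0 Nu0 erefl).
apply: (noeth_ind chR noeth regular_gen) => J sJ IH u nNu EJ.
have [h|/existsNP[a /existsNP[b /not_implyP[Nab /not_orP[Na Nb]]]]] :=
  EM (forall a b : R, colon e N u (a * b) -> colon e N u a \/ colon e N u b).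
  by exists u; split=> //; [exact: stable_colon | rewrite /colon expr1n scale1r].
apply: (IH (colon e N (b ^+ (p ^ e) *: u))) Nb erefl.
- exact: stable_colon.
- rewrite -EJ => r hr; rewrite /colon scalerA mulrC -scalerA; exact: (stableZ _ sN).
- by move=> h; apply: Na; rewrite EJ; apply: h; rewrite /colon scalerA -exprMn.
Qed.

Lemma pfilt_exists e (g : seq R^o) : (forall v, fspan p e g v) ->
  forall N, stable p e N -> exists l, pfilt e N l.
Proof.
move=> gT; apply: (noeth_ind chR noeth gT) => N sN IH.
have [->|NT] := eqVneq N setT; first by exists [::].
have [u pu] := prime_colon sN NT.
have [|l hl] := IH _ (stable_adjoin u sN) (@sub_adjoin _ _ _ u).
  move=> h; have [_ u1 _] := pu; apply: u1; rewrite /colon expr1n scale1r.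
  by apply: h; exact: mem_adjoin.
by exists (colon e N u :: l), u.
Qed.

Lemma pfilt_len Q k e N l : primeS Q -> pfilt e N l -> stable p e N ->
  (forall P, P \in l -> finlen Q k setT P) ->
  finlen Q (k + e) setT N /\
  len Q (k + e) setT N = (\sum_(P <- l) len Q k setT P)%N.
Proof.
move=> pQ; have Qm := prime_mul pQ; elim: l N => [|P l IH] N /=.
  move=> -> _ _; rewrite big_nil; apply: torsion_len => // -[v _ /(_ 1)]; apply=> //.
  by case: pQ.
move=> [u [EP pP hl]] sN fl; rewrite big_cons.
have sA := stable_adjoin u sN.
have [|f1 E1] := IH _ hl sA; first by move=> P' lP'; apply: fl; rewrite inE lP' orbT.
have [E2 f2] := len_adjoin Q k u sN; rewrite -EP in E2 f2.
have f2' := f2.1 (fl P (mem_head _ _)).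
have sk (C : set R^o) : stable p e C -> stable p (k + e) C by rewrite addnC; exact: stableS.
have [fT ET] := len_add Qm (@stable_setT R p R^o (k + e)) (sk _ sA) (sk _ sN) (@sub_adjoin _ e N u) (@subsetT _ _) f1 f2'.
by split=> //; rewrite ET E1 E2 addnC.
Qed.

End PrimeFiltration.

(** * Ranks of Frobenius and scaling of lengths *)

Section Scaling.
Variables (R : comNzRingType) (p : nat) (chR : p \in [pchar R]).
Variables (Q : set R^o).
Local Notation chain := (@chain R p).
Local Notation nontorsion := (@nontorsion R p).
Local Notation finlen := (@finlen R p).
Local Notation len := (@len R p).
Hypothesis pQ : primeS p Q.
Let Qm := prime_mul pQ.

Lemma nontorsion_up (V : lmodType R) e (A B : set V) :
  stable p e B -> nontorsion Q e.+1 A B -> nontorsion Q e A B.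
Proof.
move=> sB [v Av h]; exists v => // s Qs Bs; apply: (h s Qs).
have p0 : (0 < p)%N by rewrite prime_gt0 // (pcharf_prime chR).
have -> : s ^+ (p ^ e.+1) = (s ^+ p.-1) ^+ (p ^ e) * s ^+ (p ^ e).
  by rewrite -exprM -exprD; congr (_ ^+ _); rewrite expnS -{1}(prednK p0) mulSn addnC.
by rewrite -scalerA; exact: (stableZ _ sB).
Qed.

(** The rank of the Frobenius push-forward of R / Q over R / Q; for the maximal
    ideal it is the degree [k : k^p] of the residue field over its p-th powers. *)
Definition rho : nat := len Q 1 setT Q.
Hypothesis finQ : finlen Q 1 setT Q.

(** One application of Frobenius multiplies the length at Q by rho.  Up to torsion a
    module of length 1 at Q is a copy of R / Q, for which this is the definition of
    rho; the general case follows along a maximal chain. *)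
Lemma len_scale1 (V : lmodType R) e (A B : set V) :
  stable p e A -> stable p e B -> B `<=` A -> finlen Q e A B ->
  finlen Q e.+1 A B /\ len Q e.+1 A B = (rho * len Q e A B)%N.
Proof.
move=> sA sB; have [n] := ubnP (len Q e A B); elim: n A sA => // n IH A sA; rewrite ltnS => ln BA fl.
have S1 (C : set V) : stable p e C -> stable p e.+1 C by rewrite -addn1; exact: stableS.
have [hch _] := lenP BA fl.
have [nt0|nt0] := EM (nontorsion Q e A B); last first.
  have [_ E0] := torsion_len BA nt0; rewrite E0 muln0; apply: torsion_len => // h.
  exact/nt0/nontorsion_up.
have := nontorsion_len sB BA fl nt0; case E : (len Q e A B) => [//|k] _.
move: hch; rewrite E /= => -[C [sC hC CA [v Av nv]]].
have BC := chain_sub hC.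
have ntAC : nontorsion Q e A C by exists v.
have flAC : finlen Q e A C by apply: finlen_mono fl.
have flCB : finlen Q e C B by apply: finlen_mono fl.
have [_ E1] := len_add Qm sA sC sB BC CA flAC flCB.
have ltAC := nontorsion_len sC CA flAC ntAC.
have leCB := len_max flCB hC.
have ECB : len Q e C B = k by lia.
have EAC : len Q e A C = 1%N by lia.
have {E1 leCB ltAC} [f1 E1] := IH C sC ltac:(lia) BC flCB.
pose X := adjoin p e C v; have sX : stable p e X := stable_adjoin chR v sC.
have CX : C `<=` X := @sub_adjoin _ _ chR _ e C v.
have XA : X `<=` A.
  move=> x [r hr]; rewrite -(subrK (r ^+ (p ^ e) *: v) x).
  by apply: (stableD sA); [exact: CA | exact: (stableZ _ sA)].
have flAX : finlen Q e A X by apply: finlen_mono flAC.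
have flXC : finlen Q e X C by apply: finlen_mono flAC.
have [_ E2] := len_add Qm sA sX sC CX XA flAX flXC.
have ntXC : nontorsion Q e X C by exists v => //; exact: mem_adjoin.
have ltXC := nontorsion_len sC CX flXC ntXC.
have EXC : len Q e X C = 1%N by lia.
have EAX : len Q e A X = 0%N by lia.
pose J := colon p e C v; have sJ : stable p 0 J := stable_colon chR v sC.
have JQ : J `<=` Q by move=> r Jr; apply: contrapT => /nv; apply.
have [F0 fF0] := len_adjoin chR Q 0 v sC; rewrite add0n -/J -/X EXC in F0 fF0.
have flTJ := fF0.2 flXC.
have [flTQ ETQ] := len_prime pQ.
have flQJ : finlen Q 0 Q J by apply: finlen_mono flTJ.
have sQ : stable p 0 Q by case: pQ.
have [_ E3] := len_add Qm (@stable_setT R p R^o 0) sQ sJ JQ (@subsetT _ _) flTQ flQJ.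
rewrite F0 ETQ in E3.
have ntQJ : ~ nontorsion Q 0 Q J by move=> /(nontorsion_len sJ JQ flQJ); move: E3; rewrite add1n => -[<-].
have [f4 E4] : finlen Q 1 Q J /\ len Q 1 Q J = 0%N.
  by apply: torsion_len => // /(nontorsion_up sJ).
have [f5 E5] := len_add Qm (@stable_setT R p R^o 1) (stable_ideal 1 sQ) (stable_ideal 1 sJ) JQ (@subsetT _ _) finQ f4.
have [F1 fF1] := len_adjoin chR Q 1 v sC; rewrite -/J -/X E5 E4 addn0 -/rho add1n in F1 fF1.
have [f6 E6] : finlen Q e.+1 A X /\ len Q e.+1 A X = 0%N.
  by apply: torsion_len => // /(nontorsion_up sX) /(nontorsion_len sX XA flAX); rewrite EAX.
have [f7 E7] := len_add Qm (S1 _ sA) (S1 _ sX) (S1 _ sC) CX XA f6 (fF1.1 f5).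
have [f8 E8] := len_add Qm (S1 _ sA) (S1 _ sC) (S1 _ sB) BC CA f7 f1.
by split=> //; rewrite E8 E7 E1 E6 -F1 ECB add0n mulnS.
Qed.

Lemma len_scale (V : lmodType R) n (A B : set V) :
  stable p 0 A -> stable p 0 B -> B `<=` A -> finlen Q 0 A B ->
  finlen Q n A B /\ len Q n A B = (rho ^ n * len Q 0 A B)%N.
Proof.
move=> sA sB BA fl; elim: n => [|n [f E]]; first by rewrite mul1n.
have [f' E'] := len_scale1 (stableS n sA) (stableS n sB) BA f.
by rewrite E' E expnS mulnA.
Qed.

End Scaling.

Section Rho.
Variables (R : comNzRingType) (p : nat) (chR : p \in [pchar R]).
Local Notation finlen := (@finlen R p).
Local Notation len := (@len R p).
Local Notation rho := (@rho R p).

(** At Q the factors R / P with P not contained in Q vanish, so that the length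
    counts the occurrences of Q. *)
Lemma len_filtration (J Q : set R^o) e l : stable p 0 J -> primeS p Q ->
  pfilt p e J l -> (forall P, P \in l -> P = Q \/ ~ P `<=` Q) ->
  finlen Q e setT J /\ len Q e setT J = count_mem Q l.
Proof.
move=> sJ pQ hl lQ.
have lP P : P \in l -> finlen Q 0 setT P /\ len Q 0 setT P = (P == Q).
  move=> Pl; have [->|PQ] := lQ _ Pl; first by rewrite eqxx; exact: len_prime.
  have [PP _ _] := pfilt_prime hl Pl.
  have [s Ps Qs] : exists2 s, P s & ~ Q s.
    by apply: contrapT => h; apply: PQ => s Ps; apply: contrapT => Qs; apply: h; exists s.
  have [? ->] := len_torsion_ideal chR 0 PP Ps Qs; split=> //.
  by case: eqP PQ => // -> h; exfalso; exact: h.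
have [f E] := pfilt_len chR (k := 0) pQ hl (stable_ideal e sJ) (fun P Pl => (lP P Pl).1).
split=> //; rewrite add0n in E; rewrite E -sum1_count [RHS]big_mkcond /=.
by apply: eq_big_seq => P /lP[_ ->]; case: eqP.
Qed.

Lemma rho_filtration (Q : set R^o) l : primeS p Q -> pfilt p 1 Q l ->
  finlen Q 1 setT Q /\ rho Q = count_mem Q l.
Proof.
move=> pQ hl; have [sQ _ _] := pQ; apply: len_filtration => // P Pl.
have [PQ|PQ] := EM (P `<=` Q); [left | by right].
by apply/seteqP; split=> //; exact: (pfilt_sup chR hl).
Qed.
End Rho.

(** * Homology lengths of Frobenius twists of a free complex *)

Section FrobeniusMatrix.
Variables (R : comNzRingType) (p : nat) (chR : p \in [pchar R]).

Lemma frob_sum (I : Type) (r : seq I) (P : pred I) (F : I -> R) n :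
  (\sum_(i <- r | P i) F i) ^+ (p ^ n) = \sum_(i <- r | P i) F i ^+ (p ^ n).
Proof.
exact: (big_morph (fun x : R => x ^+ (p ^ n)) (fun x y => frobD chR x y n) (frob0 chR n)).
Qed.

Definition fmx n a b (A : 'M[R]_(a, b)) : 'M[R]_(a, b) := map_mx (fun x => x ^+ (p ^ n)) A.

Lemma fmxM n a b c (A : 'M[R]_(a, b)) (B : 'M[R]_(b, c)) : fmx n (A *m B) = fmx n A *m fmx n B.
Proof.
by apply/matrixP => i j; rewrite !mxE frob_sum; apply: eq_bigr => k _; rewrite !mxE exprMn.
Qed.

Lemma fmx0 n a b : fmx n (0 : 'M[R]_(a, b)) = 0.
Proof. by apply/matrixP => i j; rewrite !mxE (frob0 chR). Qed.

Lemma fmxD n a b (A B : 'M[R]_(a, b)) : fmx n (A + B) = fmx n A + fmx n B.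
Proof. by apply/matrixP => i j; rewrite !mxE (frobD chR). Qed.

Lemma fmx_scalar n a (x : R) : fmx n (x%:M : 'M[R]_a) = (x ^+ (p ^ n))%:M.
Proof.
by apply/matrixP => i j; rewrite !mxE; case: (i == j); rewrite ?mulr1n ?mulr0n ?(frob0 chR).
Qed.
End FrobeniusMatrix.

Section Homology.
Variables (R : comNzRingType) (p : nat) (chR : p \in [pchar R]).
Variables (b : nat -> nat) (d : forall i, 'M[R]_(b i.+1, b i)).
Hypothesis dd : forall i, d i.+1 *m d i = 0.
Implicit Types (N P : set R^o).
Local Notation chain := (@chain R p).
Local Notation finlen := (@finlen R p).
Local Notation len := (@len R p).
Local Notation stable e N := (@stable R p _ e N).
Local Notation fmx := (@fmx R p).

Let ddF n i : fmx n (d i.+1) *m fmx n (d i) = 0.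
Proof. by rewrite -(fmxM chR) dd (fmx0 chR). Qed.

Definition coords N k : set 'rV[R]_k := fun v => forall j, N (v 0 j).

Lemma stable_coords e N k : stable e N -> stable e (@coords N k).
Proof.
move=> sN; split=> [j|u v hu hv j|r v hv j]; rewrite !mxE.
- exact: (stable0 sN).
- by apply: (stableB sN); [exact: hu | exact: hv].
- exact: (stableZ _ sN (hv j)).
Qed.

Arguments stable_coords {e N k} sN.

Lemma coords_sub N N' k : N `<=` N' -> @coords N k `<=` @coords N' k.
Proof. by move=> NN v hv j; exact: NN. Qed.

Lemma coords_mul e n N a c (A : 'M[R]_(a, c)) (v : 'rV_a) : stable e N ->
  coords N v -> coords N (v *m fmx (n + e) A).
Proof.
move=> sN hv j; rewrite mxE; apply: (stable_sum _ sN) => k _.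
rewrite mxE expnD exprM mulrC; exact: (stableZ _ sN (hv k)).
Qed.

(** Cycles and boundaries in degree i + 1 of the n-th Frobenius twist of the complex
    with coefficients in N' / N; for ideals N and N' this is the twist tensored with
    N' / N.  Complexes will have b 0 = 0, so that homology at i = 0, in degree 1, is a
    cokernel and obeys the same formula as the other degrees. *)
Definition cyc n N' N i : set 'rV[R]_(b i.+1) :=
  fun v => coords N' v /\ coords N (v *m fmx n (d i)).
Definition bnd n N' N i : set 'rV[R]_(b i.+1) :=
  fun v => exists2 w, coords N' w & coords N (v - w *m fmx n (d i.+1)).

Arguments cyc n N' N i _ : clear implicits.
Arguments bnd n N' N i _ : clear implicits.

Definition hlen Q e n N' N i : nat := len Q e (cyc n N' N i) (bnd n N' N i).
Definition hfin Q e n N' N i : Prop := finlen Q e (cyc n N' N i) (bnd n N' N i).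

Lemma stable_cyc e n N' N i : stable e N' -> stable e N -> stable e (cyc n N' N i).
Proof.
move=> hN' hN.
have sN' k := stable_coords hN' (k := k); have sN k := stable_coords hN (k := k); split.
- by split; [exact: (stable0 (sN' _)) | rewrite mul0mx; exact: (stable0 (sN _))].
- move=> u v [? ?] [? ?]; split; first exact: (stableB (sN' _)).
  by rewrite mulmxBl; exact: (stableB (sN _)).
- move=> r v [? ?]; split; first exact: (stableZ _ (sN' _)).
  by rewrite -scalemxAl; exact: (stableZ _ (sN _)).
Qed.

Lemma stable_bnd e n N' N i : stable e N' -> stable e N -> stable e (bnd n N' N i).
Proof.
move=> hN' hN.
have sN' k := stable_coords hN' (k := k); have sN k := stable_coords hN (k := k); split.
- by exists 0; [exact: (stable0 (sN' _)) | rewrite mul0mx subr0; exact: (stable0 (sN _))].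
- move=> u v [w hw hu] [x hx hv]; exists (w - x); first exact: (stableB (sN' _)).
  by rewrite mulmxBl opprD addrACA -opprD; exact: (stableB (sN _)).
- move=> r v [w hw hv]; exists (r ^+ (p ^ e) *: w); first exact: (stableZ _ (sN' _)).
  by rewrite -scalemxAl -scalerBr; exact: (stableZ _ (sN _)).
Qed.

Lemma bnd_cyc e n N' N i : stable e N' -> stable e N -> N `<=` N' ->
  bnd (n + e) N' N i `<=` cyc (n + e) N' N i.
Proof.
move=> sN' sN NN v [w hw hv]; split.
  rewrite -(subrK (w *m fmx (n + e) (d i.+1)) v).
  apply: (stableD (stable_coords sN')); first exact: coords_sub hv.
  exact: coords_mul.
rewrite (_ : v *m _ = (v - w *m fmx (n + e) (d i.+1)) *m fmx (n + e) (d i)).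
  exact: coords_mul.
by rewrite mulmxBl -mulmxA ddF mulmx0 subr0.
Qed.

Lemma sub_bnd e n N' N i : stable e N' -> @coords N _ `<=` bnd n N' N i.
Proof.
by move=> sN' v hv; exists 0; [exact: (stable0 (stable_coords sN')) | rewrite mul0mx subr0].
Qed.

Arguments sub_bnd {e n N' N i} sN'.

Section Exact.
Variables (Q : set R^o) (e n : nat) (N0 N1 N2 : set R^o).
Hypothesis Qm : forall s t : R, ~ Q s -> ~ Q t -> ~ Q (s * t).
Hypotheses (s0 : stable e N0) (s1 : stable e N1) (s2 : stable e N2).
Hypotheses (N01 : N0 `<=` N1) (N12 : N1 `<=` N2).
Local Notation q := (n + e)%N.
Let N02 : N0 `<=` N2. Proof. by move=> x /N01 /N12. Qed.

(** The length of the image of the connecting homomorphism on degree i + 1. *)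
Definition connecting i : nat :=
  len Q e (cyc q N2 N1 i) (addS (cyc q N2 N0 i) (@coords N1 _)).

Let Z10 i := cyc q N1 N0 i. Let Z20 i := cyc q N2 N0 i. Let Z21 i := cyc q N2 N1 i.
Let B10 i := bnd q N1 N0 i. Let B20 i := bnd q N2 N0 i. Let B21 i := bnd q N2 N1 i.

Arguments Z10 : clear implicits.
Arguments Z20 : clear implicits.
Arguments Z21 : clear implicits.
Arguments B10 : clear implicits.
Arguments B20 : clear implicits.
Arguments B21 : clear implicits.
Let Z10_20 i : Z10 i `<=` Z20 i.
Proof. by move=> v [h ?]; split=> //; exact: coords_sub h. Qed.
Let Z20_21 i : Z20 i `<=` Z21 i.
Proof. by move=> v [h h']; split=> //; exact: coords_sub h'. Qed.
Let B10_20 i : B10 i `<=` B20 i.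
Proof. by move=> v [w h h']; exists w => //; exact: coords_sub h. Qed.
Let B20_21 i : B20 i `<=` B21 i.
Proof. by move=> v [w h h']; exists w => //; exact: coords_sub h'. Qed.
Let B10_Z10 i : B10 i `<=` Z10 i. Proof. exact: bnd_cyc. Qed.
Let B20_Z20 i : B20 i `<=` Z20 i. Proof. exact: bnd_cyc. Qed.
Let B21_Z21 i : B21 i `<=` Z21 i. Proof. exact: bnd_cyc. Qed.

Let conn' i := len Q e (Z10 i `&` B20 i) (B10 i).

(* The connecting homomorphism is induced by the differential, which maps its image,
   as presented by cokernels, onto its image as presented by kernels. *)
Let conn_eq i : conn' i = connecting i.+1.
Proof.
symmetry; have sZ21 := stable_cyc q i.+1 s2 s1.
apply: (proj1 (@len_iso R p Q _ _ e e (fun v => v *m fmx q (d i.+1)) _ _ _ _ _ _ _)).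
- by move=> u v; rewrite mulmxBl.
- by move=> r v; rewrite scalemxAl.
split; first split=> //; [exact: stable_bnd| apply: stable_setI; [exact: stable_cyc|exact: stable_bnd] |].
split.
- move=> a [h2 h1]; split; last by exists a => //; rewrite subrr; exact: (stable0 (stable_coords s0)).
  by split=> //; rewrite -mulmxA ddF mulmx0; exact: (stable0 (stable_coords s0)).
- by move=> v Bv; split; [exact: B10_Z10 | exact: B10_20].
- move=> x [[h1 _] [w hw hx]]; exists w; last exact: (sub_bnd s1).
  split=> //; rewrite -(subKr x (w *m _)); apply: (stableB (stable_coords s1)) => //.
  exact: coords_sub hx.
move=> v; split.
- move=> [z [x [[hz hz'] hx ->]]]; split.
    split; first by apply: (stableD (stable_coords s2)) => //; exact: coords_sub hx.
    rewrite mulmxDl; apply: (stableD (stable_coords s1)); first exact: coords_sub hz'.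
    exact: coords_mul.
  by exists x => //; rewrite mulmxDl addrK.
- move=> [[h2 h1] [w hw h0]]; exists (v - w), w; rewrite subrK; split=> //.
  split; last by rewrite mulmxBl.
  by apply: (stableB (stable_coords s2)) => //; exact: coords_sub hw.
Qed.

(** The long exact homology sequence of N0, N1, N2, cut into its short exact pieces. *)
Lemma homology_exact i : hfin Q e q N1 N0 i -> hfin Q e q N2 N1 i ->
  hfin Q e q N2 N0 i /\
  (hlen Q e q N2 N0 i + connecting i.+1 + connecting i =
   hlen Q e q N1 N0 i + hlen Q e q N2 N1 i)%N.
Proof.
move=> f10 f21; rewrite -conn_eq.
have sZ10 : stable e (Z10 i) by exact: stable_cyc.
have sZ20 : stable e (Z20 i) by exact: stable_cyc.
have sZ21 : stable e (Z21 i) by exact: stable_cyc.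
have sB10 : stable e (B10 i) by exact: stable_bnd.
have sB20 : stable e (B20 i) by exact: stable_bnd.
have sB21 : stable e (B21 i) by exact: stable_bnd.
have sI := stable_setI sZ10 sB20.
pose W := addS (Z10 i) (B20 i); have sW : stable e W by exact: stable_addS.
pose X := addS (Z20 i) (B21 i); have sX : stable e X by exact: stable_addS.
have idB (V : zmodType) (u v : V) : id (u - v) = id u - id v by [].
have [E2 F2] : len Q e (Z10 i) (Z10 i `&` B20 i) = len Q e W (B20 i) /\
    (finlen Q e (Z10 i) (Z10 i `&` B20 i) <-> finlen Q e W (B20 i)).
  apply: (@len_iso R p Q _ _ e e id) => //; split=> //; split.
  - by move=> a; exact: (addS_subl sB20).
  - exact: (addS_subr sZ10).
  - by move=> x [a [c [ha hc ->]]]; exists a; rewrite // addrC addKr.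
  - by move=> v; split.
have WE : Z20 i `&` B21 i = W.
  apply/seteqP; split.
    move=> v [hv [w hw h1]]; exists (v - w *m fmx q (d i.+1)), (w *m fmx q (d i.+1)).
    rewrite subrK; split=> //; last by exists w; rewrite ?subrr //; exact: (stable0 (stable_coords s0)).
    by split=> //; rewrite mulmxBl -mulmxA ddF mulmx0 subr0; case: hv.
  apply: (addS_least (stable_setI sZ20 sB21)).
    by move=> v hv; split; [exact: Z10_20 | apply: (sub_bnd s2); case: hv].
  by move=> v hv; split; [exact: B20_Z20 | exact: B20_21].
have [E4 F4] : len Q e (Z20 i) W = len Q e X (B21 i) /\
    (finlen Q e (Z20 i) W <-> finlen Q e X (B21 i)).
  apply: (@len_iso R p Q _ _ e e id) => //; split=> //; split.
  - by move=> a; exact: (addS_subl sB21).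
  - exact: (addS_subr sZ20).
  - by move=> x [a [c [ha hc ->]]]; exists a; rewrite // addrC addKr.
  - by move=> v; rewrite -WE; split.
have XZ : X `<=` Z21 i by apply: (addS_least sZ21); [exact: Z20_21 | exact: B21_Z21].
have BX : B21 i `<=` X by exact: (addS_subr sZ20).
have fX : finlen Q e X (B21 i) by apply: finlen_mono f21.
have fZX : finlen Q e (Z21 i) X by apply: finlen_mono f21.
have [_ E5] := len_add Qm sZ21 sX sB21 BX XZ fZX fX.
have XE : addS (Z20 i) (@coords N1 _) = X.
  apply/seteqP; split.
    by apply: (addS_least sX); [exact: (addS_subl sB21) | move=> v hv; apply/BX/(sub_bnd s2)].
  have sA : stable e (addS (Z20 i) (@coords N1 _)) by apply: stable_addS => //; exact: stable_coords.
  apply: (addS_least sA); first exact: (addS_subl (stable_coords s1)).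
  move=> v [w hw h1]; exists (w *m fmx q (d i.+1)), (v - w *m fmx q (d i.+1)).
  split=> //; last by rewrite addrC subrK.
  by apply: B20_Z20; exists w => //; rewrite subrr; exact: (stable0 (stable_coords s0)).
have BI : B10 i `<=` Z10 i `&` B20 i by move=> v hv; split; [exact: B10_Z10|exact: B10_20].
have IZ : Z10 i `&` B20 i `<=` Z10 i by move=> v [].
have fI : finlen Q e (Z10 i `&` B20 i) (B10 i) by apply: finlen_mono f10.
have fZI : finlen Q e (Z10 i) (Z10 i `&` B20 i) by apply: finlen_mono f10.
have [_ E3] := len_add Qm sZ10 sI sB10 BI IZ fZI fI.
have WZ : W `<=` Z20 i by apply: (addS_least sZ20); [exact: Z10_20 | exact: B20_Z20].
have [f1 E1] := len_add Qm sZ20 sW sB20 (addS_subr sZ10) WZ (F4.2 fX) (F2.1 fZI).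
split=> //; rewrite /hlen -/(Z20 i) -/(B20 i) E1 -/(Z10 i) -/(B10 i) E3 -/(Z21 i) -/(B21 i) E5.
rewrite E4 -E2 /connecting -/(Z20 i) XE -/(Z21 i) -/(conn' i).
move: (len Q e X _) (len Q e (Z10 i) _) (conn' i) (len Q e (Z21 i) X) => a1 a2 a3 a4.
by lia.
Qed.

End Exact.

(** The map r |-> r ^ (p ^ e) u identifies R / (colon N u), at level 0, with
    (adjoin N u) / N, at level e, and carries the n-th twist of the complex to the
    (n + e)-th: this is how Frobenius acts on the homology lengths. *)
Lemma homology_adjoin Q e n N u i : stable e N ->
  hlen Q 0 n setT (colon p e N u) i = hlen Q e (n + e) (adjoin p e N u) N i /\
  (hfin Q 0 n setT (colon p e N u) i <-> hfin Q e (n + e) (adjoin p e N u) N i).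
Proof.
move=> sN; set P := colon p e N u; set N1 := adjoin p e N u.
have sP : stable 0 P := stable_colon chR u sN.
have sN1 : stable e N1 := stable_adjoin chR u sN.
have NN1 : N `<=` N1 by exact: sub_adjoin.
pose f k (v : 'rV[R]_k) : 'rV[R]_k := map_mx (fun r => r ^+ (p ^ e) * u) v.
have fB k (v w : 'rV[R]_k) : f k (v - w) = f k v - f k w.
  by apply/matrixP => x y; rewrite !mxE (frobD chR) (frobN chR) mulrBl.
have fM a c (v : 'rV[R]_a) (A : 'M[R]_(a, c)) : f _ (v *m fmx n A) = f _ v *m fmx (n + e) A.
  apply/matrixP => x y; rewrite !mxE (frob_sum chR) mulr_suml; apply: eq_bigr => k _.
  by rewrite !mxE exprMn -exprM -expnD mulrAC.
have fP k (v : 'rV[R]_k) : coords P v <-> coords N (f k v).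
  by split=> h j; have := h j; rewrite !mxE.
have fT k (v : 'rV[R]_k) : coords N1 (f k v).
  by move=> j; exists (v 0 j); rewrite !mxE subrr; exact: (stable0 sN).
have fS k (v : 'rV[R]_k) : coords N1 v -> exists a, coords N (v - f k a).
  move=> hv; pose a j := sval (cid (hv j)); exists (\row_j a j) => j.
  by rewrite !mxE /a; case: cid.
have sT : stable 0 (setT : set R^o) by [].
apply: (@len_iso R p Q _ _ 0 e (f _)); first exact: fB.
  by move=> r v; apply/matrixP => x y; rewrite !mxE ?expn0 ?expr1 exprMn mulrA.
split; first by split; [exact: stable_cyc | exact: stable_bnd | exact: stable_cyc].
split.
- by move=> a [_ h]; split=> //; rewrite -fM; apply/fP.
- exact: bnd_cyc.
- move=> x [h1 h]; have [a ha] := fS _ _ h1; exists a; last exact: (sub_bnd sN1).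
  split=> //; apply/fP; rewrite fM -[f _ a](subKr x) mulmxBl.
  by apply: (stableB (stable_coords sN)) => //; exact: coords_mul.
- move=> v; split.
    move=> h; split; first by rewrite -(addn0 n) in h *; exact: (bnd_cyc (e := 0)).
    by case: h => w _ /fP; rewrite fB fM; exists (f _ w).
  move=> [_ [w /fS[a ha] h]]; exists a => //; apply/fP; rewrite fB fM.
  rewrite (_ : _ - _ = (f _ v - w *m fmx (n + e) (d i.+1)) + (w - f _ a) *m fmx (n + e) (d i.+1)).
    by apply: (stableD (stable_coords sN)) => //; exact: coords_mul.
  by rewrite mulmxBl subrKA.
Qed.

Section Filtration.
Variables (Q : set R^o) (n : nat).
Hypothesis pQ : primeS p Q.
Let Qm := prime_mul pQ.

Lemma homology_trivial e i : hfin Q e (n + e) setT setT i /\ hlen Q e (n + e) setT setT i = 0%N.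
Proof.
have sT : stable e (setT : set R^o) by [].
apply: torsion_len; first exact: bnd_cyc.
by move=> [v _ /(_ 1)]; apply; [case: pQ | exact: (sub_bnd sT)].
Qed.

Lemma homology_subadditive e N l i : pfilt p e N l -> stable e N ->
  (forall P, P \in l -> hfin Q 0 n setT P i) ->
  hfin Q e (n + e) setT N i /\
  (hlen Q e (n + e) setT N i <= \sum_(P <- l) hlen Q 0 n setT P i)%N.
Proof.
elim: l N => [|P l IH] N /=.
  by move=> -> _ _; have [f ->] := homology_trivial e i.
move=> [u [EP pP hl]] sN fl; rewrite big_cons.
have sA := stable_adjoin chR u sN.
have [|f1 E1] := IH _ hl sA; first by move=> P' lP'; apply: fl; rewrite inE lP' orbT.
have [E2 f2] := homology_adjoin Q n u i sN; rewrite -EP in E2 f2.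
have f2' := f2.1 (fl P (mem_head _ _)).
have [f E] := homology_exact Qm sN sA (@stable_setT R p R^o e) (@sub_adjoin _ _ chR _ e N u)
  (@subsetT _ _) f2' f1.
by split=> //; rewrite E2 (leq_trans _ (leq_add (leqnn _) E1)) // -E -addnA leq_addr.
Qed.

Variable L : nat.
Hypotheses (b0 : b 0 = 0%N) (bL : b L.+1 = 0%N).

Definition euler e k N' N : int := \sum_(i < L) (-1) ^+ i * (hlen Q e k N' N i)%:Z.

(** The connecting terms cancel in the alternating sum; those at both ends vanish
    because the complex is zero in degrees 0 and L + 1. *)
Lemma euler_add e N0 N1 N2 : stable e N0 -> stable e N1 -> stable e N2 ->
  N0 `<=` N1 -> N1 `<=` N2 ->
  (forall i, hfin Q e (n + e) N1 N0 i) -> (forall i, hfin Q e (n + e) N2 N1 i) ->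
  euler e (n + e) N2 N0 = euler e (n + e) N1 N0 + euler e (n + e) N2 N1.
Proof.
move=> s0 s1 s2 N01 N12 f10 f21.
pose c i := connecting Q e n N0 N1 N2 i.
have c0 : c 0 = 0%N.
  apply: (proj2 (torsion_len _ _)).
    apply: (addS_least (stable_cyc _ _ s2 s1)).
      by move=> v [h h']; split=> //; exact: coords_sub h'.
    move=> v hv; split; first exact: coords_sub hv.
    exact: coords_mul.
  move=> [v [hv _] /(_ 1)]; apply; first by case: pQ.
  rewrite expr1n scale1r; apply: (addS_subl (stable_coords s1)); split=> // j.
  by exfalso; have := ltn_ord j; rewrite {2}b0.
have cL : c L = 0%N.
  have z (v : 'rV[R]_(b L.+1)) : v = 0.
    by apply/matrixP => x j; exfalso; have := ltn_ord j; rewrite {2}bL.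
  have sA : stable e (addS (cyc (n + e) N2 N0 L) (@coords N1 (b L.+1))).
    by apply: stable_addS; [exact: stable_cyc | exact: stable_coords].
  apply: (proj2 (torsion_len _ _)).
    by move=> v _; rewrite (z v); exact: (stable0 (stable_cyc _ _ s2 s1)).
  move=> [v _ /(_ 1)]; apply; first by case: pQ.
  by rewrite (z (_ *: v)); exact: (stable0 sA).
have E i : (hlen Q e (n + e) N2 N0 i)%:Z = (hlen Q e (n + e) N1 N0 i)%:Z +
    (hlen Q e (n + e) N2 N1 i)%:Z - (c i)%:Z - (c i.+1)%:Z.
  have [_ H] := homology_exact Qm s0 s1 s2 N01 N12 (f10 i) (f21 i).
  by rewrite -/(c i) -/(c i.+1) in H; lia.
suff tel k : \sum_(i < k) (-1) ^+ i * (hlen Q e (n + e) N2 N0 i)%:Z =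
    \sum_(i < k) (-1) ^+ i * (hlen Q e (n + e) N1 N0 i)%:Z +
    \sum_(i < k) (-1) ^+ i * (hlen Q e (n + e) N2 N1 i)%:Z + (-1) ^+ k * (c k)%:Z.
  by rewrite /euler tel cL mulr0 addr0.
elim: k => [|k IH]; first by rewrite !big_ord0 c0 mulr0 !addr0.
by rewrite !big_ord_recr /= IH E exprS; ring.
Qed.

Lemma euler_filtration e N l : pfilt p e N l -> stable e N ->
  (forall P i, P \in l -> hfin Q 0 n setT P i) ->
  euler e (n + e) setT N = \sum_(P <- l) euler 0 n setT P.
Proof.
elim: l N => [|P l IH] N /=.
  by move=> -> _ _; rewrite big_nil /euler big1 // => i _; rewrite (homology_trivial e i).2 mulr0.
move=> [u [EP pP hl]] sN fl; rewrite big_cons.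
have sA := stable_adjoin chR u sN.
have fl' P' i : P' \in l -> hfin Q 0 n setT P' i by move=> lP'; apply: fl; rewrite inE lP' orbT.
have tr i := homology_adjoin Q n u i sN.
rewrite (@euler_add e N (adjoin p e N u) setT) //.
- rewrite -EP in tr; congr (_ + _); last exact: IH.
  by apply: eq_bigr => i _; rewrite (tr i).1.
- exact: sub_adjoin.
- by move=> i; apply: (tr i).2.1; rewrite -EP; apply: fl; rewrite mem_head.
- by move=> i; apply: (proj1 (homology_subadditive hl sA (fun P' lP' => fl' P' i lP'))).
Qed.

End Filtration.
End Homology.

(** * Ranks of the Frobenius push-forward *)

(** By Bernoulli's inequality (b + 1)^n outgrows c b^n. *)
Lemma leq_of_powers a c b : (forall n, (a ^ n <= c * b ^ n)%N) -> (a <= b)%N.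
Proof.
move=> h; rewrite leqNgt; apply/negP => ba.
have [b0|b0] := posnP b.
  by move: (h 1%N); rewrite b0 expn1 muln0 leqn0 => /eqP a0; rewrite a0 in ba.
have bern n : ((b + n) * b ^ n <= b * b.+1 ^ n)%N.
  elim: n => [|n IH]; first by rewrite addn0.
  rewrite [(b.+1 ^ _)%N]expnS [(b ^ _)%N]expnS mulnCA [leqRHS]mulnCA.
  apply: leq_trans (leq_mul (leqnn b.+1) IH).
  by rewrite !mulnA leq_mul2r; apply/orP; right; nia.
have := h (c * b)%N; rewrite leqNgt => /negP; apply.
have bn : (0 < b ^ (c * b))%N by rewrite expn_gt0 b0.
have le1 : (b.+1 ^ (c * b) <= a ^ (c * b))%N.
  by case: (c * b)%N => // k; rewrite leq_exp2r.
apply: leq_trans le1; rewrite -(ltn_pmul2l b0).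
by apply: leq_trans (bern _); rewrite mulnA ltn_pmul2r // mulnC; lia.
Qed.

Section Generated.
Variables (R : comNzRingType) (p : nat) (chR : p \in [pchar R]).
Local Notation chain := (@chain R p).
Local Notation nontorsion := (@nontorsion R p).
Local Notation finlen := (@finlen R p).
Local Notation len := (@len R p).
Local Notation stable e N := (@stable R p _ e N).

(** A module with l generators killed by J is filtered by size l quotients of R / J;
    X is the submodule generated by l over B. *)
Lemma len_generated (Q J : set R^o) k e (V : lmodType R) (B : set V) (l : seq V) :
  primeS p Q -> stable e B -> finlen Q k setT J ->
  (forall u r, u \in l -> J r -> B (r ^+ (p ^ e) *: u)) ->
  exists X : set V, [/\ stable e X, B `<=` X, forall u, u \in l -> X u &
    finlen Q (k + e) X B /\ (len Q (k + e) X B <= size l * len Q k setT J)%N].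
Proof.
move=> pQ sB fJ; have Qm := prime_mul pQ; elim: l => [|u l IH] h.
  have nt : ~ nontorsion Q (k + e) B B.
    move=> [v Bv /(_ 1)]; apply; first by case: pQ.
    by rewrite expr1n scale1r.
  by have [f E] := torsion_len (@subset_refl _ B) nt; exists B; split=> //; rewrite E.
have [|X [sX BX lX [fX EX]]] := IH; first by move=> v r vl; apply: h; rewrite inE vl orbT.
have sA := stable_adjoin chR u sX.
have [E F] := len_adjoin chR Q k u sX.
have JC : J `<=` colon p e X u by move=> r Jr; apply/BX/h; rewrite ?mem_head.
have fC : finlen Q k setT (colon p e X u) by apply: finlen_mono fJ.
have leC : (len Q k setT (colon p e X u) <= len Q k setT J)%N by apply: len_mono.
have sk (C : set V) : stable e C -> stable (k + e) C by rewrite addnC; exact: stableS.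
have XA : X `<=` adjoin p e X u by exact: sub_adjoin.
have [f' E'] := len_add Qm (sk _ sA) (sk _ sX) (sk _ sB) BX XA (F.1 fC) fX.
exists (adjoin p e X u); split=> //.
- by move=> v /BX /XA.
- by move=> v; rewrite inE => /orP[/eqP ->|/lX /XA //]; exact: mem_adjoin.
- by split=> //; rewrite E' -E mulSn leq_add.
Qed.

(** The Frobenius power: the ideal generated by the (p ^ n)-th powers. *)
Definition frobI (J : set R^o) n : set R^o := fun v =>
  forall B : set R^o, stable 0 B -> (forall x, J x -> B (x ^+ (p ^ n))) -> B v.

Lemma stable_frobI J n : stable 0 (frobI J n).
Proof.
split=> [B sB _|u v hu hv B sB lB|r v hv B sB lB].
- exact: (stable0 sB).
- by apply: (stableB sB); [exact: hu | exact: hv].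
- by apply: (stableZ _ sB); exact: hv.
Qed.

Lemma mem_frobI (J : set R^o) n (x : R) : J x -> frobI J n (x ^+ (p ^ n)).
Proof. by move=> Jx B _; exact. Qed.

Definition prodI (J M : set R^o) : set R^o := fun v =>
  forall B : set R^o, stable 0 B -> (forall x y : R, J x -> M y -> B (x * y)) -> B v.

Lemma stable_prodI J M : stable 0 (prodI J M).
Proof.
split=> [B sB _|u v hu hv B sB lB|r v hv B sB lB].
- exact: (stable0 sB).
- by apply: (stableB sB); [exact: hu | exact: hv].
- by apply: (stableZ _ sB); exact: hv.
Qed.

Lemma mem_prodI (J M : set R^o) (x y : R) : J x -> M y -> prodI J M (x * y).
Proof. by move=> Jx My B _; exact. Qed.

Lemma prodI_sub J M : stable 0 M -> prodI J M `<=` M.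
Proof. by move=> sM v hv; apply: (hv M sM) => x y _; exact: (stable0M sM). Qed.

Definition powI J k : set R^o := iter k (prodI J) setT.

Lemma stable_powI J k : stable 0 (powI J k).
Proof. by case: k => [|k] //; exact: stable_prodI. Qed.

Lemma powI_sub J k : powI J k.+1 `<=` powI J k.
Proof. exact: (prodI_sub (stable_powI J k)). Qed.

Lemma mem_powI (J : set R^o) (x : R) k : J x -> powI J k (x ^+ k).
Proof. by move=> Jx; elim: k => //= k IH; rewrite exprS; exact: mem_prodI. Qed.

(** Nakayama's lemma at Q, without localizing: if s M lies in Q M then
    (s - a) g lies in the span of the remaining generators for some a in Q, and the
    first generator g is eliminated. *)
Lemma nakayama_torsion (Q : set R^o) (l : seq R^o) : primeS p Q ->
  (exists2 s : R, ~ Q s & forall v : R, fspan p 0 l v -> prodI Q (fspan p 0 l) (s * v)) ->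
  exists2 t : R, ~ Q t & forall v : R, fspan p 0 l v -> t * v = 0.
Proof.
move=> pQ; have [sQ Q1 _] := pQ; have Qm := prime_mul pQ.
elim: l => [|g l IH] [s Qs h].
  exists 1 => // v /(_ [set 0] (stable_zero _ _ _)) -> //; by rewrite mulr0.
have sl := @stable_fspan R p R^o 0 l.
have sub v : fspan p 0 l v -> fspan p 0 (g :: l) v.
  by apply: fspan_mono => x lx; rewrite inE lx orbT.
have dec (v : R) : prodI Q (fspan p 0 (g :: l)) v ->
    exists2 a : R, Q a & prodI Q (fspan p 0 l) (v - a * g).
  move=> /(_ (fun v : R^o => exists2 a : R, Q a & prodI Q (fspan p 0 l) (v - a * g))); apply.
    have sP := stable_prodI Q (fspan p 0 l); split.
    - by exists 0; [exact: (stable0 sQ) | rewrite mul0r subr0; exact: (stable0 sP)].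
    - move=> u w [a Qa ha] [c Qc hc]; exists (a - c); first exact: (stableB sQ).
      by rewrite mulrBl opprD addrACA -opprD; exact: (stableB sP).
    - move=> r u [a Qa ha]; exists (r * a); first exact: (stable0M sQ).
      by rewrite expn0 expr1 scaler_regular -mulrA -mulrBr; exact: (stable0M sP).
  move=> x y Qx /(fspan_consP chR)[r]; rewrite expn0 expr1 scaler_regular => hr.
  exists (x * r); first by rewrite mulrC; exact: (stable0M sQ).
  by rewrite -mulrA -mulrBr; exact: mem_prodI.
have [a Qa ha] := dec _ (h g (@mem_fspan _ _ _ _ _ _ (mem_head _ _))).
pose t := s - a; have Qt : ~ Q t.
  by move=> Qt; apply: Qs; rewrite -(subrK a s); exact: (stableD sQ).
rewrite -mulrBl -/t in ha.
have tg : fspan p 0 l (t * g) by exact: (prodI_sub sl ha).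
have tspan (v : R) : fspan p 0 (g :: l) v -> fspan p 0 l (t * v).
  move=> /(fspan_consP chR)[r]; rewrite expn0 expr1 scaler_regular => hr.
  rewrite -(subrK (r * g) v) mulrDr mulrCA; apply: (stableD sl); exact: (stable0M sl).
have [|t' Qt' ht'] := IH.
  exists (t * s); first exact: Qm.
  move=> v /sub /h hv; rewrite -mulrA; move: hv; set w := s * v; move: w => w /(_ (fun w : R^o => prodI Q (fspan p 0 l) (t * w))).
  have sP := stable_prodI Q (fspan p 0 l); apply.
    split; first by rewrite mulr0; exact: (stable0 sP).
    - by move=> u z hu hz; rewrite mulrBr; exact: (stableB sP).
    - by move=> r z hz; rewrite expn0 expr1 scaler_regular mulrCA; exact: (stable0M sP).
  by move=> x y Qx /tspan hy; rewrite mulrCA; exact: mem_prodI.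
exists (t' * t); first exact: Qm.
by move=> v /tspan /ht'; rewrite mulrA.
Qed.
End Generated.
Arguments frobI {R} p J n _.
Arguments powI {R} p J k _.

Section Rank.
Variables (R : idomainType) (p : nat) (chR : p \in [pchar R]).
Hypothesis noeth : forall J : set R^o, stable p 0 J -> fgen p 0 J.
Variable g1 : seq R^o.
Hypothesis g1T : forall v, fspan p 1 g1 v.
Local Notation chain := (@chain R p).
Local Notation nontorsion := (@nontorsion R p).
Local Notation finlen := (@finlen R p).
Local Notation len := (@len R p).
Local Notation stable e N := (@stable R p _ e N).
Local Notation rho := (@rho R p).
Implicit Types (P Q J N : set R^o).

Lemma frob_gens n : exists2 l : seq R^o, (forall v, fspan p n l v) & size l = (size g1 ^ n)%N.
Proof.
elim: n => [|n [l lT ls]].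
  by exists [:: (1 : R^o)] => // v; exact: regular_gen.
exists [seq (u : R) ^+ p * w | u <- l, w <- g1]; last by rewrite size_allpairs ls expnSr.
move=> v A sA hA.
have key (w u : R) : w \in g1 -> A (u ^+ p * w).
  move=> wg; apply: (lT u (fun y : R^o => A (y ^+ p * w))).
    have e1 (x : R) : x ^+ p = x ^+ (p ^ 1) by rewrite expn1.
    split; first by rewrite e1 (frob0 chR) mul0r; exact: (stable0 sA).
    - by move=> x y hx hy; rewrite e1 (frobD chR) (frobN chR) -e1 mulrBl; exact: (stableB sA).
    - by move=> r x hx; rewrite scaler_regular exprMn -exprM -expnSr -mulrA; exact: (stableZ _ sA).
  by move=> x xl; apply: hA; apply: allpairs_f.
have sG : stable 1 (fun x : R^o => forall r : R, A (r ^+ p * x)).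
  split=> [r|x y hx hy r|s x hx r].
  - by rewrite mulr0; exact: (stable0 sA).
  - by rewrite mulrBr; exact: (stableB sA).
  - by rewrite expn1 scaler_regular mulrA -exprMn.
have := @g1T v _ sG (fun w wg r => key w r wg) 1.
by rewrite expr1n mul1r.
Qed.

Lemma gens_stable_exists e N : stable e N -> exists l, pfilt p e N l.
Proof. by have [g gT _] := frob_gens e; exact: pfilt_exists gT N. Qed.

Lemma finlen_rho Q : primeS p Q -> finlen Q 1 setT Q.
Proof.
move=> pQ; have [sQ _ _] := pQ.
have [l hl] := gens_stable_exists (stable_ideal 1 sQ).
by have [] := rho_filtration chR pQ hl.
Qed.

Lemma len_frob_scale (V : lmodType R) Q n (A B : set V) : primeS p Q ->
  stable 0 A -> stable 0 B -> B `<=` A -> finlen Q 0 A B ->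
  finlen Q n A B /\ len Q n A B = (rho Q ^ n * len Q 0 A B)%N.
Proof. by move=> pQ; apply: len_scale => //; exact: finlen_rho. Qed.

Lemma primeS_zero : primeS p [set 0 : R^o].
Proof.
split; first exact: stable_zero.
  by move=> /eqP; apply/negP; exact: oner_neq0.
by move=> a b /= /eqP; rewrite mulf_eq0 => /orP[] /eqP ->; [left | right].
Qed.

Lemma finlen_frobI Q n : primeS p Q ->
  finlen Q 0 setT (frobI p Q n).
Proof.
move=> pQ; have sI := stable_frobI p Q n.
have [l hl] := gens_stable_exists sI.
have lQ P : P \in l -> P = Q \/ ~ P `<=` Q.
  move=> Pl; have [PQ|PQ] := EM (P `<=` Q); last by right.
  left; apply/seteqP; split=> // x Qx; apply: (prime_exp (pfilt_prime hl Pl) (n := (p ^ n)%N)).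
  by apply: (pfilt_sup chR hl sI Pl); exact: mem_frobI.
by have [] := len_filtration chR sI pQ hl lQ.
Qed.

(** The Frobenius power of Q lies in Q ^ (p ^ n), and the powers of a nonzero Q
    decrease strictly even after localization at Q, by Nakayama. *)
Lemma len_frobI_ge Q n : primeS p Q -> Q != [set 0] ->
  (p ^ n <= len Q 0 setT (frobI p Q n))%N.
Proof.
move=> pQ Q0; have [sQ Q1 _] := pQ.
apply: len_max; first exact: finlen_frobI.
apply: (chain_mono (@subset_refl _ setT) (B := powI p Q (p ^ n))).
  by move=> v; apply; [exact: stable_powI | move=> x Qx; exact: mem_powI].
elim: (p ^ n)%N => [//|k IH].
have -> : k.+1 = (k + 1)%N by rewrite addn1.
apply: chain_cat IH _; exists (powI p Q k.+1).
rewrite addn1; split; [exact: stable_powI | by [] | exact: powI_sub |].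
apply: contrapT => tor.
have [l El] := noeth (stable_powI p Q k).
have [s Qs hs] : exists2 s : R, ~ Q s & forall v : R, v \in l -> powI p Q k.+1 (s * v).
  have : forall v, v \in l -> powI p Q k v by rewrite El => v; exact: mem_fspan.
  elim: l {El} => [_|u l IHl h]; first by exists 1.
  have [v vl|s Qs hs] := IHl; first by apply: h; rewrite inE vl orbT.
  have [t Qt ht] : exists2 t : R, ~ Q t & powI p Q k.+1 (t * u).
    apply: contrapT => nex; apply: tor; exists u; first by apply: h; rewrite mem_head.
    move=> t Qt ht; apply: nex; exists t => //.
  have sP := stable_powI p Q k.+1.
  exists (s * t); first exact: (prime_mul pQ).
  move=> v; rewrite inE => /orP[/eqP ->|/hs hv].
    by rewrite -mulrA; exact: (stable0M sP).
  by rewrite mulrAC mulrC; exact: (stable0M sP).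
have [|t Qt ht] := @nakayama_torsion R p chR Q l pQ.
  exists s => // v; rewrite -El => hv.
  have sP := stable_powI p Q k.+1.
  have : fspan p 0 l v by rewrite -El.
  move=> /(_ (fun w : R^o => powI p Q k.+1 (s * w))); apply=> //.
  split; first by rewrite mulr0; exact: (stable0 sP).
  - by move=> x y hx hy; rewrite mulrBr; exact: (stableB sP).
  - by move=> r x hx; rewrite expn0 expr1 scaler_regular mulrCA; exact: (stable0M sP).
have [a Qa a0] : exists2 a : R, Q a & a != 0.
  apply: contrapT => nex; move/eqP: Q0; apply; apply/seteqP; split=> [x Qx|x ->].
    by apply: contrapT => /eqP x0; apply: nex; exists x.
  exact: (stable0 sQ).
have t0 : t != 0 by apply/eqP => t0; apply: Qt; rewrite t0; exact: (stable0 sQ).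
have : fspan p 0 l (a ^+ k) by rewrite -El; exact: mem_powI.
by move=> /ht /eqP; rewrite mulf_eq0 (negbTE t0) expf_eq0 (negbTE a0) andbF.
Qed.

Lemma len_frobI_le Q n (l : seq R^o) : primeS p Q -> (forall v, fspan p n l v) ->
  (len Q n setT (frobI p Q n) <= size l)%N.
Proof.
move=> pQ lT; have [fQ EQ] := len_prime pQ.
have sI := stable_ideal n (stable_frobI p Q n).
have [|X [sX BX lX [fX le]]] := len_generated chR (k := 0) (l := l) pQ sI fQ.
  move=> u r _ Qr; rewrite scaler_regular mulrC.
  by apply: (stable0M (stable_frobI p Q n)); exact: mem_frobI.
have XT : X = setT by apply/seteqP; split=> // v _; exact: lT.
by rewrite XT EQ muln1 add0n in le.
Qed.

Variable m : set R^o.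
Hypothesis pm : primeS p m.
Hypothesis m_local : forall s : R, ~ m s -> exists t : R, t * s = 1.
Notation kappa := (rho m).

(** Nakayama's lemma for the n-th push-forward of R: a maximal submodule containing
    l would have a simple quotient, killed by m. *)
Lemma frob_nakayama n (l : seq R^o) :
  addS (fspan p n l) (frobI p m n) = setT -> forall v, fspan p n l v.
Proof.
move=> eT; have [g gT _] := frob_gens n.
have sl := @stable_fspan R p R^o n l.
suff : forall N, stable n N -> fspan p n l `<=` N -> N = setT.
  by move=> /(_ _ sl (@subset_refl _ _)) -> .
apply: (noeth_ind chR noeth gT) => N sN IH lN; apply: contrapT => NT.
have sub (u r : R) : m r -> N (r ^+ (p ^ n) * u).
  move=> mr; apply: contrapT => nN.
  have aT : adjoin p n N (r ^+ (p ^ n) * u) = setT.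
    apply: IH; [exact: stable_adjoin | exact: sub_adjoin | |].
      by move=> h; apply/nN/h; exact: mem_adjoin.
    by move=> v /lN; exact: sub_adjoin.
  have [s] : adjoin p n N (r ^+ (p ^ n) * u) u by rewrite aT.
  rewrite scaler_regular mulrA -exprMn -{1}[u]mul1r -mulrBl -{1}(expr1n _ (p ^ n)).
  rewrite -(frobN chR) -(frobD chR) => hN.
  have [|t ht] := m_local (s := 1 - s * r).
    move=> h; have [sm m1 _] := pm; apply: m1; rewrite -(subrK (s * r) 1).
    by apply: (stableD sm) => //; exact: (stable0M sm).
  apply: nN; apply: (stableZ r sN); rewrite -[u]mul1r -(expr1n _ (p ^ n)) -ht exprMn -mulrA.
  exact: (stableZ t sN).
apply: NT; apply/seteqP; split=> // v _.
have : addS (fspan p n l) (frobI p m n) v by rewrite eT.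
move=> [a [c [/lN Na hc ->]]]; apply: (stableD sN) => //.
suff : forall x : R, N (x * c) by move=> /(_ 1); rewrite mul1r.
apply: (hc (fun y : R^o => forall x : R, N (x * y))).
  split=> [x|y z hy hz x|r y hy x].
  - by rewrite mulr0; exact: (stable0 sN).
  - by rewrite mulrBr; exact: (stableB sN).
  - by rewrite expn0 expr1 scaler_regular mulrA; exact: hy.
by move=> y my x; rewrite mulrC; exact: sub.
Qed.

(** Generators modulo the Frobenius power of m are chosen greedily, each one
    lengthening a chain. *)
Lemma small_gens n : exists2 l : seq R^o, (forall v, fspan p n l v) &
  (size l <= len m n setT (frobI p m n))%N.
Proof.
set B := frobI p m n; have sB : stable n B := stable_ideal n (stable_frobI p m n).
have [fB _] := len_frob_scale n pm (@stable_setT R p R^o 0) (stable_frobI p m n)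
  (@subsetT _ _) (finlen_frobI n pm).
have step k : (exists2 l : seq R^o, (forall v, fspan p n l v) & (size l <= k)%N /\
      (size l <= len m n setT B)%N) \/
    (exists2 l : seq R^o, size l = k & chain m n k (addS (fspan p n l) B) B).
  elim: k => [|k [[l lT [ls ls']]|[l ls lc]]].
  - by right; exists [::] => //=; exact: (addS_subr (@stable_fspan R p R^o n [::])).
  - by left; exists l => //; split=> //; exact: leqW.
  have sl := @stable_fspan R p R^o n l.
  have [eT|nT] := EM (addS (fspan p n l) B = setT).
    left; exists l; first exact: frob_nakayama.
    by rewrite ls; split=> //; apply: len_max => //; exact: chain_mono lc.
  right; have [u nu] : exists u, ~ addS (fspan p n l) B u.
    apply: contrapT => nex; apply: nT; apply/seteqP; split=> // u _.
    by apply: contrapT => nu; apply: nex; exists u.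
  have sul := @stable_fspan R p R^o n (u :: l).
  exists (u :: l); first by rewrite /= ls.
  exists (addS (fspan p n l) B); split=> //; first exact: stable_addS.
    apply: addS_least; first exact: (stable_addS sul sB); last exact: (addS_subr sul).
    move=> v hv; apply: (addS_subl sB); move: v hv.
    by apply: fspan_mono => x xl; rewrite inE xl orbT.
  exists u; first by apply: (addS_subl sB); apply: mem_fspan; rewrite mem_head.
  move=> s /m_local[t ts] h; apply: nu.
  rewrite -[u]scale1r -(expr1n _ (p ^ n)) -ts exprMn -scalerA.
  by apply: stableZ h; exact: stable_addS.
have [[l lT [_ ls]]|[l ls lc]] := step (len m n setT B).+1; first by exists l.
have : ((len m n setT B).+1 <= len m n setT B)%N by apply: len_max => //; exact: chain_mono lc.
by rewrite ltnn.
Qed.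

Variables (dim C : nat).
Hypothesis growth : forall n, (len m 0 setT (frobI p m n) <= C * p ^ (n * dim))%N.

(** Both sides are compared with the number of generators of the n-th push-forward
    of R.  Modulo the Frobenius power of Q each generator contributes at most 1 to the
    length at Q, which is rho Q ^ n times the length before Frobenius; and by
    Nakayama there need be no more generators than the length modulo m. *)
Lemma rho_power_bound Q n : primeS p Q ->
  (rho Q ^ n * len Q 0 setT (frobI p Q n) <= C * (kappa * p ^ dim) ^ n)%N.
Proof.
move=> pQ; have [l lT ls] := small_gens n.
have [_ <-] := len_frob_scale n pQ (@stable_setT R p R^o 0) (stable_frobI p Q n)
  (@subsetT _ _) (finlen_frobI n pQ).
apply: leq_trans (len_frobI_le pQ lT) _; apply: leq_trans ls _.
have [_ ->] := len_frob_scale n pm (@stable_setT R p R^o 0) (stable_frobI p m n)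
  (@subsetT _ _) (finlen_frobI n pm).
by rewrite expnMn -expnM [(dim * n)%N]mulnC mulnCA leq_mul2l growth orbT.
Qed.

(** For Q <> 0 the length on the left of rho_power_bound is at least p ^ n, which
    gains a factor p over the bound for the zero ideal. *)
Lemma rho_nonzero_bound Q : primeS p Q -> Q != [set 0] ->
  (rho Q * p <= kappa * p ^ dim)%N.
Proof.
move=> pQ Q0; apply: (@leq_of_powers _ C) => n.
apply: leq_trans (rho_power_bound n pQ); rewrite expnMn leq_mul2l.
by rewrite len_frobI_ge ?orbT.
Qed.

Lemma rho_zero_bound : (rho [set 0%R : R^o] <= kappa * p ^ dim)%N.
Proof.
apply: (@leq_of_powers _ C) => n; apply: leq_trans (rho_power_bound n primeS_zero).
rewrite -{1}[(_ ^ n)%N]muln1 leq_mul2l; apply/orP; right.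
have [s0 _ _] := primeS_zero.
have I0 : frobI p [set 0 : R^o] n `<=` [set 0].
  by move=> v; apply => // x ->; exact: (frob0 chR).
rewrite -(len_prime primeS_zero).2; apply: len_mono => //.
by apply: finlen_frobI; exact: primeS_zero.
Qed.

End Rank.

(** * Finiteness of homology and the Frobenius recurrences *)

Section Recurrence.
Variables (R : idomainType) (p : nat) (chR : p \in [pchar R]).
Hypothesis noeth : forall J : set R^o, stable p 0 J -> fgen p 0 J.
Variable g1 : seq R^o.
Hypothesis g1T : forall v, fspan p 1 g1 v.
Variable m : set R^o.
Hypothesis pm : primeS p m.
Local Notation finlen := (@finlen R p).
Local Notation len := (@len R p).
Local Notation stable e N := (@stable R p _ e N).
Local Notation rho := (@rho R p).
Implicit Types (P Q J N : set R^o).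

Lemma finlen_of_primes J : stable 0 J -> (forall P, primeS p P -> J `<=` P -> P = m) ->
  finlen m 0 setT J.
Proof.
move=> sJ h; have [l hl] := gens_stable_exists chR noeth g1T sJ.
have lm P : P \in l -> P = m \/ ~ P `<=` m.
  by move=> Pl; left; apply: h; [exact: (pfilt_prime hl Pl) | exact: (pfilt_sup chR hl sJ Pl)].
by have [] := len_filtration chR sJ pm hl lm.
Qed.

Variables (b : nat -> nat) (d : forall i, 'M[R]_(b i.+1, b i)).
Hypothesis dd : forall i, d i.+1 *m d i = 0.
Local Notation hfin := (@hfin R p b d).
Local Notation hlen := (@hlen R p b d).

Lemma rowvec_gens k : exists l : seq 'rV[R]_k, forall v, fspan p 0 l v.
Proof.
exists [seq delta_mx 0 j | j <- enum 'I_k] => v B sB lB; rewrite (row_sum_delta v).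
apply: (stable_sum _ sB) => j _.
by apply: (stableZ (v 0 j) sB); apply: lB; apply: map_f; rewrite mem_enum.
Qed.

Section Finiteness.
Variable fs : seq R.
Hypothesis homotopy : forall f, f \in fs -> exists s : forall i, 'M[R]_(b i, b i.+1),
  forall i, d i *m s i + s i.+1 *m d i.+1 = f%:M.
Hypothesis fs_primary : forall P, primeS p P -> (forall f, f \in fs -> P f) -> P = m.

(** Contracting homotopies for fs survive the Frobenius twist and show that the
    powers f ^ (p ^ n) kill the homology, whatever the coefficients.  Hence its
    annihilator is primary to m. *)
Lemma homology_finite n P i : stable 0 P -> hfin m 0 n setT P i.
Proof.
move=> sP; set Z := @cyc R p b d n setT P i; set B := @bnd R p b d n setT P i.
have sT : stable 0 (setT : set R^o) by [].
have sZ : stable 0 Z by exact: stable_cyc.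
have sB : stable 0 B by exact: stable_bnd.
pose J : set R^o := fun r : R => forall v, Z v -> B (r *: v).
have sJ : stable 0 J.
  split=> [v _|r s hr hs v Zv|r s hs v Zv].
  - by rewrite scale0r; exact: (stable0 sB).
  - by rewrite scalerBl; apply: (stableB sB); [exact: hr | exact: hs].
  - by rewrite scaler_regular -scalerA; apply: (stableZ _ sB); exact: hs.
have fJ : finlen m 0 setT J.
  apply: finlen_of_primes => // P' pP' JP'; apply: fs_primary => // f ff.
  apply: (prime_exp pP' (n := (p ^ n)%N)); apply: JP' => v [_ hv].
  have [s hs] := homotopy ff; exists (v *m fmx p n (s i.+1)) => //.
  rewrite -mul_scalar_mx -(scalar_mxC (f ^+ _)).
  rewrite -(fmx_scalar chR) -(hs i) (fmxD chR) !(fmxM chR) mulmxDr !mulmxA addrK.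
  by rewrite -(addn0 n); apply: coords_mul => //; rewrite addn0.
have [g gT] := rowvec_gens (b i.+1).
have [l El] := noetherian_span chR noeth sZ (l := g) (fun v _ => gT v).
have [|X [sX BX lX [fX _]]] := len_generated chR (k := 0) (l := l) pm sB fJ.
  move=> u r ul Jr; have Zu : Z u by have : fspan p 0 l u; [exact: mem_fspan | rewrite -El].
  exact: Jr u Zu.
by apply: finlen_mono fX => //; rewrite -/Z El; exact: fspan_least.
Qed.
End Finiteness.

Lemma rho_gt0 : (0 < rho m)%N.
Proof.
have [sm m1 _] := pm.
apply: (nontorsion_len (stable_ideal 1 sm) (@subsetT _ _) (finlen_rho chR noeth g1T pm)).
exists 1 => // s ms; rewrite scaler_regular mulr1 => h; apply: ms; exact: (prime_exp pm h).
Qed.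

Lemma pushforward_hlen n P i : stable 0 P -> hfin m 0 n.+1 setT P i ->
  hfin m 1 n.+1 setT P i /\ hlen m 1 n.+1 setT P i = (rho m * hlen m 0 n.+1 setT P i)%N.
Proof.
move=> sP fP; have sT : stable 0 (setT : set R^o) by [].
apply: (len_scale1 chR pm (finlen_rho chR noeth g1T pm)) => //.
- exact: stable_cyc.
- exact: stable_bnd.
- by rewrite -(addn0 n.+1); exact: bnd_cyc.
Qed.

(** The twist n + 1 with coefficients in R / P, seen through Frobenius, is the twist n
    with coefficients in the push-forward of R / P, which a prime filtration
    dissects. *)
Lemma hlen_recurrence i n P l : stable 0 P -> pfilt p 1 P l ->
  (forall k P', stable 0 P' -> hfin m 0 k setT P' i) ->
  (rho m * hlen m 0 n.+1 setT P i <= \sum_(P' <- l) hlen m 0 n setT P' i)%N.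
Proof.
move=> sP hl fin; have [_ <-] := pushforward_hlen sP (fin n.+1 P sP).
have [|_] := homology_subadditive chR dd (n := n) (i := i) pm hl (stable_ideal 1 sP).
  by move=> P' lP'; apply: fin; have [] := pfilt_prime hl lP'.
by rewrite addn1.
Qed.

Lemma euler_recurrence L n P l : b 0 = 0%N -> b L.+1 = 0%N ->
  stable 0 P -> pfilt p 1 P l ->
  (forall i k P', stable 0 P' -> hfin m 0 k setT P' i) ->
  (rho m)%:Z * euler p d m L 0 n.+1 setT P = \sum_(P' <- l) euler p d m L 0 n setT P'.
Proof.
move=> b0 bL sP hl fin.
rewrite -(@euler_filtration R p chR b d dd m n pm L b0 bL 1 P l hl (stable_ideal 1 sP)); last first.
  by move=> P' i lP'; apply: fin; have [] := pfilt_prime hl lP'.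
rewrite /euler mulr_sumr; apply: eq_bigr => i _.
by rewrite addn1 (pushforward_hlen sP (fin i n.+1 P sP)).2 PoszM mulrCA.
Qed.

End Recurrence.

(** * Affine recurrences and rational limits *)

Section Contraction.
Variable K : realType.
Implicit Types (u g : nat -> K) (lam : K).

Lemma cvg0_contraction u g lam : 0 <= lam < 1 -> (forall n, 0 <= u n) ->
  (forall n, u n.+1 <= lam * u n + g n) ->
  g n @[n --> \oo] --> 0 -> u n @[n --> \oo] --> (0 : K).
Proof.
move=> /andP[lam0 lam1] u0 rec g0.
apply/cvgrPdist_le => eps eps0.
have del0 : 0 < eps / 2 * (1 - lam) by rewrite mulr_gt0 ?divr_gt0 ?subr_gt0.
have [N _ hN] := (cvgrPdist_le _ _).1 g0 _ del0.
have bound k : u (N + k)%N <= lam ^+ k * u N + eps / 2.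
  elim: k => [|k IH]; first by rewrite addn0 expr0 mul1r; lra.
  rewrite addnS; apply: le_trans (rec _) _.
  have := hN (N + k)%N (leq_addr _ _); rewrite /= sub0r normrN ler_norml => /andP[_ hg].
  have : lam * u (N + k)%N <= lam * (lam ^+ k * u N + eps / 2) by rewrite ler_wpM2l.
  by rewrite exprS mulrDr mulrA; move: hg; move: (lam * lam ^+ k * u N) => z; lra.
have geo : (fun k => lam ^+ k * u N) @ \oo --> (0 : K).
  rewrite -(mul0r (u N)); apply: cvgMl.
  by apply: cvg_expr; rewrite ger0_norm.
have eps20 : 0 < eps / 2 by rewrite divr_gt0.
have [M _ hM] := (cvgrPdist_le _ _).1 geo _ eps20.
exists (N + M)%N => // n /= NMn.
rewrite sub0r normrN ger0_norm //.
have -> : n = (N + (n - N))%N by rewrite subnKC // (leq_trans _ NMn) // leq_addr.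
apply: le_trans (bound _) _.
have := hM (n - N)%N; rewrite /= sub0r normrN => /(_ _)/wrap[]; first by rewrite leq_subRL // (leq_trans _ NMn) // leq_addr.
by rewrite ler_norml => /andP[_]; lra.
Qed.

(** The limit is the fixed point of x = lam x + l, and the distance to it
    contracts. *)
Lemma cvg_affine_recurrence u g lam (l : K) : 0 <= lam < 1 ->
  (forall n, u n.+1 = lam * u n + g n) ->
  g n @[n --> \oo] --> l -> u n @[n --> \oo] --> l / (1 - lam).
Proof.
move=> lam01 rec gl; have /andP[_ lam1] := lam01.
have nz : 1 - lam != 0 by rewrite subr_eq0 gt_eqF.
apply/subr_cvg0/norm_cvg0P.
apply: (@cvg0_contraction _ (fun n => `|g n - l|) lam) => //.
- move=> n; rewrite /= rec.
  have -> : lam * u n + g n - l / (1 - lam) = lam * (u n - l / (1 - lam)) + (g n - l).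
    by field.
  apply: le_trans (ler_normD _ _) _; rewrite normrM ger0_norm //.
  by case/andP: lam01.
- by apply/norm_cvg0P/subr_cvg0.
Qed.

Definition rat_limit u : Prop := exists q : rat, u n @[n --> \oo] --> (ratr q : K).

Lemma rat_limit_affine u g (a : rat) : 0 <= a < 1 ->
  (forall n, u n.+1 = ratr a * u n + g n) -> rat_limit g -> rat_limit u.
Proof.
move=> /andP[a0 a1] rec [q hq]; exists (q / (1 - a)).
rewrite fmorph_div rmorphB rmorph1; apply: cvg_affine_recurrence hq => //.
by rewrite ler0q a0 -(rmorph1 (@ratr K)) ltr_rat.
Qed.

Lemma rat_limit_sum (T : eqType) (l : seq T) (u : T -> nat -> K) :
  (forall t, t \in l -> rat_limit (u t)) ->
  rat_limit (fun n => \sum_(t <- l) u t n).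
Proof.
elim: l => [_|t l IH h].
  by exists 0; rewrite rmorph0; under eq_fun do rewrite big_nil; exact: cvg_cst.
have [q hq] := h t (mem_head _ _).
have [|r hr] := IH; first by move=> x xl; apply: h; rewrite inE xl orbT.
by exists (q + r); rewrite rmorphD; under eq_fun do rewrite big_cons; exact: cvgD.
Qed.

Lemma rat_limitM u (a : rat) : rat_limit u -> rat_limit (fun n => ratr a * u n).
Proof. by move=> [q hq]; exists (a * q); rewrite rmorphM; exact: cvgMr. Qed.

Lemma rat_limitD u v : rat_limit u -> rat_limit v -> rat_limit (fun n => u n + v n).
Proof. by move=> [q hq] [r hr]; exists (q + r); rewrite rmorphD; exact: cvgD. Qed.

Lemma cvg0_sum (T : eqType) (l : seq T) (u : T -> nat -> K) :
  (forall t, t \in l -> u t n @[n --> \oo] --> 0) ->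
  (\sum_(t <- l) u t n) @[n --> \oo] --> (0 : K).
Proof.
elim: l => [_|t l IH h]; first by under eq_fun do rewrite big_nil; exact: cvg_cst.
have -> : (fun n => \sum_(x <- t :: l) u x n) = (fun n => u t n + \sum_(x <- l) u x n).
  by apply/funext => n; rewrite big_cons.
have hl : (fun n => \sum_(x <- l) u x n) @ \oo --> (0 : K).
  by apply: IH => x xl; apply: h; rewrite inE xl orbT.
rewrite -[X in _ --> X]addr0; apply: cvgD hl; apply: h; exact: mem_head.
Qed.
End Contraction.

(** * Growth along the primes *)

Lemma big_count_split (T : eqType) (V : nmodType) (l : seq T) (x : T) (G : T -> V) :
  \sum_(t <- l) G t = G x *+ count_mem x l + \sum_(t <- [seq t <- l | t != x]) G t.
Proof.
elim: l => [|t l IH]; first by rewrite !big_nil mulr0n addr0.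
rewrite big_cons IH /=; case: eqVneq => [->|ne] /=; first by rewrite mulrS addrA.
by rewrite big_cons addrCA.
Qed.

Section Growth.
Variables (K : realType) (R : idomainType) (p : nat) (chR : p \in [pchar R]).
Hypothesis noeth : forall J : set R^o, stable p 0 J -> fgen p 0 J.
Variable g1 : seq R^o.
Hypothesis g1T : forall v, fspan p 1 g1 v.
Variables (m : set R^o) (dim : nat).
Local Notation rho := (@rho R p).
Local Notation kappa := (rho m).
Hypothesis kappa_gt0 : (0 < kappa)%N.
Hypothesis rho_bound : forall Q, primeS p Q -> Q != [set 0] ->
  (rho Q * p <= kappa * p ^ dim)%N.
Implicit Types (P Q : set R^o).
Local Notation D := ((p ^ dim)%N%:R : K).
Local Notation c := ((kappa * p ^ dim)%N%:R : K).

Let p_gt1 : (1 < p)%N. Proof. by rewrite prime_gt1 // (pcharf_prime chR). Qed.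
Let p_gt0 : (0 < p)%N. Proof. exact: ltnW. Qed.
Let D0 : D != 0. Proof. by rewrite pnatr_eq0 expn_eq0 gtn_eqF. Qed.
Let c_gt0n : (0 < kappa * p ^ dim)%N. Proof. by rewrite muln_gt0 kappa_gt0 expn_gt0 p_gt0. Qed.
Let k0 : (kappa%:R : K) != 0. Proof. by rewrite pnatr_eq0 gtn_eqF. Qed.

Let ratio P : rat := (rho P)%:R / (kappa * p ^ dim)%N%:R.

Lemma rho_lt P : primeS p P -> P != [set 0] -> (rho P < kappa * p ^ dim)%N.
Proof.
move=> pP P0.
have := rho_bound pP P0; have [->//|r0] := posnP (rho P).
by apply: leq_trans; rewrite -{1}[rho P]muln1 ltn_pmul2l.
Qed.

Let ratioP P : primeS p P -> P != [set 0] -> 0 <= ratio P < 1.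
Proof.
move=> pP P0; rewrite /ratio divr_ge0 //= ltr_pdivrMr ?ltr0n // mul1r ltr_nat.
exact: rho_lt.
Qed.

Let ratioK P : ratr (ratio P) = (rho P)%:R / c :> K.
Proof. by rewrite /ratio fmorph_div !rmorph_nat. Qed.

(** Apart from P itself only strictly larger primes occur in a filtration of the
    push-forward of R / P. *)
Lemma prime_dissection P : primeS p P -> exists2 l, pfilt p 1 P l &
  forall P', P' \in [seq t <- l | t != P] ->
    [/\ primeS p P', P `<=` P' & ~ P' `<=` P].
Proof.
move=> pP; have [sP _ _] := pP.
have [l hl] := gens_stable_exists chR noeth g1T (stable_ideal 1 sP).
exists l => // P'; rewrite mem_filter => /andP[ne lP'].
have PP' := pfilt_sup chR hl sP lP'.
split=> //; first exact: pfilt_prime hl lP'.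
by move=> P'P; move/eqP: ne; apply; apply/seteqP.
Qed.

Lemma prime_above_nonzero P P' : primeS p P -> primeS p P' -> P `<=` P' -> ~ P' `<=` P ->
  P' != [set 0].
Proof.
move=> [sP _ _] _ _ nP'; apply/eqP => E; apply: nP'; rewrite E => x ->.
exact: (stable0 sP).
Qed.

Lemma noeth_prime_ind (T : set R^o -> Prop) :
  (forall P, primeS p P -> P != [set 0] ->
    (forall P', primeS p P' -> P' != [set 0] -> P `<=` P' -> ~ P' `<=` P -> T P') -> T P) ->
  forall P, primeS p P -> P != [set 0] -> T P.
Proof.
move=> step P pP P0; have [sP _ _] := pP; move: P sP pP P0.
apply: (noeth_ind chR noeth (@regular_gen R p)) => P sP IH pP P0.
by apply: step => // P' pP' P'0 PP' nP'; apply: IH => //; case: pP'.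
Qed.

(** Normalized by (p ^ dim) ^ n, the sequence satisfies a recurrence whose ratio
    rho P / (kappa p ^ dim) is below 1 and whose inhomogeneous part, from the larger
    primes, tends to 0. *)
Lemma growth_step (F : nat -> set R^o -> nat) :
  (forall P l n, primeS p P -> pfilt p 1 P l ->
     (kappa * F n.+1 P <= \sum_(P' <- l) F n P')%N) ->
  forall P, primeS p P -> (rho P < kappa * p ^ dim)%N ->
  (forall P', primeS p P' -> P `<=` P' -> ~ P' `<=` P ->
    ((F n P')%:R / D ^+ n) @[n --> \oo] --> (0 : K)) ->
  ((F n P)%:R / D ^+ n) @[n --> \oo] --> (0 : K).
Proof.
move=> rec P pP ltP IH.
have [l hl ll] := prime_dissection pP.
have [_ Erho] := rho_filtration chR pP hl.
set l' := [seq t <- l | t != P] in ll.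
pose g n : K := c^-1 * \sum_(P' <- l') (F n P')%:R / D ^+ n.
apply: (@cvg0_contraction K _ g (ratr (ratio P))).
- by rewrite ler0q -(rmorph1 (@ratr K)) ltr_rat /ratio divr_ge0 //= ltr_pdivrMr ?ltr0n // mul1r ltr_nat.
- by move=> n; rewrite divr_ge0.
- move=> n; have := rec P l n pP hl; rewrite (big_count_split _ P) -/l' -Erho.
  have mulnE (a k : nat) : a *+ k = (a * k)%N.
    by elim: k => [|k IHk]; rewrite ?muln0 // mulrS IHk mulnS.
  rewrite mulnE -(ler_nat K) natrM natrD natrM natr_sum => h.
  rewrite ratioK /g -mulr_suml [D ^+ n.+1]exprS invfM natrM.
  have Dn : 0 < (D * D ^+ n)%R by rewrite mulr_gt0 ?exprn_gt0 // lt_neqAle eq_sym D0 /=.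
  rewrite -(ler_pM2l (x := kappa%:R * (D * D ^+ n))); last first.
    by rewrite mulr_gt0 // ltr0n.
  have Dn0 : D ^+ n != 0 by rewrite expf_neq0.
  apply: le_trans (_ : _ <= kappa%:R * (F n.+1 P)%:R) _.
    by rewrite le_eqVlt; apply/orP; left; apply/eqP; field; rewrite Dn0 D0.
  apply: (le_trans h); rewrite le_eqVlt; apply/orP; left; apply/eqP; field.
  by rewrite Dn0 D0 k0.
- rewrite -(mulr0 c^-1); apply: cvgMr; apply: cvg0_sum => P' /ll[pP' PP' nP'].
  exact: IH.
Qed.

Lemma growth_negligible (F : nat -> set R^o -> nat) :
  (forall P l n, primeS p P -> pfilt p 1 P l ->
     (kappa * F n.+1 P <= \sum_(P' <- l) F n P')%N) ->
  forall P, primeS p P -> P != [set 0] ->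
  ((F n P)%:R / D ^+ n) @[n --> \oo] --> (0 : K).
Proof.
move=> rec; apply: noeth_prime_ind => P pP P0 IH.
apply: growth_step => //; first exact: rho_lt.
by move=> P' pP' PP' nP'; apply: IH => //; exact: prime_above_nonzero PP' nP'.
Qed.

(** Otherwise growth_step would apply to the zero ideal as well. *)
Lemma rho_zero_exact (F : nat -> set R^o -> nat) (eps : K) :
  (forall P l n, primeS p P -> pfilt p 1 P l ->
     (kappa * F n.+1 P <= \sum_(P' <- l) F n P')%N) ->
  0 < eps -> (\forall n \near \oo, eps <= (F n [set 0])%:R / D ^+ n) ->
  (kappa * p ^ dim <= rho [set 0%R : R^o])%N.
Proof.
move=> rec eps0 ge; rewrite leqNgt; apply/negP => lt.
have pZ := @primeS_zero R p.
have c0 : ((F n [set 0])%:R / D ^+ n) @[n --> \oo] --> (0 : K).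
  apply: growth_step => // P' pP' PP' nP'.
  by apply: growth_negligible => //; exact: prime_above_nonzero PP' nP'.
have h : eps <= 0 := cvgr_to_ge c0 ge.
by move: eps0; rewrite ltNge h.
Qed.


Variable X : nat -> set R^o -> int.
Hypothesis X_rec : forall P l n, primeS p P -> pfilt p 1 P l ->
  kappa%:Z * X n.+1 P = \sum_(P' <- l) X n P'.

Let x n P : K := (X n P)%:~R / D ^+ n.

Let x_rec P l n : primeS p P -> pfilt p 1 P l ->
  x n.+1 P = ratr (ratio P) * x n P + c^-1 * \sum_(P' <- [seq t <- l | t != P]) x n P'.
Proof.
move=> pP hl; have [_ Erho] := rho_filtration chR pP hl.
have /(congr1 (fun z : int => z%:~R : K)) /= := X_rec n pP hl.
rewrite (big_count_split _ P) -Erho intrM intrD rmorphMn rmorph_sum /= -[_ *+ rho P]mulr_natr => h.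
rewrite ratioK /x -mulr_suml [D ^+ n.+1]exprS natrM.
have Dn0 : D ^+ n != 0 by rewrite expf_neq0.
have {}h : kappa%:R * (X n.+1 P)%:~R = _ := h.
rewrite -[(X n.+1 P)%:~R in LHS](mulKf k0) h.
by field; rewrite Dn0 D0 k0.
Qed.

(** The partial sums S_n of the normalized sequence satisfy
    S_(n+1) = ratio S_n + (x_0 + partial sums for the larger primes), an affine
    recurrence with rational data whose ratio is below 1. *)
Lemma series_rational P : primeS p P -> P != [set 0] ->
  rat_limit (fun n => \sum_(k < n) x k P : K).
Proof.
move: P; apply: noeth_prime_ind => P pP P0 IH.
have [l hl ll] := prime_dissection pP.
set l' := [seq t <- l | t != P] in ll.
apply: (@rat_limit_affine K _ (fun n => (X 0 P)%:~R +
  ratr (kappa * p ^ dim)%N%:R^-1 * \sum_(P' <- l') \sum_(k < n) x k P') (ratio P)).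
- exact: ratioP.
- move=> n; rewrite big_ord_recl /= mulr_sumr fmorphV.
  under eq_bigr do rewrite (x_rec _ pP hl).
  rewrite big_split /= -!mulr_sumr /x expr0 divr1 exchange_big /= ratr_nat.
  by rewrite addrCA addrA [_ + _%:~R]addrC.
- apply: rat_limitD.
    by exists (X 0 P)%:~R; rewrite ratr_int; exact: cvg_cst.
  apply: rat_limitM; apply: rat_limit_sum => P' /ll[pP' PP' nP'].
  by apply: IH => //; exact: prime_above_nonzero PP' nP'.
Qed.

(** For the zero ideal the ratio is exactly 1, so the normalized sequence is its
    initial value plus partial sums of the series over the nonzero primes. *)
Lemma limit_rational : rho [set 0] = (kappa * p ^ dim)%N ->
  rat_limit (fun n => x n [set 0] : K).
Proof.
move=> E0; have pP := @primeS_zero R p; have [l hl ll] := prime_dissection pP.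
set l' := [seq t <- l | t != [set 0]] in ll.
have -> : (fun n => x n [set 0]) = (fun n => (X 0 [set 0])%:~R +
  ratr (kappa * p ^ dim)%N%:R^-1 * \sum_(P' <- l') \sum_(k < n) x k P').
  apply/funext; elim=> [|n IH].
    by rewrite big1 ?mulr0 ?addr0 /x ?expr0 ?divr1 // => P' _; rewrite big_ord0.
  rewrite (x_rec _ pP hl) ratioK E0 divff ?mul1r; last by rewrite pnatr_eq0 gtn_eqF.
  rewrite IH; have -> : ratr (kappa * p ^ dim)%N%:R^-1 = c^-1 by rewrite fmorphV rmorph_nat.
  rewrite -addrA -mulrDr -big_split /=; congr (_ + _ * _).
  by apply: eq_bigr => P' _; rewrite big_ord_recr.
apply: rat_limitD.
  by exists (X 0 [set 0])%:~R; rewrite ratr_int; exact: cvg_cst.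
apply: rat_limitM; apply: rat_limit_sum => P' /ll[pP' PP' nP'].
by apply: series_rational => //; exact: prime_above_nonzero PP' nP'.
Qed.

End Growth.

(** * Regular sequences and their Frobenius powers *)

Section CyclicFiltration.
Variables (R : comNzRingType) (p : nat) (chR : p \in [pchar R]).
Local Notation stable e N := (@stable R p _ e N).
Local Notation colon := (@colon R p R^o 0).
Local Notation adjoin := (@adjoin R p R^o 0).
Local Notation chain := (@chain R p).
Local Notation finlen := (@finlen R p).
Local Notation len := (@len R p).
Implicit Types (J B M : set R^o) (us : seq R).

Lemma adjoinE J (u v : R) : adjoin J u v <-> exists r : R, J (v - r * u).
Proof. by split=> -[r h]; exists r; move: h; rewrite expn0 expr1. Qed.

Lemma colonE J (u r : R) : colon J u r <-> J (r * u).
Proof. by rewrite /colon expn0 expr1. Qed.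

(** M / J is filtered by cyclic quotients, all isomorphic to R / B. *)
Fixpoint cfilt J B us M : Prop :=
  if us is u :: us' then colon J u = B /\ cfilt (adjoin J u) B us' M else J = M.

Lemma cfilt_cat J B us us' M M' : cfilt J B us M -> cfilt M B us' M' ->
  cfilt J B (us ++ us') M'.
Proof. by elim: us J => [|u us IH] J /=; [move=> -> | move=> [-> /IH h] /h]. Qed.

Definition nzd J (x : R) := forall r : R, J (x * r) -> J r.

Lemma nzd_cfilt J B us x : stable 0 J -> cfilt J B us setT -> nzd B x -> nzd J x.
Proof.
elim: us J => [|u us IH] J sJ /=; first by move=> -> _.
move=> [E hf] nB z Jz; have sA := stable_adjoin chR (u : R^o) sJ.
have /adjoinE[r hr] : adjoin J u z.
  by apply: (IH _ sA hf nB); apply: sub_adjoin.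
have : B r.
  apply: nB; rewrite -E; apply/colonE.
  rewrite (_ : x * r * u = x * z - x * (z - r * u)); last by ring.
  by apply: (stableB sJ) => //; rewrite mulrC; rewrite mulrC; exact: (stable0M sJ).
by rewrite -E => /colonE hru; rewrite -(subrK (r * u) z); exact: (stableD sJ).
Qed.

(** Since x is a nonzerodivisor on all factors, a filtration stays exact modulo x. *)
Lemma colon_adjoin J B us (u x : R) : stable 0 J -> cfilt J B (u :: us) setT -> nzd B x ->
  colon (adjoin J x) u = adjoin B x.
Proof.
move=> sJ [E hf] nB; have sA := stable_adjoin chR (u : R^o) sJ.
apply/seteqP; split=> r.
  move=> /colonE/adjoinE[t hJ].
  have /adjoinE[r' hr'] : adjoin J u t.
    apply: (nzd_cfilt sA hf nB); apply/adjoinE; exists r.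
    by rewrite (_ : _ - _ = - (r * u - t * x)); [exact: (stableN sJ) | ring].
  apply/adjoinE; exists r'; rewrite -E; apply/colonE.
  rewrite (_ : _ * u = (r * u - t * x) + x * (t - r' * u)); last by ring.
  by apply: (stableD sJ) => //; exact: (stable0M sJ).
move=> /adjoinE[s]; rewrite -E => /colonE h; apply/colonE/adjoinE; exists (s * u).
by rewrite (_ : _ - _ = (r - s * x) * u) //; ring.
Qed.

(** The ideal J + x^(q+1) R + x^q M, which runs from J + x^(q+1) R to J + x^q R as M runs
    from J to R. *)
Definition powlayer J (x : R) q M : set R^o := fun v : R => exists t w : R,
  M w /\ J (v - x ^+ q.+1 * t - x ^+ q * w).

Lemma cfilt_powlayer J B us x q M : stable 0 J -> nzd J x -> nzd B x ->
  stable 0 M -> J `<=` M -> cfilt M B us setT ->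
  cfilt (powlayer J x q M) (adjoin B x) [seq x ^+ q * u | u <- us] (adjoin J (x ^+ q)).
Proof.
move=> sJ nJ nB; have nJq : nzd J (x ^+ q).
  by elim: q => [|q IH] r; [rewrite mul1r | rewrite exprSr -mulrA => /IH /nJ].
elim: us M => [|u us IH] M sM JM.
  move=> /= ->; apply/seteqP; split=> v.
    move=> [t [w [_ h]]]; apply/adjoinE; exists (x * t + w).
    by rewrite (_ : _ - _ = v - x ^+ q.+1 * t - x ^+ q * w) // exprS; ring.
  move=> /adjoinE[r h]; exists 0, r; split=> //.
  by rewrite (_ : _ - _ - _ = v - r * x ^+ q) //; ring.
move=> h; have [E hf] := h; have sA := stable_adjoin chR (u : R^o) sM; split.
  apply/seteqP; split=> r.
    move=> /colonE[t [w [Mw hJ]]].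
    rewrite -(colon_adjoin sM h nB); apply/colonE/adjoinE; exists t.
    have /JM hM : J (r * u - x * t - w).
      apply: nJq.
      have -> : x ^+ q * (r * u - x * t - w) = r * (x ^+ q * u) - x ^+ q.+1 * t - x ^+ q * w.
        by rewrite exprS; ring.
      exact: hJ.
    rewrite (_ : _ - _ = (r * u - x * t - w) + w); last by ring.
    exact: (stableD sM).
  rewrite -(colon_adjoin sM h nB) => /colonE/adjoinE[t hM]; apply/colonE.
  exists t, (r * u - t * x); split=> //.
  by rewrite (_ : _ - _ - _ = 0); [exact: (stable0 sJ) | rewrite exprS; ring].
have -> : adjoin (powlayer J x q M) (x ^+ q * u) = powlayer J x q (adjoin M u).
  apply/seteqP; split=> v.
    move=> /adjoinE[r [t [w [Mw hJ]]]]; exists t, (w + r * u); split.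
      by apply/adjoinE; exists r; rewrite addrK.
    by rewrite (_ : _ - _ - _ = v - r * (x ^+ q * u) - x ^+ q.+1 * t - x ^+ q * w) //; ring.
  move=> [t [w [/adjoinE[r hM] hJ]]]; apply/adjoinE; exists r, t, (w - r * u); split=> //.
  by rewrite (_ : _ - _ - _ = v - x ^+ q.+1 * t - x ^+ q * w) //; ring.
by apply: IH => // v /JM; exact: sub_adjoin.
Qed.

(** R / (J + x^q) has q layers x^i R / x^(i+1) R, each a copy of R / (J + x). *)
Lemma cfilt_power J B us x q : stable 0 J -> cfilt J B us setT -> nzd B x ->
  exists2 us', size us' = (q * size us)%N & cfilt (adjoin J (x ^+ q)) (adjoin B x) us' setT.
Proof.
move=> sJ hf nB; elim: q => [|q [us' s' h']].
  exists [::] => //=; apply/seteqP; split=> // v _; apply/adjoinE; exists v.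
  by rewrite expr0 mulr1 subrr; exact: (stable0 sJ).
exists ([seq x ^+ q * u | u <- us] ++ us').
  by rewrite size_cat size_map s' mulSn.
apply: cfilt_cat h'.
have -> : adjoin J (x ^+ q.+1) = powlayer J x q J.
  apply/seteqP; split=> v.
    move=> /adjoinE[r h]; exists r, 0; split; first exact: (stable0 sJ).
    by rewrite mulr0 subr0 mulrC.
  move=> [t [w [Jw h]]]; apply/adjoinE; exists t.
  rewrite (_ : _ - _ = (v - x ^+ q.+1 * t - x ^+ q * w) + x ^+ q * w); last by ring.
  by apply: (stableD sJ) => //; exact: (stable0M sJ).
by apply: cfilt_powlayer => //; exact: (nzd_cfilt sJ hf nB).
Qed.

Fixpoint seqideal (xs : seq R) q : set R^o :=
  if xs is x :: xs' then adjoin (seqideal xs' q) (x ^+ q) else [set 0].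

(** The sequence is listed from its last element to its first. *)
Fixpoint revregular (xs : seq R) : Prop :=
  if xs is x :: xs' then nzd (seqideal xs' 1) x /\ revregular xs' else True.

Lemma stable_seqideal xs q : stable 0 (seqideal xs q).
Proof. by elim: xs => [|x xs IH] /=; [exact: stable_zero | exact: stable_adjoin]. Qed.

(** Each element of the sequence, raised to the power q, multiplies the number of layers
    by q. *)
Lemma regular_cfilt xs q : revregular xs ->
  exists2 us, size us = (q ^ size xs)%N & cfilt (seqideal xs q) (seqideal xs 1) us setT.
Proof.
elim: xs => [_|x xs IH [nx /IH[us su hu]]].
  exists [:: 1] => //=; split.
    by apply/seteqP; split=> r; rewrite colonE mulr1.
  by apply/seteqP; split=> // v _; apply/adjoinE; exists v; rewrite mulr1 subrr.
have [us' s' h'] := cfilt_power q (stable_seqideal xs q) hu nx.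
by exists us'; rewrite /= ?expr1 // s' su expnS.
Qed.

Lemma seqideal_frob xs n (r : R) : seqideal xs 1 r -> seqideal xs (p ^ n) (r ^+ (p ^ n)).
Proof.
elim: xs r => [|x xs IH] r /=; first by move=> ->; exact: (frob0 chR).
move=> /adjoinE[s /IH h]; apply/adjoinE; exists (s ^+ (p ^ n)).
by move: h; rewrite (frobD chR) (frobN chR) expr1 exprMn.
Qed.

Lemma seqideal_min xs q J : stable 0 J -> (forall x, x \in xs -> J (x ^+ q)) ->
  seqideal xs q `<=` J.
Proof.
move=> sJ; elim: xs => [_ v ->|x xs IH h v /= /adjoinE[r hr]]; first exact: (stable0 sJ).
rewrite -(subrK (r * x ^+ q) v); apply: (stableD sJ).
  by apply: IH hr => y ys; apply: h; rewrite inE ys orbT.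
by apply: (stable0M sJ); apply: h; rewrite mem_head.
Qed.

Lemma mem_seqideal xs q x : x \in xs -> seqideal xs q (x ^+ q).
Proof.
elim: xs => [//|y xs IH]; rewrite inE => /orP[/eqP ->|/IH h] /=.
  by apply/adjoinE; exists 1; rewrite mul1r subrr; exact: (stable0 (stable_seqideal _ _)).
exact: sub_adjoin.
Qed.

Lemma cfilt_chain Q e J B us : primeS p Q -> stable 0 J -> B `<=` Q -> cfilt J B us setT ->
  chain Q e (size us) setT J.
Proof.
move=> pQ sJ BQ; elim: us J sJ => [|u us IH] J sJ; first by move=> /= ->.
move=> [E hf]; have sA := stable_adjoin chR (u : R^o) sJ.
have -> : size (u :: us) = (size us + 1)%N by rewrite addn1.
apply: (chain_cat (IH _ sA hf)).
exists J; split; [exact: stable_ideal | by [] | exact: sub_adjoin |].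
exists u; first exact: mem_adjoin.
move=> s Qs Jsu; apply: Qs; apply: (prime_exp pQ (n := (p ^ e)%N)); apply: BQ.
by rewrite -E; apply/colonE.
Qed.

Lemma cfilt_len Q J B us : primeS p Q -> stable 0 J -> finlen Q 0 setT B ->
  cfilt J B us setT ->
  finlen Q 0 setT J /\ len Q 0 setT J = (size us * len Q 0 setT B)%N.
Proof.
move=> pQ + fB; have Qm := prime_mul pQ.
elim: us J => [|u us IH] J sJ /=.
  move=> ->; rewrite mul0n; apply: torsion_len => // -[v _ /(_ 1)]; apply=> //.
  by case: pQ.
move=> [E hf]; have sA := stable_adjoin chR (u : R^o) sJ.
have [f1 E1] := IH _ sA hf.
have [E2 F2] := len_adjoin chR Q 0 (u : R^o) sJ; rewrite E in E2 F2.
have [f3 E3] := len_add Qm (@stable_setT R p R^o 0) sA sJ (@sub_adjoin _ _ chR _ 0 J u)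
  (@subsetT _ _) f1 (F2.1 fB).
by split=> //; rewrite E3 E1 mulSn addnC; congr (_ + _)%N.
Qed.

End CyclicFiltration.

(** * Dimension of Frobenius-finite local domains *)

Section LocalDomain.
Variables (R : idomainType) (p : nat) (chR : p \in [pchar R]).
Hypothesis noeth : forall J : set R^o, stable p 0 J -> fgen p 0 J.
Variable g1 : seq R^o.
Hypothesis g1T : forall v, fspan p 1 g1 v.
Variable m : set R^o.
Hypothesis pm : primeS p m.
Hypothesis m_local : forall s : R, ~ m s -> exists t : R, t * s = 1.
Local Notation stable e N := (@stable R p _ e N).
Local Notation finlen := (@finlen R p).
Local Notation len := (@len R p).
Local Notation chain := (@chain R p).
Local Notation adjoin := (@adjoin R p R^o 0).
Local Notation seqideal := (@seqideal R p).
Local Notation revregular := (@revregular R p).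
Implicit Types (P Q J N : set R^o) (xs : seq R).

Lemma minimal_member (l : seq (set R^o)) : l != [::] ->
  exists2 Q, Q \in l & forall P, P \in l -> P = Q \/ ~ P `<=` Q.
Proof.
elim: l => [//|X l IH] _; have [->|l0] := eqVneq l [::].
  by exists X; rewrite ?mem_head // => P; rewrite inE => /eqP; left.
have [Q Ql Qmin] := IH l0; have [XQ|XQ] := EM (X `<=` Q); last first.
  exists Q; first by rewrite inE Ql orbT.
  by move=> P; rewrite inE => /orP[/eqP ->|/Qmin //]; right.
exists X; first exact: mem_head.
move=> P; rewrite inE => /orP[/eqP ->|Pl]; first by left.
have [PX|PX] := EM (P `<=` X); last by right.
left; apply/seteqP; split=> //.
have [->|PQ] := Qmin P Pl; first exact: XQ.
by exfalso; apply: PQ => v /PX /XQ.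
Qed.

(** Let Q be minimal over the ideal B of the sequence, so that R / B has finite length
    c at Q.  The push-forward of R modulo the Frobenius power of B is filtered by
    p ^ (e * size xs) copies of a module alive at Q, while it is generated over R / B by
    size g1 ^ e elements and so has length at most size g1 ^ e * c. *)
Lemma depth_bound xs : revregular xs -> ~ seqideal xs 1 1 ->
  (p ^ size xs <= size g1)%N.
Proof.
move=> reg n1; set B := seqideal xs 1; have sB : stable 0 B by exact: stable_seqideal.
have [l hl] := gens_stable_exists chR noeth g1T sB.
have [|Q Ql Qmin] := @minimal_member l.
  by apply/eqP => l0; move: hl n1; rewrite l0 /= /B => ->; apply.
have pQ := pfilt_prime hl Ql.
have [fB _] := len_filtration chR sB pQ hl Qmin.
have BQ : B `<=` Q := pfilt_sup chR hl sB Ql.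
apply: (@leq_of_powers _ (len Q 0 setT B)) => e.
have sJ : stable 0 (seqideal xs (p ^ e)) by exact: stable_seqideal.
have [us su hus] := regular_cfilt chR (p ^ e) reg.
have := cfilt_chain chR e pQ sJ BQ hus; rewrite su -expnM [(e * _)%N]mulnC expnM => hch.
have [g gT gs] := frob_gens chR g1T e.
have [|X [sX JX gX [fX le]]] := len_generated chR (k := 0) (l := g) pQ (stable_ideal e sJ) fB.
  move=> u r _ Br; rewrite scaler_regular mulrC; apply: (stable0M sJ).
  exact: seqideal_frob.
have XT : X = setT by apply/seteqP; split=> // v _; exact: gT.
rewrite XT add0n in fX le; apply: leq_trans (len_max fX hch) _.
by apply: leq_trans le _; rewrite gs mulnC.
Qed.

Lemma unit_sub (r x : R) : m x -> exists t : R, t * (1 - r * x) = 1.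
Proof.
move=> mx; have [sm m1 _] := pm; apply: m_local => h; apply: m1.
by rewrite -(subrK (r * x) 1); apply: (stableD sm) => //; exact: (stable0M sm).
Qed.

(** If no power of x lay in J, the ideals J + x^k R would decrease forever. *)
Lemma nilpotent_mod J (x : R) : stable 0 J -> finlen m 0 setT J -> m x ->
  exists k, J (x ^+ k).
Proof.
move=> sJ [N hN] mx; apply: contrapT => nex.
suff : chain m 0 N.+1 setT J by move=> /hN; rewrite ltnn.
apply: (chain_mono (@subset_refl _ setT) (B := adjoin J (x ^+ N.+1))); first exact: sub_adjoin.
elim: N.+1 => [//|k IH].
have sAd i : stable 0 (adjoin J (x ^+ i)) by exact: stable_adjoin.
rewrite -addn1; apply: (chain_cat IH); rewrite addn1.
exists (adjoin J (x ^+ k.+1)); split; [exact: sAd | by [] | |].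
  move=> v /adjoinE[r h]; apply/adjoinE; exists (r * x); by rewrite -mulrA -exprS.
exists (x ^+ k : R); first exact: mem_adjoin.
move=> s /m_local[t ts] /adjoinE[r h]; apply: nex; exists k.
have [u hu] := unit_sub (t * r) mx.
have -> : x ^+ k = u * (t * (s * x ^+ k - r * x ^+ k.+1)).
  rewrite mulrBr mulrA ts mul1r exprS -[LHS]mul1r -hu; ring.
by apply: (stable0M sJ); apply: (stable0M sJ).
Qed.

Lemma uniform_nilpotent J : stable 0 J -> finlen m 0 setT J ->
  exists s, forall x : R, m x -> J (x ^+ (p ^ s)).
Proof.
move=> sJ fJ; have [sm _ _] := pm; have [l El] := noeth sm.
have p1 : (1 < p)%N by rewrite prime_gt1 // (pcharf_prime chR).
have up (x : R) i j : (i <= j)%N -> J (x ^+ i) -> J (x ^+ j).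
  by move=> ij h; rewrite -(subnK ij) exprD; exact: (stable0M sJ).
have [s hs] : exists s, forall x : R, x \in l -> J (x ^+ (p ^ s)).
  have : forall x : R, x \in l -> m x by rewrite El => x xl; exact: mem_fspan.
  elim: l {El} => [_|x l IH h]; first by exists 0%N.
  have [s hs] : exists s, forall x : R, x \in l -> J (x ^+ (p ^ s)).
    by apply: IH => y yl; apply: h; rewrite inE yl orbT.
  have [k hk] := nilpotent_mod sJ fJ (h x (mem_head _ _)).
  exists (s + k)%N => y; rewrite inE => /orP[/eqP ->|/hs].
    by apply: up hk; apply: leq_trans (ltnW (ltn_expl k p1)) _; rewrite leq_exp2l // leq_addl.
  by apply: up; rewrite leq_exp2l // leq_addr.
exists s => x; rewrite El => /(_ (fun x : R^o => J ((x : R) ^+ (p ^ s)))); apply=> //.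
split; first by rewrite (frob0 chR); exact: (stable0 sJ).
- by move=> u v hu hv; rewrite (frobD chR) (frobN chR); exact: (stableB sJ).
- by move=> r u hu; rewrite expn0 expr1 scaler_regular exprMn; exact: (stable0M sJ).
Qed.

Lemma prime_sub_max P : primeS p P -> P `<=` m.
Proof.
move=> [sP P1 _] x Px; apply: contrapT => /m_local[t tx]; apply: P1.
by rewrite -tx; exact: (stable0M sP).
Qed.

Lemma prime_over_finite J P : stable 0 J -> finlen m 0 setT J -> primeS p P -> J `<=` P ->
  P = m.
Proof.
move=> sJ fJ pP JP; apply/seteqP; split; first exact: prime_sub_max.
move=> x mx; have [k hk] := nilpotent_mod sJ fJ mx.
exact: (prime_exp pP (JP _ hk)).
Qed.

Section SystemOfParameters.
Variable xs : seq R.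
Hypotheses (reg : revregular xs) (xm : forall x, x \in xs -> m x).
Hypothesis fin : finlen m 0 setT (seqideal xs 1).
Local Notation dim := (size xs).

Lemma seqideal_max q : (0 < q)%N -> seqideal xs q `<=` m.
Proof.
have [sm _ _] := pm; move=> q0; apply: seqideal_min => // x /xm mx.
by rewrite -(prednK q0) exprSr; exact: (stable0M sm).
Qed.

Lemma parameter_growth n :
  (len m 0 setT (frobI p m n) <= len m 0 setT (seqideal xs 1) * p ^ (n * dim))%N.
Proof.
have sJ : stable 0 (seqideal xs (p ^ n)) by exact: stable_seqideal.
have [us su hus] := regular_cfilt chR (p ^ n) reg.
have [fJ EJ] := cfilt_len chR pm sJ fin hus.
apply: leq_trans (_ : _ <= len m 0 setT (seqideal xs (p ^ n)))%N _.
  apply: len_mono => //; apply: seqideal_min; first exact: stable_frobI.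
  by move=> x /xm; exact: mem_frobI.
by rewrite EJ su -expnM mulnC.
Qed.

(** Some Frobenius power of m lies in the ideal of xs, so Frobenius powers of J are,
    after a fixed shift s, contained in those of xs. *)
Lemma parameter_lower : exists s, forall n J, J `<=` m ->
  finlen m 0 setT (frobI p J (s + n)) ->
  (p ^ (n * dim) <= len m 0 setT (frobI p J (s + n)))%N.
Proof.
have sB : stable 0 (seqideal xs 1) by exact: stable_seqideal.
have [s hs] := uniform_nilpotent sB fin; exists s => n J Jm fJ.
have sJ : stable 0 (seqideal xs (p ^ n)) by exact: stable_seqideal.
have [us su hus] := regular_cfilt chR (p ^ n) reg.
have h := cfilt_chain chR 0 pm sJ (seqideal_max (q := 1) isT) hus.
rewrite su -expnM in h.
have sub : frobI p J (s + n) `<=` seqideal xs (p ^ n).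
  move=> v /(_ _ sJ); apply=> x /Jm mx; rewrite expnD exprM; apply: seqideal_frob => //; exact: hs.
by apply: len_max => //; exact: chain_mono h.
Qed.

End SystemOfParameters.

(** An ideal over J maximal among those that miss the products s x^i, s outside P, is
    prime; J itself misses them as x is a nonzerodivisor on R / J. *)
Lemma prime_below J P (x : R) : stable 0 J -> primeS p P -> J `<=` P -> nzd J x ->
  exists P', [/\ primeS p P', J `<=` P', P' `<=` P & ~ P' x].
Proof.
move=> sJ pP JP nx; have [_ P1 _] := pP.
pose good N := forall (s : R) i, ~ P s -> ~ N (s * x ^+ i).
have gJ : good J.
  move=> s i Ps h; apply/Ps/JP; elim: i h => [|i IH]; first by rewrite mulr1.
  by rewrite exprS mulrCA => /nx /IH.
suff : forall N, stable 0 N -> J `<=` N -> good N ->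
  exists P', [/\ primeS p P', J `<=` P', P' `<=` P & ~ P' x].
  by move=> /(_ J sJ (@subset_refl _ J) gJ).
apply: (noeth_ind chR noeth (@regular_gen R p)) => N sN IH JN gN.
have [h|/existsNP[a /existsNP[b /not_implyP[Nab /not_orP[Na Nb]]]]] :=
    EM (forall a b : R, N (a * b) -> N a \/ N b).
  exists N; split=> //.
  - by split=> // N1; apply: (gN 1 0%N P1); rewrite mulr1.
  - by move=> s Ns; apply: contrapT => Ps; apply: (gN s 0%N Ps); rewrite mulr1.
  - by move=> Nx; apply: (gN 1 1%N P1); rewrite mul1r.
have big (c : R) : ~ N c -> good (adjoin N c) ->
    exists P', [/\ primeS p P', J `<=` P', P' `<=` P & ~ P' x].
  move=> Nc gc; apply: (IH (adjoin N c)) => //.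
  - exact: stable_adjoin.
  - exact: sub_adjoin.
  - by move=> h; apply/Nc/h; exact: mem_adjoin.
  - by move=> v /JN; exact: sub_adjoin.
have bad (c : R) : ~ good (adjoin N c) ->
    exists s i, ~ P s /\ adjoin N c (s * x ^+ i).
  by move=> /existsNP[s /existsNP[i /not_implyP[Ps /contrapT h]]]; exists s, i.
have [ga|/bad[s [i [Ps /adjoinE[r hr]]]]] := EM (good (adjoin N a)); first exact: big ga.
have [gb|/bad[t [j [Pt /adjoinE[r' hr']]]]] := EM (good (adjoin N b)); first exact: big gb.
exfalso; apply: (gN (s * t) (i + j)%N (prime_mul pP Ps Pt)).
set u := s * x ^+ i in hr; set v := t * x ^+ j in hr'.
have -> : s * t * x ^+ (i + j) = v * (u - r * a) + (r * a) * (v - r' * b) + r * r' * (a * b).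
  by rewrite /u /v exprD; ring.
by apply: (stableD sN); [apply: (stableD sN) |]; exact: (stable0M sN).
Qed.

Lemma prime_chain_below xs P : revregular xs -> primeS p P -> seqideal xs 1 `<=` P ->
  exists C : nat -> set R^o, [/\ C (size xs) = P,
    forall i, (i <= size xs)%N -> primeS p (C i) &
    forall i, (i < size xs)%N -> C i `<=` C i.+1 /\ ~ C i.+1 `<=` C i].
Proof.
elim: xs P => [|x xs IH] P /=.
  by move=> _ pP _; exists (fun=> P); split.
move=> [nx reg] pP sub; have sJ : stable 0 (seqideal xs 1) by exact: stable_seqideal.
have JP : seqideal xs 1 `<=` P by move=> v hv; apply: sub; exact: sub_adjoin.
have Px : P x.
  by apply: sub; rewrite expr1; exact: mem_adjoin.
have [P' [pP' JP' P'P nPx]] := prime_below sJ pP JP nx.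
have [C [Cs Cp Ci]] := IH P' reg pP' JP'.
exists (fun i => if (i <= size xs)%N then C i else P); split.
- by rewrite ltnn.
- by move=> i _; case: leqP => // /Cp.
- move=> i; rewrite ltnS => le; rewrite le; case: ltnP => [lt|ge]; first exact: Ci.
  have -> : i = size xs by apply/eqP; rewrite eqn_leq le.
  by rewrite Cs; split=> // /(_ _ Px).
Qed.

End LocalDomain.

(** * Finite free resolutions over a perfect coherent ring *)

Section PerfectTor.
Variables (S : comNzRingType) (p : nat) (chS : p \in [pchar S]).
Hypothesis reduced : forall s : S, s ^+ p = 0 -> s = 0.
Implicit Types (rs : seq (nat -> S)) (r : nat -> S).

Definition root_system r := forall n, r n.+1 ^+ p = r n.

(** With r n a compatible system of p^n-th roots of x, this adjoins the ideal of all
    roots of x: radI rs is the radical of the ideal generated by the elements whose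
    roots are listed, and S / radI rs is again perfect. *)
Fixpoint radI rs (s : S) : Prop :=
  if rs is r :: rs' then exists n t, radI rs' (s - t * r n) else s = 0.

Let p_gt1 : (1 < p)%N. Proof. by rewrite prime_gt1 // (pcharf_prime chS). Qed.

Let rootM r n : root_system r -> r n = r n.+1 ^+ p.-1 * r n.+1.
Proof. by move=> hr; rewrite -exprSr prednK ?hr // ltnW. Qed.

Lemma radI_ideal rs : (forall r, List.In r rs -> root_system r) ->
  [/\ radI rs 0, forall s t, radI rs s -> radI rs t -> radI rs (s - t)
   & forall a s, radI rs s -> radI rs (a * s)].
Proof.
elim: rs => [_|r rs IH h]; first by split=> // [s t -> ->|a s ->]; rewrite ?subrr ?mulr0.
have [I0 IB IM] := IH (fun r' h' => h r' (or_intror h')).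
have hr := h r (or_introl erefl).
have up n k t s : radI rs (s - t * r n) -> exists t', radI rs (s - t' * r (n + k)%N).
  elim: k => [|k IHk]; first by rewrite addn0; exists t.
  move=> /IHk[t' ht']; exists (t' * r (n + k).+1 ^+ p.-1).
  by rewrite addnS -mulrA -rootM.
split=> /=.
- by exists 0%N, 0; rewrite mul0r subrr.
- move=> s t [n [x /(up n)h1]] [k [y /(up k)h2]].
  have [x' hx] := h1 k; have [y' hy] := h2 n.
  exists (n + k)%N, (x' - y'); rewrite [(k + n)%N]addnC in hy.
  rewrite (_ : _ - _ = (s - x' * r (n + k)%N) - (t - y' * r (n + k)%N)); last by ring.
  exact: IB.
- move=> a s [n [t hs]]; exists n, (a * t).
  by rewrite -mulrA -mulrBr; exact: IM.
Qed.

Hypothesis perfect : forall s : S, exists t, t ^+ p = s.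

Lemma radI_radical rs s : (forall r, List.In r rs -> root_system r) ->
  radI rs (s ^+ p) -> radI rs s.
Proof.
have pB (x y : S) : (x - y) ^+ p = x ^+ p - y ^+ p.
  by have := frobD chS x (- y) 1; rewrite (frobN chS) expn1.
elim: rs s => [|r rs IH] s h; first exact: reduced.
move=> [n [t ht]]; have hr := h r (or_introl erefl).
have [t' tt] := perfect t; exists n.+1, t'; apply: IH.
  by move=> r' h'; apply: h; right.
by rewrite pB exprMn tt hr.
Qed.

Definition radrow rs k (v : 'rV[S]_k) := forall j, radI rs (v 0 j).

Section Row.
Variable rs : seq (nat -> S).
Hypothesis hrs : forall r, List.In r rs -> root_system r.
Let I0 := let: And3 h _ _ := radI_ideal hrs in h.
Let IB := let: And3 _ h _ := radI_ideal hrs in h.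
Let IM := let: And3 _ _ h := radI_ideal hrs in h.

Lemma radI_add s t : radI rs s -> radI rs t -> radI rs (s + t).
Proof. by move=> hs ht; rewrite -(opprK t) -sub0r -opprB subr0; apply: IB => //; rewrite -sub0r; exact: IB. Qed.

Lemma radI_sum (I : Type) (l : seq I) (F : I -> S) : (forall i, radI rs (F i)) ->
  radI rs (\sum_(i <- l) F i).
Proof. by move=> h; elim/big_ind: _ => //; exact: radI_add. Qed.

Lemma radrowD k (u v : 'rV[S]_k) : radrow rs u -> radrow rs v -> radrow rs (u + v).
Proof. by move=> hu hv j; rewrite mxE; exact: radI_add. Qed.

Lemma radrowM k l (u : 'rV[S]_k) (A : 'M[S]_(k, l)) : radrow rs u -> radrow rs (u *m A).
Proof. by move=> hu j; rewrite mxE; apply: radI_sum => i; rewrite mulrC; exact: IM. Qed.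

Lemma radrowZ k (u : 'rV[S]_k) a : radrow rs u -> radrow rs (a *: u).
Proof. by move=> hu j; rewrite mxE; exact: IM. Qed.
End Row.

Variables (b : nat -> nat) (d : forall i, 'M[S]_(b i.+1, b i)).
Hypothesis dd : forall i, d i.+1 *m d i = 0.
Hypothesis exact_d : forall i (z : 'rV[S]_(b i.+2)), z *m d i.+1 = 0 ->
  exists w, z = w *m d i.+2.

(** The i-th homology of the complex modulo radI rs vanishes for i > size rs: each
    element of rs adds at most one to the Tor-dimension.  A cycle modulo
    radI (r :: rs) has differential r n *: y modulo radI rs.  As radI rs is radical,
    r n annihilating the differential of y modulo radI rs forces every root r n' to do
    so; hence r (n+1) *: y is a cycle one degree lower, a boundary by induction, and
    correcting z by a multiple of r (n+1) makes it a cycle modulo radI rs. *)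
Lemma tor_vanishing rs i (z : 'rV[S]_(b i.+1)) : (forall r, List.In r rs -> root_system r) ->
  (size rs < i)%N -> radrow rs (z *m d i) ->
  exists w, radrow rs (z - w *m d i.+1).
Proof.
elim: rs i z => [|r rs IH] i z hrs.
  case: i z => // i z _ h; have [|w ->] := @exact_d i z.
    by apply/rowP => j; rewrite h mxE.
  by exists w => j; rewrite subrr mxE.
case: i z => // i z; rewrite ltnS => si h.
have hrs' r' : List.In r' rs -> root_system r' by move=> h'; apply: hrs; right.
have hr := hrs r (or_introl erefl).
have [n [y hy]] : exists n (y : 'rV[S]_(b i.+1)), radrow rs (z *m d i.+1 - r n *: y).
  pose N j := sval (cid (h j)); pose n := (\max_j N j)%N.
  have hn j : exists t, radI rs ((z *m d i.+1) 0 j - t * r n).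
    have [t ht] := svalP (cid (h j)); rewrite -/(N j) in ht.
    have Nn : (N j <= n)%N by exact: (leq_bigmax (F := N)).
    rewrite -(subnKC Nn); elim: (n - N j)%N => [|k [t' ht']].
      by rewrite addn0; exists t.
    by exists (t' * r (N j + k).+1 ^+ p.-1); rewrite addnS -mulrA -rootM.
  have [y hy] := choice hn; exists n, (\row_j y j) => j.
  by have := hy j; rewrite !mxE mulrC.
pose R1 := r n.+1; pose c := R1 ^+ p.-1.
have cr : r n = c * R1 by exact: rootM.
have [|w hw] := IH i (R1 *: y) hrs' si.
  move=> j; apply: radI_radical => //.
  have h1 : radrow rs ((z *m d i.+1 - r n *: y) *m d i) by exact: radrowM.
  rewrite mulmxBl -mulmxA dd mulmx0 sub0r -scalemxAl in h1.
  have := radrowZ hrs' (- ((y *m d i) 0 j) ^+ p.-1) h1 j.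
  rewrite -scalemxAl !mxE mulrNN mulrCA mulrC -exprSr prednK ?(ltnW p_gt1) //.
  by rewrite exprMn hr mulrC.
have [|w' hw'] := IH i.+1 (z - c *: w) hrs' (ltnW si).
  have -> : (z - c *: w) *m d i.+1 =
      (z *m d i.+1 - r n *: y) + c *: (R1 *: y - w *m d i.+1).
    by rewrite mulmxBl -scalemxAl scalerBr scalerA -cr addrA subrK.
  by apply: radrowD => //; exact: radrowZ.
exists w' => j; exists n.+1, (R1 ^+ p.-2 * w 0 j).
have := hw' j; rewrite !mxE; congr radI.
have -> : R1 ^+ p.-2 * w 0 j * r n.+1 = c * w 0 j.
  by rewrite mulrAC -exprSr prednK // -ltnS prednK // ltnW.
by ring.
Qed.

(** Modulo radI rs the differentials vanish, so a basis vector is a cycle and hence,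
    in high degree, lies in radI rs: there is none. *)
Lemma minimal_complex_bounded rs i : (forall r, List.In r rs -> root_system r) ->
  ~ radI rs 1 -> (size rs < i)%N -> (forall x y, radI rs (d i x y)) ->
  (forall x y, radI rs (d i.+1 x y)) -> b i.+1 = 0%N.
Proof.
move=> hrs n1 si hi hi1; apply/eqP; rewrite -leqn0 leqNgt; apply/negP => b0.
have hmul k l (A : 'M[S]_(k, l)) (v : 'rV[S]_k) : (forall x y, radI rs (A x y)) -> radrow rs (v *m A).
  have [_ _ IM] := radI_ideal hrs.
  by move=> hA j; rewrite mxE; apply: radI_sum => // x; exact: IM.
pose j0 := Ordinal b0.
have [w hw] := @tor_vanishing rs i (delta_mx 0 j0) hrs si (hmul _ _ _ _ hi).
apply: n1; have := radrowD hrs hw (hmul _ _ _ w hi1) j0.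
by rewrite subrK mxE !eqxx.
Qed.

End PerfectTor.

(** * Syzygies over a coherent ring *)

Section SubmoduleOfSet.
Variables (R : comNzRingType) (V : lmodType R).

Definition linear_set (A : set V) : Prop :=
  [/\ A 0, forall u v, A u -> A v -> A (u + v) & forall a v, A v -> A (a *: v)].

Definition linear_pred (A : set V) (hA : linear_set A) : {pred V} := fun v => `[< A v >].

Lemma linear_pred_submod A (hA : linear_set A) : subsemimod_closed (linear_pred hA).
Proof.
have [A0 AD AZ] := hA; split; first split.
- exact/asboolP.
- by move=> u v /asboolP Au /asboolP Av; apply/asboolP; exact: AD.
- by move=> a v /asboolP Av; apply/asboolP; exact: AZ.
Qed.

HB.instance Definition _ A (hA : linear_set A) :=
  GRing.isSubSemiModClosed.Build R V (linear_pred hA) (linear_pred_submod hA).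

Definition submod_of_set A (hA : linear_set A) : submodClosed V := linear_pred hA.

Lemma mem_submod_of_set A (hA : linear_set A) v : (v \in submod_of_set hA) = `[< A v >].
Proof. by []. Qed.

Lemma submod_spanP (X : set V) v : v \in submod_span X <->
  forall A, linear_set A -> (forall u, X u -> A u) -> A v.
Proof.
split=> [/asboolP h A hA XA|h]; last first.
  apply/asboolP => N XN; have := h (fun v => v \in N); apply=> //.
  by split; [exact: rpred0 | move=> *; exact: rpredD | move=> *; exact: rpredZ].
have := h (submod_of_set hA); rewrite mem_submod_of_set => /(_ _)/asboolP; apply.
by move=> x /XA Ax; rewrite mem_submod_of_set; exact/asboolP.
Qed.
End SubmoduleOfSet.

Section Kernel.
Variable S : comNzRingType.

Definition is_syzygy a c k (A : 'M[S]_(a, c)) (K : 'M[S]_(k, a)) : Prop :=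
  forall y : 'rV[S]_a, y *m A = 0 <-> exists w : 'rV[S]_k, y = w *m K.

Lemma linear_rowset a k (K : 'M[S]_(k, a)) :
  linear_set (fun y : 'rV[S]_a => exists w : 'rV[S]_k, y = w *m K).
Proof.
split; first by exists 0; rewrite mul0mx.
- by move=> _ _ [u ->] [v ->]; exists (u + v); rewrite mulmxDl.
- by move=> r _ [u ->]; exists (r *: u); rewrite scalemxAl.
Qed.

Lemma linear_set_sum (V : lmodType S) (A : set V) (I : Type) (l : seq I) (F : I -> V) :
  linear_set A -> (forall i, A (F i)) -> A (\sum_(i <- l) F i).
Proof. by move=> [A0 AD _] h; elim/big_ind: _. Qed.

Lemma rows_of_seq a (l : seq 'rV[S]_a) : exists k (K : 'M[S]_(k, a)),
  (forall u, u \in l -> exists w : 'rV[S]_k, u = w *m K) /\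
  forall A : set 'rV[S]_a, linear_set A -> (forall u, u \in l -> A u) ->
    forall w : 'rV[S]_k, A (w *m K).
Proof.
pose K : 'M[S]_(size l, a) := \matrix_(i < size l) l`_i.
exists (size l), K; split=> [u ul|A hA lA w].
  have il : (index u l < size l)%N by rewrite index_mem.
  by exists (delta_mx 0 (Ordinal il)); rewrite -rowE rowK nth_index.
rewrite mulmx_sum_row; apply: linear_set_sum => // i.
have [_ _ AZ] := hA; apply: AZ; rewrite rowK; apply: lA; exact: mem_nth.
Qed.

Hypothesis coh : coherent_ring S.

(** Schanuel's lemma.  The given presentation f of the ideal of the c_j and the one by
    c are compared through U, lifting the c_j along f, and B, expressing f by the c_j:
    the syzygies of c are generated by the rows of 1 - U B and by the images under B of
    generators of the kernel of f. *)
Lemma column_syzygy a (c : 'cV[S]_a) : exists k (K : 'M[S]_(k, a)), is_syzygy c K.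
Proof.
pose gs : seq S^o := [seq c i 0 | i <- enum 'I_a].
pose I : ideal S := submod_span ([set` gs] : set S^o).
have cI j : (c j 0 : S^o) \in I.
  by apply/submod_spanP => A hA; apply => /=; apply/mapP; exists j; rewrite ?mem_enum.
have [|n [f [fI [s hs]]]] := coh (I := I); first by exists gs.
have Ic (v : S^o) : v \in I -> exists y : 'rV[S]_a, v = (y *m c) 0 0.
  move=> /submod_spanP /(_ (fun v : S^o => exists y : 'rV[S]_a, v = (y *m c) 0 0)); apply.
    split; first by exists 0; rewrite mul0mx mxE.
    - by move=> _ _ [u ->] [v' ->]; exists (u + v'); rewrite mulmxDl [RHS]mxE.
    - by move=> r _ [u ->]; exists (r *: u); rewrite -scalemxAl [RHS]mxE.
  move=> u /= /mapP[j _ ->]; exists (delta_mx 0 j).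
  by rewrite -rowE mxE.
have [U hU] : exists U : 'M[S]_(a, n), forall j, f (row j U) = c j 0.
  have /choice[u hu] : forall j, exists u : 'rV[S]_n, f u = c j 0.
    by move=> j; exact: (fI _).1 (cI j).
  by exists (\matrix_j u j) => j; rewrite rowK.
have [B hB] : exists B : 'M[S]_(n, a), forall x : 'rV[S]_n, f x = (x *m (B *m c)) 0 0.
  have /choice[u hu] : forall i, exists y : 'rV[S]_a, f (delta_mx 0 i) = (y *m c) 0 0.
    by move=> i; apply/Ic/fI; exists (delta_mx 0 i).
  exists (\matrix_i u i) => x; rewrite {1}(row_sum_delta x) linear_sum mxE.
  apply: eq_bigr => i _; rewrite linearZ /= hu.
  by rewrite -[u i](rowK u i) -row_mul [X in _ *: X]mxE.
pose T : 'M[S]_a := 1%:M - U *m B.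
have Tc : T *m c = 0.
  apply/matrixP => j x; rewrite (ord1 x) mulmxBl mul1mx -mulmxA mxE [X in _ + X]mxE.
  have := hB (row j U); rewrite hU -row_mul [in RHS]mxE => ->; rewrite subrr mxE //.
have [k [K [sK KA]]] := rows_of_seq ([seq row j T | j <- enum 'I_a] ++ [seq x *m B | x <- s]).
have lr := linear_rowset K; have [_ rD rZ] := lr.
exists k, K => y; split; last first.
  move=> [w ->].
  have lA : linear_set (fun v : 'rV[S]_a => v *m c = 0).
    split; first by rewrite mul0mx.
    - by move=> u v hu hv; rewrite mulmxDl hu hv addr0.
    - by move=> r v hv; rewrite -scalemxAl hv scaler0.
  apply: (KA _ lA) => u; rewrite mem_cat => /orP[] /mapP[x xs ->].
    by rewrite -row_mul Tc row0.
  have : x \in lin_ker f by rewrite hs; apply/submod_spanP => A hA h; exact: h.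
  rewrite unfold_in /lin_ker_pred => /eqP fx.
  by apply/matrixP => i j; rewrite (ord1 i) (ord1 j) -mulmxA -hB fx mxE.
move=> yc.
have -> : y = y *m T + (y *m U) *m B by rewrite mulmxBr mulmx1 mulmxA subrK.
apply: rD.
  rewrite mulmx_sum_row; apply: (linear_set_sum _ lr) => j; apply: rZ.
  by apply: sK; rewrite mem_cat; apply/orP; left; apply/mapP; exists j; rewrite ?mem_enum.
have : y *m U \in lin_ker f.
  rewrite unfold_in /lin_ker_pred hB; apply/eqP.
  have -> : y *m U *m (B *m c) = y *m c - y *m T *m c.
    by rewrite -!mulmxA -mulmxBr mulmxBl mul1mx subKr !mulmxA.
  by rewrite yc -mulmxA Tc mulmx0 subr0 mxE.
rewrite hs => /submod_spanP /(_ (fun v => exists w : 'rV[S]_k, v *m B = w *m K)); apply.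
  split; first by exists 0; rewrite !mul0mx.
  - by move=> u v [w hw] [w' hw']; exists (w + w'); rewrite !mulmxDl hw hw'.
  - by move=> r u [w hw]; exists (r *: w); rewrite -!scalemxAl hw.
by move=> u us; apply: sK; rewrite mem_cat; apply/orP; right; apply/mapP; exists u.
Qed.

(** Syzygies of several columns are syzygies of syzygies of the first one. *)
Lemma matrix_syzygy a c (A : 'M[S]_(a, c)) : exists k (K : 'M[S]_(k, a)), is_syzygy A K.
Proof.
elim: c a A => [|c IH] a A.
  exists a, 1%:M => y; split=> _; first by exists y; rewrite mulmx1.
  by apply/matrixP => i [].
pose A1 : 'M[S]_(a, 1 + c) := A.
have [k1 [K1 h1]] := column_syzygy (lsubmx A1).
have [k2 [K2 h2]] := IH _ (K1 *m rsubmx A1).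
have E (y : 'rV[S]_a) : y *m A1 = 0 <-> y *m lsubmx A1 = 0 /\ y *m rsubmx A1 = 0.
  rewrite -{1}(hsubmxK A1) mul_mx_row -row_mx0.
  by split=> [/eq_row_mx|[-> ->]].
exists k2, (K2 *m K1) => y; change (y *m A1 = 0 <-> exists w, y = w *m (K2 *m K1)); split.
  move=> /E[/h1[w ->]]; rewrite -mulmxA => /h2[u ->].
  by exists u; rewrite mulmxA.
move=> [w ->]; apply/E; split.
  by rewrite mulmxA; apply/h1; exists (w *m K2).
by rewrite mulmxA -mulmxA; apply/h2; exists w.
Qed.

Definition nonunit (x : S) := forall t, t * x <> 1.

(** In a generating set of least size no relation has a unit coefficient, as it would
    make a generator redundant. *)
Lemma minimal_syzygy a c (A : 'M[S]_(a, c)) : exists k (K : 'M[S]_(k, a)),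
  is_syzygy A K /\ forall w : 'rV[S]_k, w *m K = 0 -> forall j, nonunit (w 0 j).
Proof.
have [k0 [K0 h0]] := matrix_syzygy A.
pose P k := `[< exists K : 'M[S]_(k, a), is_syzygy A K >].
have exP : exists k, P k by exists k0; apply/asboolP; exists K0.
case: (ex_minnP exP) => k /asboolP[K hK] kmin; exists k, K; split=> // w wK j t tw.
case: k K hK kmin w wK j tw => [K _ _ w _ []//|k] K hK kmin w wK j tw.
suff : P k by move=> /kmin; rewrite ltnn.
apply/asboolP; exists (row' j K) => y; rewrite hK; split; last first.
  move=> [v ->]; pose v' : 'rV[S]_k.+1 := \row_i if unlift j i is Some i' then v 0 i' else 0.
  exists v'; rewrite !mulmx_sum_row (bigD1_ord j) //= mxE unlift_none scale0r add0r.
  by apply: eq_bigr => i _; rewrite mxE liftK row_rowsub; congr (_ *: _); apply/rowP => x; rewrite !mxE.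
move=> [v ->]; exists (\row_i (v 0 (lift j i) - v 0 j * t * w 0 (lift j i))).
have rowE i : row i (row' j K) = row (lift j i) K by apply/rowP => x; rewrite !mxE.
have Kj : row j K = - \sum_i (t * w 0 (lift j i)) *: row (lift j i) K.
  move: wK; rewrite mulmx_sum_row (bigD1_ord j) //= => /(congr1 (fun z => t *: z)).
  rewrite scaler0 scalerDr scalerA tw scale1r => /eqP; rewrite addr_eq0 => /eqP ->.
  by rewrite scaler_sumr; congr (- _); apply: eq_bigr => i _; rewrite scalerA.
rewrite !mulmx_sum_row (bigD1_ord j) //= Kj scalerN scaler_sumr -sumrN -big_split /=.
apply: eq_bigr => i _; rewrite mxE rowE scalerA scalerBl addrC mulrA //.
Qed.

End Kernel.

Section Resolution.
Variable S : comNzRingType.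
Hypothesis coh : coherent_ring S.
Variable fs : seq S.

Record mxbox := MxBox { mx_cols : nat; mx_rows : nat; mx_of : 'M[S]_(mx_rows, mx_cols) }.

Definition next_box (B : mxbox) : mxbox :=
  let h := cid (minimal_syzygy coh (mx_of B)) in
  @MxBox (mx_rows B) (sval h) (sval (cid (svalP h))).

Lemma next_boxP B : is_syzygy (mx_of B) (mx_of (next_box B)) /\
  forall w : 'rV[S]_(mx_rows (next_box B)), w *m mx_of (next_box B) = 0 -> forall j, nonunit (w 0 j).
Proof. by rewrite /next_box /=; case: cid => k hk /=; case: cid. Qed.

Fixpoint boxes (i : nat) : mxbox :=
  if i is j.+1 then next_box (boxes j)
  else MxBox (\col_(j < size fs) fs`_j : 'M[S]_(size fs, 1)).

(** The free resolution of S / (fs), shifted by one degree: degree 0 is zero,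
    degree 1 is S, degree 2 carries the generators fs and the rest are minimal
    syzygies. *)
Definition betti i : nat := if i is j.+1 then mx_cols (boxes j) else 0%N.

Definition differential i : 'M[S]_(betti i.+1, betti i) :=
  match i with 0 => 0 | j.+1 => mx_of (boxes j) end.

Lemma differential_syzygy i : is_syzygy (differential i.+1) (differential i.+2).
Proof. by have [] := next_boxP (boxes i). Qed.

Lemma differential_minimal i (w : 'rV[S]_(betti i.+3)) : w *m differential i.+2 = 0 -> forall j, nonunit (w 0 j).
Proof. by have [_] := next_boxP (boxes i); exact. Qed.

Lemma differential_complex i : differential i.+1 *m differential i = 0.
Proof.
case: i => [|i]; first by rewrite mulmx0.
apply/row_matrixP => x; rewrite row_mul row0; apply/differential_syzygy.
by exists (delta_mx 0 x); rewrite -rowE.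
Qed.

Lemma differential_exact i k (X : 'M[S]_(k, betti i.+2)) : X *m differential i.+1 = 0 ->
  exists Y, X = Y *m differential i.+2.
Proof.
move=> h; have /choice[y hy] : forall x, exists w, row x X = w *m differential i.+2.
  by move=> x; apply/differential_syzygy; rewrite -row_mul h row0.
by exists (\matrix_x y x); apply/row_matrixP => x; rewrite row_mul rowK.
Qed.

(** Each f in fs annihilates S / (fs), so multiplication by f on the resolution is
    null-homotopic; the homotopy is lifted degree by degree. *)
Lemma differential_homotopy f : f \in fs -> exists s : forall i, 'M[S]_(betti i, betti i.+1),
  forall i, differential i *m s i + s i.+1 *m differential i.+1 = f%:M.
Proof.
move=> ff; pose good i (s : 'M[S]_(betti i, betti i.+1)) :=
  exists s', f%:M - differential i *m s = s' *m differential i.+1.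
have good0 : good 0%N 0.
  have il : (index f fs < size fs)%N by rewrite index_mem.
  exists (delta_mx 0 (Ordinal il)); rewrite mulmx0 subr0 -rowE.
  by apply/matrixP => x y; rewrite (ord1 x) (ord1 y) !mxE eqxx nth_index.
have step i s (h : good i s) : good i.+1 (sval (cid h)).
  case: (cid h) => s' /= E; apply: differential_exact.
  rewrite mulmxBl -mulmxA -E mulmxBr mulmxA differential_complex mul0mx subr0.
  by rewrite scalar_mxC subrr.
pose F := fix F i : {s | good i s} :=
  if i is j.+1 then exist _ _ (step j _ (svalP (F j))) else exist _ _ good0.
exists (fun i => sval (F i)) => i.
change (differential i *m sval (F i) + sval (cid (svalP (F i))) *m differential i.+1 = f%:M).
by case: (cid (svalP (F i))) => s' /= <-; rewrite addrC subrK.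
Qed.

Section Bounded.
Variables (p : nat) (chS : p \in [pchar S]).
Hypothesis reduced : forall s : S, s ^+ p = 0 -> s = 0.
Hypothesis perfect : forall s : S, exists t, t ^+ p = s.
Variable rs : seq (nat -> S).
Hypothesis hrs : forall r, List.In r rs -> root_system p r.
Hypothesis rs_proper : ~ radI rs 1.
Hypothesis rs_local : forall s, radI rs s \/ exists t, t * s = 1.

(** The syzygies of fs need not be minimal, nor therefore the first two differentials;
   the offset 3 skips them. *)
Lemma betti_bounded i : (size rs + 3 <= i)%N -> betti i.+1 = 0%N.
Proof.
have ent k x y : radI rs (differential k.+3 x y).
  have [//|[t ht]] := rs_local (differential k.+3 x y).
  exfalso; apply: (@differential_minimal k (row x (differential k.+3)) _ y t).
    by rewrite -row_mul differential_complex row0.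
  by rewrite mxE.
move=> le; have -> : i = (i - 3).+3 by lia.
apply: (minimal_complex_bounded chS reduced perfect differential_complex _ hrs rs_proper) => //.
  by move=> k z /differential_exact.
by lia.
Qed.
End Bounded.
End Resolution.

Theorem finite_free_resolution (S : comNzRingType) (p : nat) (chS : p \in [pchar S])
    (rs : seq (nat -> S)) (fs : seq S) :
  coherent_ring S -> (forall s : S, s ^+ p = 0 -> s = 0) -> (forall s : S, exists t, t ^+ p = s) ->
  (forall r, List.In r rs -> root_system p r) -> ~ radI rs 1 ->
  (forall s, radI rs s \/ exists t, t * s = 1) ->
  exists (b : nat -> nat) (d : forall i, 'M[S]_(b i.+1, b i)) (L : nat),
  [/\ [/\ b 0 = 0%N, b 1 = 1%N, b 2 = size fs & forall i, (L <= i)%N -> b i.+1 = 0%N],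
      forall j k, d 1 j k = fs`_j,
      forall i, d i.+1 *m d i = 0,
      forall i (z : 'rV_(b i.+2)), z *m d i.+1 = 0 -> exists w, z = w *m d i.+2
    & forall f, f \in fs -> exists s : forall i, 'M[S]_(b i, b i.+1),
        forall i, d i *m s i + s i.+1 *m d i.+1 = f%:M].
Proof.
move=> coh red perf hrs n1 loc.
exists (betti coh fs), (differential coh fs), (size rs + 3)%N; split.
- by split=> // i; apply: (betti_bounded _ _ chS red perf hrs n1 loc).
- by move=> j k; rewrite /differential /= mxE.
- exact: differential_complex.
- by move=> i z /differential_exact.
- exact: differential_homotopy.
Qed.

(** * Descent from the perfect closure *)

Section Descent.
Variables (R : idomainType) (p : nat) (chR : p \in [pchar R]).
Local Notation S := (perfect_closure chR).
Local Notation stable e N := (@stable R p _ e N).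
Local Notation tp := (to_perf chR).

Lemma to_perf_inj n : injective (tp n).
Proof.
move=> x y /eqP/to_perfP[k h]; apply/eqP; rewrite -subr_eq0.
have : (x - y) ^+ (p ^ (k + n)) == 0 by rewrite (frobD chR) (frobN chR) h subrr.
by rewrite expf_eq0 => /andP[].
Qed.

Lemma to_perfX n k x : tp (n + k) (x ^+ (p ^ k)) = tp n x.
Proof. by rewrite -to_perfS. Qed.

Lemma to_perf_root n x : tp n.+1 x ^+ p = tp n x.
Proof. by have := to_perfX n 1 x; rewrite addn1 expn1 rmorphXn. Qed.

Lemma perfect_closure_pchar : p \in [pchar S].
Proof. exact: (rmorph_pchar (to_perf chR 0)). Qed.

Lemma perfect_closure_reduced (s : S) : s ^+ p = 0 -> s = 0.
Proof.
have [n [x ->]] := to_perf_surj s; rewrite -rmorphXn -{1}(rmorph0 (tp n)) => /to_perf_inj /eqP.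
by rewrite expf_eq0 => /andP[_ /eqP ->]; rewrite rmorph0.
Qed.

Lemma perfect_closure_perfect (s : S) : exists t, t ^+ p = s.
Proof. by have [n [x ->]] := to_perf_surj s; exists (tp n.+1 x); rewrite to_perf_root. Qed.

Definition roots_of (l : seq R) : seq (nat -> S) := [seq (fun n => tp n x) | x <- l].

Lemma roots_ofP l r : List.In r (roots_of l) -> root_system p r.
Proof.
elim: l => [//|x l IH] /= [<-|/IH //] n; exact: to_perf_root.
Qed.

Section Local.
Variable m : set R^o.
Hypothesis pm : primeS p m.
Hypothesis m_local : forall s : R, ~ m s -> exists t : R, t * s = 1.
Variable l : seq R^o.
Hypothesis El : m = fspan p 0 l.

Let perfm (s : S) := exists n (x : R), m x /\ s = tp n x.

Let perfm_lift n k x : m x -> exists2 y : R, m y & tp n x = tp (n + k) y.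
Proof.
have [sm _ _] := pm; move=> mx; exists (x ^+ (p ^ k)); last by rewrite to_perfX.
rewrite -(prednK (n := p ^ k)%N); first by rewrite exprSr; exact: (stable0M sm).
by rewrite expn_gt0 prime_gt0 // (pcharf_prime chR).
Qed.

Lemma radI_roots_sub s : radI (roots_of l) s -> perfm s.
Proof.
have [sm _ _] := pm.
have : forall x : R, x \in l -> m x by rewrite El => x xl; exact: mem_fspan.
elim: (l : seq R) s => [|x l' IH] s h /=.
  by move=> ->; exists 0%N, 0; split; [exact: (stable0 sm) | rewrite rmorph0].
move=> [n [t /IH]] [|k [y [my E]]]; first by move=> z zl; apply: h; rewrite inE zl orbT.
have [j [a Et]] := to_perf_surj t.
have [y1 my1 Ey1] := perfm_lift k (n + j) my.
have [x1 mx1 Ex1] := perfm_lift n (k + j) (h x (mem_head _ _)).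
exists (k + (n + j))%N, (y1 + a ^+ (p ^ (k + n)) * x1); split.
  by apply: (stableD sm) => //; exact: (stable0M sm).
rewrite -[LHS](subrK (t * tp n x)) E Ey1 rmorphD rmorphM /=; congr (_ + _ * _).
  by rewrite Et -(to_perfX j (k + n)); congr tp; lia.
by rewrite Ex1; congr tp; lia.
Qed.

Lemma radI_one : ~ radI (roots_of l) 1.
Proof.
move=> /radI_roots_sub[n [x [mx]]]; rewrite -(rmorph1 (tp n)) => /to_perf_inj E.
by have [_ m1 _] := pm; apply: m1; rewrite E.
Qed.

Lemma radI_local s : radI (roots_of l) s \/ exists t, t * s = 1.
Proof.
have [n [x ->]] := to_perf_surj s.
have [mx|/m_local[t tx]] := EM (m x); last first.
  by right; exists (tp n t); rewrite -rmorphM tx rmorph1.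
left; have [I0 IB IM] := radI_ideal perfect_closure_pchar (@roots_ofP l).
have mem r k : List.In r (roots_of l) -> radI (roots_of l) (r k).
  have : forall r', List.In r' (roots_of l) -> root_system p r' by exact: roots_ofP.
  elim: (roots_of l) => [//|r' rs IH] hrs /= [->|/IH h].
    have [J0 _ _] := radI_ideal perfect_closure_pchar (fun r h => hrs r (or_intror h)).
    by exists k, 1; rewrite mul1r subrr.
  by exists 0%N, 0; rewrite mul0r subr0; apply: h => r'' h; apply: hrs; right.
rewrite El in mx; have := mx (fun x : R^o => radI (roots_of l) (tp n x)); apply.
  split; first by rewrite rmorph0.
  - by move=> u v hu hv; rewrite rmorphB; exact: IB.
  - by move=> a u hu; rewrite expn0 expr1 scaler_regular rmorphM; exact: IM.
move=> u ul; apply: (mem (fun k => tp k u)).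
elim: (l : seq R) ul => [//|y l' IH]; rewrite inE => /orP[/eqP ->|/IH h]; first by left.
by right.
Qed.

Lemma lift_matrix a c (A : 'M[S]_(a, c)) : exists N, forall n, (N <= n)%N ->
  exists B : 'M[R]_(a, c), A = map_mx (tp n) B.
Proof.
have h (i : 'I_a) (j : 'I_c) : exists N, forall n, (N <= n)%N -> exists x, A i j = tp n x.
  have [N [x E]] := to_perf_surj (A i j); exists N => n Nn.
  by exists (x ^+ (p ^ (n - N))); rewrite E -(to_perfX N (n - N)) subnKC.
have /choice[f hf] : forall i, exists N, forall j n, (N <= n)%N -> exists x, A i j = tp n x.
  move=> i; have /choice[f hf] := h i; exists (\max_j f j)%N => j n le.
  by apply: hf; apply: leq_trans le; exact: (leq_bigmax (F := f)).
exists (\max_i f i)%N => n le.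
have /choice[B hB] : forall i, exists r : 'rV[R]_c, forall j, A i j = tp n (r 0 j).
  move=> i; have /choice[r hr] : forall j, exists x, A i j = tp n x.
    by move=> j; apply: hf; apply: leq_trans le; exact: (leq_bigmax (F := f)).
  by exists (\row_j r j) => j; rewrite mxE.
by exists (\matrix_i B i); apply/matrixP => i j; rewrite !mxE hB.
Qed.

Lemma lift_family (ra ca : nat -> nat) (A : forall i, 'M[S]_(ra i, ca i)) L :
  (forall i, (L <= i)%N -> ra i = 0%N \/ ca i = 0%N) ->
  exists N, forall n, (N <= n)%N -> exists B : forall i, 'M[R]_(ra i, ca i),
    forall i, A i = map_mx (tp n) (B i).
Proof.
move=> hL; have /choice[f hf] := fun i => lift_matrix (A i).
exists (\max_(i < L) f i)%N => n le.
suff h i : exists B : 'M[R]_(ra i, ca i), A i = map_mx (tp n) B.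
  by exists (fun i => sval (cid (h i))) => i; case: cid.
have [iL|Li] := ltnP i L.
  by apply: hf; apply: leq_trans le; exact: (leq_bigmax (F := fun i : 'I_L => f i) (Ordinal iL)).
exists 0; apply/matrixP => x y; exfalso.
have [E|E] := hL i Li; first by have := ltn_ord x; rewrite {2}E.
by have := ltn_ord y; rewrite {2}E.
Qed.

Lemma map_to_perf_inj n a c : injective (@map_mx _ _ (tp n) a c).
Proof.
move=> A B /matrixP h; apply/matrixP => i j; have := h i j; rewrite !mxE.
exact: to_perf_inj.
Qed.

Lemma map_to_perf_fmx n k a c (A : 'M[R]_(a, c)) :
  map_mx (tp (n + k)) (fmx p k A) = map_mx (tp n) A.
Proof. by apply/matrixP => i j; rewrite !mxE to_perfX. Qed.

(** The bounded resolution over the perfect closure involves finitely many matrices,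
    which all come from the copy of R at some level n0; read there, they form a complex
    over R.  Exactness over the closure says that a cycle of a Frobenius twist becomes a
    boundary after finitely many further twists. *)
Theorem frobenius_exact_complex (fs : seq R) : coherent_ring S ->
  exists (b : nat -> nat) (d : forall i, 'M[R]_(b i.+1, b i)) (L n0 : nat),
  [/\ [/\ b 0 = 0%N, b 1 = 1%N, b 2 = size fs & b L.+1 = 0%N],
      forall j k, d 1 j k = fs`_j ^+ (p ^ n0),
      forall i, d i.+1 *m d i = 0,
      forall n i (z : 'rV_(b i.+2)), z *m fmx p n (d i.+1) = 0 ->
        exists e w, fmx p e z = w *m fmx p (n + e) (d i.+2)
    & forall f, f \in fs -> exists s : forall i, 'M[R]_(b i, b i.+1),
        forall i, d i *m s i + s i.+1 *m d i.+1 = (f ^+ (p ^ n0))%:M].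
Proof.
move=> coh.
have [b [D [L [[b0 b1 b2 bL] D1 DD Dex Dh]]]] := finite_free_resolution perfect_closure_pchar
  [seq tp 0 f | f <- fs] coh perfect_closure_reduced perfect_closure_perfect (@roots_ofP l)
  radI_one radI_local.
have Dlow i : (L <= i)%N -> b i.+1 = 0%N \/ b i = 0%N by move=> /bL; left.
have Slow i : (L <= i)%N -> b i = 0%N \/ b i.+1 = 0%N by move=> /bL; right.
have [N1 lift1] := lift_family D Dlow.
have [N2 lift2] : exists N, forall n, (N <= n)%N -> forall f, f \in fs ->
    exists s : forall i, 'M[R]_(b i, b i.+1), forall i,
      D i *m map_mx (tp n) (s i) + map_mx (tp n) (s i.+1) *m D i.+1 = (tp 0 f)%:M.
  have : forall f, f \in fs -> f \in fs by [].
  elim: {-2}fs => [_|f fs' IH sub]; first by exists 0%N.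
  have [N hN] : exists N, forall n, (N <= n)%N -> forall f, f \in fs' ->
      exists s : forall i, 'M[R]_(b i, b i.+1), forall i,
      D i *m map_mx (tp n) (s i) + map_mx (tp n) (s i.+1) *m D i.+1 = (tp 0 f)%:M.
    by apply: IH => g gfs; apply: sub; rewrite inE gfs orbT.
  have [s hs] := Dh (tp 0 f) (map_f _ (sub f (mem_head _ _))).
  have [N' hN'] := lift_family s Slow.
  exists (maxn N N') => n; rewrite geq_max => /andP[Nn N'n] g; rewrite inE => /orP[/eqP ->|gfs].
    by have [s' E] := hN' n N'n; exists s' => i; rewrite -!E.
  exact: hN.
pose n0 := maxn N1 N2.
have [d Ed] := lift1 n0 (leq_maxl _ _).
have lift0 f : tp 0 f = tp n0 (f ^+ (p ^ n0)) by rewrite -[in RHS](add0n n0) to_perfX.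
exists b, d, L, n0; split.
- by split=> //; [rewrite b2 size_map | exact: bL].
- move=> j k; apply: (@to_perf_inj n0); rewrite -lift0.
  have := D1 j k; rewrite Ed mxE => ->.
  by rewrite (nth_map 0) // -[X in (_ < X)%N](size_map (tp 0)) -b2.
- by move=> i; apply: (@map_to_perf_inj n0); rewrite map_mxM -!Ed DD map_mx0.
- move=> n i z hz.
  have [|w hw] := Dex i (map_mx (tp (n0 + n)) z).
    by rewrite Ed -(map_to_perf_fmx n0 n) -map_mxM hz map_mx0.
  have [N hN] := lift_matrix w; have [w' Ew] := hN (n0 + n + N)%N (leq_addl _ _).
  exists N, w'; apply: (@map_to_perf_inj (n0 + n + N)).
  by rewrite map_to_perf_fmx hw Ew Ed map_mxM -addnA map_to_perf_fmx.
- move=> f ff; have [s hs] := lift2 n0 (leq_maxr _ _) f ff; exists s => i.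
  apply: (@map_to_perf_inj n0); rewrite map_mxD !map_mxM -!Ed hs map_scalar_mx /= -lift0 //.
Qed.

End Local.
End Descent.

(** * A uniform annihilator for higher homology *)

Section FrobeniusFunctional.
Variables (R : idomainType) (p : nat) (chR : p \in [pchar R]).
Hypothesis noeth : forall J : set R^o, stable p 0 J -> fgen p 0 J.
Variable g1 : seq R^o.
Hypothesis g1T : forall v, fspan p 1 g1 v.
Local Notation stable e N := (@stable R p _ e N).
Local Notation adjoin := (@adjoin R p R^o 1).

(** R-linear maps from the e-th push-forward of R to R. *)
Definition frob_linear e (phi : R -> R) := (forall x y, phi (x - y) = phi x - phi y) /\
  (forall r x, phi (r ^+ (p ^ e) * x) = r * phi x).

Let p1 (x : R) : x ^+ p = x ^+ (p ^ 1). Proof. by rewrite expn1. Qed.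
Let pB (x y : R) : (x - y) ^+ p = x ^+ p - y ^+ p.
Proof. by rewrite !p1 (frobD chR) (frobN chR). Qed.
Let p_gt0 : (0 < p)%N. Proof. by rewrite prime_gt0 // (pcharf_prime chR). Qed.

(** A submodule W of the push-forward of R, maximal with respect to meeting the copy
    R^p of R trivially: R^p is essential in the quotient by W. *)
Lemma maximal_complement : exists W : set R^o, [/\ stable 1 W,
  forall r : R, W (r ^+ p) -> r = 0 &
  forall N : set R^o, stable 1 N -> W `<=` N -> ~ N `<=` W -> exists2 r : R, r != 0 & N (r ^+ p)].
Proof.
suff : forall N : set R^o, stable 1 N -> (forall r : R, N (r ^+ p) -> r = 0) ->
  exists W : set R^o, [/\ stable 1 W,
  forall r : R, W (r ^+ p) -> r = 0 &
  forall N : set R^o, stable 1 N -> W `<=` N -> ~ N `<=` W -> exists2 r : R, r != 0 & N (r ^+ p)].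
  apply; first exact: stable_zero.
  by move=> r /eqP; rewrite expf_eq0 => /andP[_ /eqP].
apply: (noeth_ind chR noeth g1T) => N sN IH N0.
have [h|/existsNP[N' /not_implyP[sN' /not_implyP[NN' /not_implyP[nN' nex]]]]] := EM (forall N' : set R^o, stable 1 N' -> N `<=` N' -> ~ N' `<=` N ->
    exists2 r : R, r != 0 & N' (r ^+ p)).
  by exists N.
apply: (IH N') => // r hr; apply: contrapT => /eqP r0; apply: nex; by exists r.
Qed.

(** As R^p is essential modulo W, every generator has a nonzero multiple in W + R^p.
    A common multiplier c works for all of R, and phi x is the R^p-component of
    c^p x. *)
Lemma frobenius_functional : exists (phi : R -> R), frob_linear 1 phi /\ phi 1 != 0.
Proof.
have [W [sW W0 Wmax]] := maximal_complement.
have loc (x : R) : exists2 a : R, a != 0 & exists b : R, W (a ^+ p * x - b ^+ p).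
  have [Wx|Wx] := EM (W x).
    exists 1; first exact: oner_neq0.
    by exists 0; rewrite expr1n mul1r p1 (frob0 chR) subr0.
  have nA : ~ adjoin W x `<=` W by move=> h; apply/Wx/h; exact: mem_adjoin.
  have [r r0 [s]] := Wmax _ (stable_adjoin chR (x : R^o) sW) (@sub_adjoin _ _ chR _ 1 W x) nA.
  rewrite -p1 => hs; exists s; last first.
    by exists r; rewrite -opprB; exact: (stableN sW).
  apply/eqP => s0; move/eqP: r0; apply; apply: W0.
  by move: hs; rewrite s0 expr0n gtn_eqF // scale0r subr0.
have scale (a b c x : R) : W (a ^+ p * x - b ^+ p) -> W ((c * a) ^+ p * x - (c * b) ^+ p).
  by move=> h; rewrite !exprMn -mulrA -mulrBr p1; exact: (stableZ c sW h).
have [c c0 hc] : exists2 c : R, c != 0 & forall x : R, x \in g1 -> exists b : R, W (c ^+ p * x - b ^+ p).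
  elim: (g1 : seq R) => [|x l [c c0 hc]]; first by exists 1; rewrite ?oner_neq0.
  have [a a0 [b hb]] := loc x; exists (c * a); first by rewrite mulf_neq0.
  move=> y; rewrite inE => /orP[/eqP ->|/hc[b' hb']]; first by exists (c * b); exact: scale.
  by exists (a * b'); rewrite [c * a]mulrC; exact: scale.
have all (x : R) : exists b : R, W (c ^+ p * x - b ^+ p).
  apply: (@g1T x (fun x : R^o => exists b : R, W (c ^+ p * x - b ^+ p))) => //.
  split.
  - by exists 0; rewrite mulr0 p1 (frob0 chR) subr0; exact: (stable0 sW).
  - move=> u v [b hb] [b' hb']; exists (b - b').
    by rewrite pB mulrBr opprD addrACA -opprD; exact: (stableB sW).
  - move=> r v [b hb]; exists (r * b); rewrite expn1 scaler_regular exprMn mulrCA -mulrBr p1.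
    exact: (stableZ r sW hb).
have uniq (x b b' : R) : W (x - b ^+ p) -> W (x - b' ^+ p) -> b = b'.
  move=> h h'; apply/eqP; rewrite -subr_eq0; apply/eqP/W0; rewrite pB.
  rewrite (_ : _ - _ = (x - b' ^+ p) - (x - b ^+ p)); last by ring.
  exact: (stableB sW).
have [phi hphi] := choice all; exists phi; split; first split.
- move=> x y; apply: (uniq (c ^+ p * (x - y))) => //.
  by rewrite pB mulrBr opprD addrACA -opprD; exact: (stableB sW).
- move=> r x; apply: (uniq (c ^+ p * (r ^+ (p ^ 1) * x))) => //.
  by rewrite -p1 exprMn mulrCA -mulrBr p1; exact: (stableZ r sW (hphi x)).
- rewrite (_ : phi 1 = c) //; apply: (uniq (c ^+ p * 1)) => //.
  by rewrite mulr1 subrr; exact: (stable0 sW).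
Qed.

(** The value at 1 must not depend on e.  With c = phi 1 one has phi (c^p) = c^2, so
    psi 1 = c^2 is preserved by passing from psi to x |-> phi (c^(p-2) psi x). *)
Lemma frobenius_functionals : exists2 c : R, c != 0 &
  forall e, exists phi, frob_linear e phi /\ phi 1 = c.
Proof.
have [phi [[phiB phiZ] phi1]] := frobenius_functional.
pose c := phi 1; exists (c ^+ 2); first exact: expf_neq0.
elim=> [|e [psi [[psiB psiZ] psi1]]].
  exists (fun x => c ^+ 2 * x); rewrite mulr1; split=> //; split=> [x y|r x].
    by rewrite mulrBr.
  by rewrite expn0 expr1 mulrCA.
exists (fun x => phi (c ^+ (p - 2) * psi x)); split; last first.
  have p2 : (1 < p)%N by rewrite prime_gt1 // (pcharf_prime chR).
  rewrite psi1 -exprD subnK // -[c ^+ p]mulr1 p1 phiZ //.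
split=> [x y|r x]; first by rewrite psiB mulrBr phiB.
by rewrite expnS exprM psiZ mulrCA [r ^+ p]p1 phiZ.
Qed.

End FrobeniusFunctional.

Section KilledHomology.
Variables (R : idomainType) (p : nat) (chR : p \in [pchar R]).
Variables (b : nat -> nat) (d : forall i, 'M[R]_(b i.+1, b i)).
Hypothesis dd : forall i, d i.+1 *m d i = 0.
Hypothesis frob_exact : forall n i (z : 'rV[R]_(b i.+2)), z *m fmx p n (d i.+1) = 0 ->
  exists e w, fmx p e z = w *m fmx p (n + e) (d i.+2).
Variable c : R.
Hypothesis c0 : c != 0.
Hypothesis functionals : forall e, exists phi, @frob_linear R p e phi /\ phi 1 = c.
Local Notation stable e N := (@stable R p _ e N).

(** Applying the functional of level e to the relation that exhibits the e-th twist of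
    z as a boundary exhibits c z itself as one. *)
Lemma homology_killed n i (z : 'rV[R]_(b i.+2)) : z *m fmx p n (d i.+1) = 0 ->
  exists w, c *: z = w *m fmx p n (d i.+2).
Proof.
move=> /frob_exact[e [w E]]; have [phi [[phiB phiZ] phi1]] := functionals e.
have phi0 : phi 0 = 0 by have := phiB 0 0; rewrite !subrr.
have phiD x y : phi (x + y) = phi x + phi y.
  by have := phiB x (- y); have := phiB 0 y; rewrite opprK phi0 !sub0r => -> ->; rewrite opprK.
exists (map_mx phi w); apply/rowP => j; rewrite !mxE.
have := congr1 (fun A : 'rV_(b i.+2) => phi (A 0 j)) E.
rewrite !mxE -[X in phi X]mulr1 phiZ phi1 mulrC => ->.
rewrite (big_morph phi phiD phi0); apply: eq_bigr => k _.
by rewrite !mxE mulrC expnD exprM phiZ mulrC.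
Qed.

Definition multiples : set R^o := fun x : R => exists r : R, x = r * c.

Lemma stable_multiples : stable 0 multiples.
Proof.
split; first by exists 0; rewrite mul0r.
- by move=> _ _ [r ->] [s ->]; exists (r - s); rewrite mulrBl.
- by move=> r _ [s ->]; exists (r * s); rewrite expn0 expr1 scaler_regular mulrA.
Qed.

Variable Q : set R^o.

(** As c kills the homology in degree i + 1 of the complex over R, the exact sequence
    of multiplication by c makes it a quotient of the homology in degree i + 2 with
    coefficients in R / c R. *)
Lemma hlen_killed n i : hfin (b := b) p d Q 0 n setT multiples i.+2 ->
  (hlen (b := b) p d Q 0 n setT [set 0%R : R^o] i.+1 <= hlen (b := b) p d Q 0 n setT multiples i.+2)%N.
Proof.
move=> fin; set A := @cyc R p b d n setT multiples i.+2.
have sT : stable 0 (setT : set R^o) by [].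
have s0 : stable 0 [set 0%R : R^o] by exact: stable_zero.
have sM := stable_multiples.
set Z := @cyc R p b d n setT [set 0%R : R^o] i.+1; set B := @bnd R p b d n setT [set 0%R : R^o] i.+1.
have sZ : stable 0 Z by exact: stable_cyc.
have sB : stable 0 B by exact: stable_bnd.
have sA : stable 0 A by exact: stable_cyc.
have BZ : B `<=` Z by rewrite /B /Z -(addn0 n); exact: bnd_cyc.
have zero k (v : 'rV[R]_k) : coords [set 0%R : R^o] v <-> v = 0.
  by split=> [h|-> j]; [apply/rowP => j; rewrite h mxE | rewrite mxE].
have ZE v : Z v <-> v *m fmx p n (d i.+1) = 0 by split=> [[_ /zero]|/zero].
pose f (v : 'rV[R]_(b i.+2)) := c *: v; pose g (w : 'rV[R]_(b i.+3)) := w *m fmx p n (d i.+2).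
have fB u v : f (u - v) = f u - f v by exact: scalerBr.
have fZ r v : f (r ^+ (p ^ 0) *: v) = r ^+ (p ^ 0) *: f v by rewrite /f !scalerA mulrC.
have gB u v : g (u - v) = g u - g v by exact: mulmxBl.
have gZ r v : g (r ^+ (p ^ 0) *: v) = r ^+ (p ^ 0) *: g v by rewrite /g scalemxAl.
have sc_inj k : injective (fun v : 'rV[R]_k => c *: v).
  by move=> u v /rowP h; apply/rowP => j; have := h j; rewrite !mxE; exact: mulfI.
have f_inj : injective f := @sc_inj _.
have [E1 _] : len p Q 0 Z B = len p Q 0 (f @` Z) (f @` B) /\
    (finlen p Q 0 Z B <-> finlen p Q 0 (f @` Z) (f @` B)).
  apply: (@len_iso R p Q _ _ 0 0 f) => //; split; first split=> //; try exact: stable_image.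
  split.
  - by move=> a; exists a.
  - by move=> _ [v /BZ Zv <-]; exists v.
  - move=> _ [v Zv <-]; exists v => //; rewrite subrr.
    by exists 0; [exact: (stable0 sB) | rewrite /f scaler0].
  - by move=> v; split=> [Bv|[_ [v' Bv' /f_inj <-]]] //; split; [exact: BZ | exists v].
have [E2 _] : len p Q 0 A (A `&` g @^-1` (f @` B)) = len p Q 0 (f @` Z) (f @` B) /\
    (finlen p Q 0 A (A `&` g @^-1` (f @` B)) <-> finlen p Q 0 (f @` Z) (f @` B)).
  apply: (@len_iso R p Q _ _ 0 0 g) => //; split; first split=> //; try exact: stable_image.
  split.
  - move=> w [_ hw]; have /choice[r hr] := hw.
    exists (\row_j r j); last by apply/rowP => j; rewrite [RHS]hr [LHS]mxE mxE mulrC.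
    apply/ZE; apply: sc_inj; rewrite /= scaler0 scalemxAl.
    have -> : c *: (\row_j r j) = g w by apply/rowP => j; rewrite [RHS]hr [LHS]mxE mxE mulrC.
    by rewrite /g -mulmxA -(fmxM chR) dd (fmx0 chR) mulmx0.
  - by move=> _ [v /BZ Zv <-]; exists v.
  - move=> _ [z /ZE hz <-]; have [w hw] := homology_killed hz.
    exists w; last by exists 0; [exact: (stable0 sB) | rewrite /f /g hw subrr scaler0].
    by split=> // j; exists (z 0 j); rewrite -hw mxE mulrC.
  - by move=> w.
rewrite /hlen -/Z -/B E1 -E2; apply: len_mono => //.
  move=> w [u _ hw]; have hA : A w.
    have : @bnd R p b d n setT multiples i.+2 w by exists u.
    by rewrite /A -(addn0 n); exact: bnd_cyc.
  split=> //; have /choice[r hr] := hw.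
  exists ((\row_j r j) *m fmx p n (d i.+2)).
    by exists (\row_j r j) => // j; rewrite subrr mxE.
  rewrite /f scalemxAl.
  have -> : c *: (\row_j r j) = w - u *m fmx p n (d i.+3) by apply/rowP => j; rewrite hr !mxE mulrC.
  by rewrite mulmxBl -mulmxA -(fmxM chR) dd (fmx0 chR) mulmx0 subr0.
Qed.

End KilledHomology.

(** * Ideals, lengths and dimension *)

Section SetsOfIdeals.
Variables (R : comNzRingType) (p : nat).
Local Notation stable e N := (@stable R p _ e N).

Lemma linear_stable (V : lmodType R) (A : set V) : linear_set A <-> stable 0 A.
Proof.
split=> [[A0 AD AZ]|sA].
  split=> // u v Au Av.
  by rewrite -scaleN1r; apply: AD => //; exact: AZ.
split; [exact: (stable0 sA) | by move=> u v; exact: (stableD sA) |].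
by move=> a v Av; have := stableZ a sA Av; rewrite expn0 expr1.
Qed.

Definition set_of_submod (V : lmodType R) (N : submodClosed V) : set V := fun v => v \in N.

Lemma stable_submod (V : lmodType R) (N : submodClosed V) : stable 0 (set_of_submod N).
Proof.
apply/linear_stable; split; rewrite /set_of_submod.
- exact: rpred0.
- by move=> u v; exact: rpredD.
- by move=> a v; exact: rpredZ.
Qed.

Lemma submod_span_fspan (V : lmodType R) (s : seq V) v :
  v \in submod_span [set` s] <-> fspan p 0 s v.
Proof.
rewrite submod_spanP; split=> h B.
  by move=> /linear_stable; exact: h.
by move=> /linear_stable; exact: h.
Qed.

Lemma noetherian_fgen : noetherian_ring R -> forall J : set R^o, stable 0 J -> fgen p 0 J.
Proof.
move=> noeth J sJ; have lJ := (linear_stable J).2 sJ.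
have [s hs] := noeth (submod_of_set lJ); exists s; apply/seteqP; split=> v.
  by move=> Jv; apply/submod_span_fspan; rewrite -hs mem_submod_of_set; exact/asboolP.
by move=> /submod_span_fspan; rewrite -hs mem_submod_of_set => /asboolP.
Qed.

Lemma mem_frobenius_power (I : ideal R) n (x : R^o) :
  x \in frobenius_power p I n <-> frobI p (set_of_submod I) n x.
Proof.
rewrite submod_spanP; split=> h B sB hB.
  by apply: h; [exact/linear_stable | move=> _ [y Iy ->]; exact: hB].
by apply: h; [exact/linear_stable | move=> y Iy; apply: hB; exists y].
Qed.

Lemma F_finite_gens (chR : p \in [pchar R]) : F_finite chR ->
  exists g : seq R^o, forall v, fspan p 1 g v.
Proof.
move=> [s hs]; exists s => v B sB sBs.
have /submod_spanP := hs v; apply=> //; split; first exact: (stable0 sB).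
- by move=> u w; exact: (stableD sB).
- move=> a u Bu; have := stableZ a sB Bu; rewrite expn1; exact.
Qed.

End SetsOfIdeals.

Lemma nat_sup_bounded (P : set nat) b : (exists n, P n) -> (forall n, P n -> (n <= b)%N) ->
  P (nat_sup P) /\ forall k, P k -> (k <= nat_sup P)%N.
Proof.
move=> [n0 hn0] bP; rewrite /nat_sup.
have [n [hn mx]] : exists n, P n /\ forall k, P k -> (k <= n)%N.
  have exP : exists n, `[< P n >] by exists n0; apply/asboolP.
  have bP' n : `[< P n >] -> (n <= b)%N by move=> /asboolP; exact: bP.
  case: (ex_maxnP exP bP') => n /asboolP hn mx; exists n; split=> // k hk.
  by apply: mx; apply/asboolP.
by case: xgetP => [m -> [? ?]|/(_ n)]; [split | case; split].
Qed.

Lemma nat_sup_pos (P : set nat) : (0 < nat_sup P)%N ->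
  P (nat_sup P) /\ forall k, P k -> (k <= nat_sup P)%N.
Proof. by rewrite /nat_sup; case: xgetP => [m -> [? ?]|]. Qed.

Lemma quotient_pi_eq0 (R : comNzRingType) (V : lmodType R) (N : submodClosed V) (v : V) :
  (\pi_(quotient_module N) v = 0)%qT <-> v \in N.
Proof.
have <- : (\pi_(quotient_module N) (0 : V) = 0)%qT.
  set z := (\pi_(quotient_module N) (0 : V))%qT.
  by apply: (addrI z); rewrite /z -quotient_piD !addr0.
by rewrite quotient_piP subr0.
Qed.

Section QuotientLength.
Variables (R : comNzRingType) (p : nat) (m : set R^o).
Hypothesis pm : primeS p m.
Hypothesis m_local : forall s : R, ~ m s -> exists t : R, t * s = 1.
Local Notation stable e N := (@stable R p _ e N).
Local Open Scope quotient_scope.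
Variable I : ideal R.
Local Notation qI := (quotient_module I).

(** Chains of submodules of R / I are chains of ideals above I; over a local ring a
    proper inclusion is the same as one that survives localization at m. *)
Lemma quotient_chain n : submodule_chain qI n <->
  chain p m 0 n (setT : set R^o) (set_of_submod I).
Proof.
have unit_mem (A : set R^o) (s : R) (v : R^o) : stable 0 A -> ~ m s -> A (s ^+ (p ^ 0) *: v) -> A v.
  move=> sA /m_local[t ts] h; have := stableZ t sA h.
  by rewrite scalerA expn0 !expr1 ts scale1r.
have pi0 : \pi_qI (0 : R^o) = 0 by apply/quotient_pi_eq0; exact: rpred0.
split.
  move=> [C hC]; pose pre i : set R^o := fun r => \pi_qI r \in C i.
  have spre i : stable 0 (pre i).
    apply/linear_stable; rewrite /pre; split.
    - by rewrite pi0; exact: rpred0.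
    - by move=> u v; rewrite quotient_piD; exact: rpredD.
    - by move=> a v; rewrite -quotient_scale_pi => h; apply: (@rpredZ _ _ (C i) a).
  suff h k : (k <= n)%N -> chain p m 0 k (pre k) (set_of_submod I).
    by apply: chain_mono (h n (leqnn n)).
  elim: k => [_ v Iv|k IH kn].
    rewrite /pre /=; have -> : \pi_qI v = 0; last exact: rpred0.
    exact/quotient_pi_eq0.
  exists (pre k); split; [exact: spre | by apply: IH; exact: ltnW | |].
    by move=> v; rewrite /pre; have [sub _] := hC k kn; exact: sub.
  have [_ nsub] := hC k kn.
  have [x xC xn] : exists2 x, x \in C k.+1 & ~ x \in C k.
    apply: contrapT => nex; apply: nsub => x xC; apply: contrapT => xn.
    by apply: nex; exists x.
  have [v E] := quotient_pi_surj x; exists v; first by rewrite /pre -E.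
  by move=> s ms h; apply: xn; rewrite E; exact: (unit_mem (pre k) s).
have build k (A : set R^o) : stable 0 A -> chain p m 0 k A (set_of_submod I) ->
    exists C : nat -> set R^o, [/\ C k = A,
      forall i, (i <= k)%N -> stable 0 (C i) /\ set_of_submod I `<=` C i &
      forall i, (i < k)%N -> C i `<=` C i.+1 /\ ~ C i.+1 `<=` C i].
  elim: k A => [|k IH] A sA /=; first by move=> IA; exists (fun=> A); split.
  move=> [A' [sA' hA' A'A [v Av nv]]]; have [C [Ck Cs Ci]] := IH A' sA' hA'.
  have IA' := chain_sub hA'.
  exists (fun i => if (i <= k)%N then C i else A); split; first by rewrite ltnn.
    by move=> i _; case: leqP => [/Cs //|_]; split=> // x /IA' /A'A.
  move=> i; rewrite ltnS => le; rewrite le; case: ltnP => [lt|ge]; first exact: Ci.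
  have -> : i = k by apply/eqP; rewrite eqn_leq le.
  rewrite Ck; split=> // h; apply: (nv 1); first by case: pm.
  by rewrite expr1n scale1r; exact: h.
move=> /(build _ _ (@stable_setT R p R^o 0))[C [_ Cs Ci]].
pose A i : set qI := fun x => exists2 v, C i v & x = \pi_qI v.
have lA i : (i <= n)%N -> linear_set (A i).
  move=> le; have [/linear_stable[C0 CD CZ] _] := Cs i le; split.
  - by exists 0; rewrite ?pi0.
  - by move=> _ _ [u hu ->] [v hv ->]; exists (u + v); [exact: CD | rewrite quotient_piD].
  - by move=> a _ [v hv ->]; exists (a *: v); [exact: CZ | rewrite -quotient_scale_pi].
pose D i : submodClosed qI := if pselect (i <= n)%N is left le then submod_of_set (lA i le)
  else submod_of_set (lA 0 (leq0n n)).
have DE i x : (i <= n)%N -> x \in D i <-> A i x.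
  move=> le; rewrite /D; case: pselect => // le'; rewrite mem_submod_of_set.
  by split=> [/asboolP|?] //; exact/asboolP.
exists D => i lt; have [sub nsub] := Ci i lt; split.
  by move=> x /(DE _ _ (ltnW lt))[v hv ->]; apply/(DE _ _ lt); exists v => //; exact: sub.
move=> h; apply: nsub => v hv.
have [v' hv' E] : A i (\pi_qI v) by apply/(DE _ _ (ltnW lt))/h/(DE _ _ lt); exists v.
have [sC IC] := Cs i (ltnW lt).
by rewrite -(subrK v' v); apply: (stableD sC) => //; apply: IC; apply/quotient_piP.
Qed.

Lemma quotient_length : module_length qI = len p m 0 (setT : set R^o) (set_of_submod I).
Proof. by congr nat_sup; apply/funext => n; apply/propext; exact: quotient_chain. Qed.

Lemma quotient_finite_length : finite_length qI -> finlen p m 0 (setT : set R^o) (set_of_submod I).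
Proof. by move=> [b hb]; exists b => n /quotient_chain; exact: hb. Qed.

End QuotientLength.

(** * Systems of parameters in Cohen-Macaulay rings *)

Section CohenMacaulay.
Variables (R : idomainType) (p : nat) (chR : p \in [pchar R]) (m : ideal R).
Hypothesis locR : local_ring m.
Local Notation stable e N := (@stable R p _ e N).
Local Notation M := (set_of_submod m).
Local Notation seqideal := (@seqideal R p).
Local Notation revregular := (@revregular R p).

Let noeth : forall J : set R^o, stable 0 J -> fgen p 0 J.
Proof. by case: locR => h _ _; exact: noetherian_fgen. Qed.

Lemma maximal_over (N : set R^o) : stable 0 N -> ~ N 1 ->
  exists2 m' : ideal R, maximal_ideal m' & N `<=` set_of_submod m'.
Proof.
move: N; apply: (noeth_ind chR noeth (@regular_gen R p)) => N sN IH N1.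
have [[N' [sN' NN' nN' N'1]]|h] := EM (exists N' : set R^o,
    [/\ stable 0 N', N `<=` N', ~ N' `<=` N & ~ N' 1]).
  by have [m' mm' sub] := IH N' sN' NN' nN' N'1; exists m' => // x /NN'; exact: sub.
exists (submod_of_set ((linear_stable p N).2 sN)); last first.
  by move=> x Nx; exact/asboolP.
split; first exact/asboolP.
move=> I' I1 sub x Ix; apply/asboolP; apply: contrapT => Nx.
apply: h; exists (set_of_submod I'); split.
- exact: stable_submod.
- by move=> y Ny; apply: sub; exact/asboolP.
- by move=> h; apply/Nx/h.
- exact/negP.
Qed.

Lemma local_unit (s : R) : ~ M s -> exists t : R, t * s = 1.
Proof.
move=> Ms; apply: contrapT => nu.
pose N : set R^o := fun x : R => exists r : R, x = r * s.
have sN : stable 0 N.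
  split; first by exists 0; rewrite mul0r.
  - by move=> _ _ [r ->] [r' ->]; exists (r - r'); rewrite mulrBl.
  - by move=> r _ [r' ->]; exists (r * r'); rewrite expn0 expr1 scaler_regular mulrA.
have [|m' mm' sub] := maximal_over sN.
  by move=> [r E]; apply: nu; exists r.
have [_ _ uniq] := locR; apply: Ms; rewrite /set_of_submod -(uniq m' mm').
by apply: sub; exists 1; rewrite mul1r.
Qed.

Lemma local_prime : primeS p M.
Proof.
have [_ [m1 _] _] := locR; have sM := stable_submod p m.
split=> //; first exact/negP.
move=> a b Mab; have [Ma|/local_unit[t ta]] := EM (M a); [by left | right].
by rewrite -[b]mul1r -ta -mulrA; exact: (stable0M sM).
Qed.

Lemma seqideal_span (xs s : seq R) (v : R^o) : xs =i s ->
  seqideal xs 1 v <-> v \in submod_span ([set` s] : set R^o).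
Proof.
move=> xss; rewrite (submod_span_fspan p); split.
  apply: (seqideal_min (stable_fspan _ _ _)) => x xs_x; rewrite expr1.
  by apply: mem_fspan; rewrite -xss.
apply: fspan_least; first exact: stable_seqideal.
move=> u us; rewrite -[u]expr1; apply: mem_seqideal => //; by rewrite xss.
Qed.

Lemma regular_rev (s : seq R) : regular_sequence s ->
  revregular (rev s) /\ ~ seqideal (rev s) 1 1.
Proof.
move=> [n1 reg]; split; last first.
  by move=> /(seqideal_span _ (mem_rev s)) h; move/negP: n1; apply.
suff h k : (k <= size s)%N -> revregular (rev (take k s)).
  by have := h _ (leqnn _); rewrite take_size.
elim: k => [|k IH] ks; first by rewrite take0.
rewrite (take_nth 0) // rev_rcons; split; last by apply: IH; exact: ltnW.
move=> r /(seqideal_span _ (mem_rev _)) hr; apply/(seqideal_span _ (mem_rev _)).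
have := reg k ks (\pi_(quotient_module (submod_span ([set` take k s] : set R^o)))%qT (r : R^o)).
move=> h; apply/quotient_pi_eq0; apply: h.
rewrite -[_ *: _]/(quotient_scale _ _) quotient_scale_pi; exact/quotient_pi_eq0.
Qed.

Lemma regular_nil : regular_sequence ([::] : seq R).
Proof.
split=> //; apply/negP => /(submod_span_fspan p) /(_ _ (stable_zero _ _ _)).
by move=> h; have /eqP := h (fun u (h : u \in [::]) => False_ind _ (notF h)); rewrite oner_eq0.
Qed.

Lemma regular_single (x : R) : M x -> x != 0 -> regular_sequence [:: x].
Proof.
move=> Mx x0; have [_ m1 _] := local_prime; split.
  apply/negP => /(submod_span_fspan p) h; apply: m1; apply: h; first exact: stable_submod.
  by move=> u; rewrite inE => /eqP ->.
move=> [|//] _ /= v; have [r ->] := quotient_pi_surj v.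
have z0 (w : R^o) : w \in submod_span ([set` [::]] : set R^o) <-> w = 0.
  rewrite (submod_span_fspan p); split=> [h|->]; last exact: (stable0 (stable_fspan _ _ _)).
  by apply: (h _ (stable_zero _ _ _)).
rewrite -[_ *: _]/(quotient_scale _ _) quotient_scale_pi => /quotient_pi_eq0 /z0 /eqP.
by rewrite mulf_eq0 (negbTE x0) /= => /eqP ->; apply/quotient_pi_eq0/z0.
Qed.

Lemma prime_chain_of_sets n (C : nat -> set R^o) :
  (forall i, (i <= n)%N -> primeS p (C i)) ->
  (forall i, (i < n)%N -> C i `<=` C i.+1 /\ ~ C i.+1 `<=` C i) -> prime_chain R n.
Proof.
move=> hp hC; pose D i : ideal R := if pselect (stable 0 (C i)) is left h
  then submod_of_set ((linear_stable p (C i)).2 h) else submod_span set0.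
have DE i (x : R^o) : (i <= n)%N -> x \in D i <-> C i x.
  move=> le; have [sC _ _] := hp i le; rewrite /D; case: pselect => // h.
  by rewrite mem_submod_of_set; split=> [/asboolP|?] //; exact/asboolP.
exists D; split=> i le.
  have [sC C1 Cm] := hp i le; split; first by apply/negP => /(DE _ _ le).
  move=> a b /(DE _ _ le) /Cm[] h; apply/orP; [left | right]; exact/(DE _ _ le).
have [sub nsub] := hC i le; split.
  by move=> x /(DE _ _ (ltnW le)) /sub h; apply/(DE _ _ le).
by move=> h; apply: nsub => x hx; apply/(DE _ _ (ltnW le))/h/(DE _ _ le).
Qed.

Hypothesis finF : F_finite chR.

(** A maximal regular sequence has length krull_dim R.  A prime other than m above it
    would give a chain of primes longer than that, by prime_chain_below.  Both depth and
    dimension take the value 0 when they are unbounded: depth_bound excludes this for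
    depth, and if the dimension is 0, so is the depth, and then m = 0. *)
Lemma cohen_macaulay_parameters : cohen_macaulay m -> exists xs : seq R,
  [/\ size xs = krull_dim R, revregular xs, (forall x, x \in xs -> M x) &
      finlen p M 0 (setT : set R^o) (seqideal xs 1)].
Proof.
move=> cm; have pM := local_prime; have [g1 g1T] := F_finite_gens finF.
pose T n := exists s : seq R, [/\ size s = n, {subset s <= m} & regular_sequence s].
have p1 : (1 < p)%N by rewrite prime_gt1 // (pcharf_prime chR).
have [[s [sz sm reg]] dmax] : T (depth m) /\ forall k, T k -> (k <= depth m)%N.
  apply: (@nat_sup_bounded T (size g1)).
    by exists 0%N, [::]; split=> //; exact: regular_nil.
  move=> n [s [<- _ /regular_rev[rs ns]]].
  rewrite -(size_rev s); apply: leq_trans (depth_bound chR noeth g1T rs ns).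
  exact: ltnW (ltn_expl _ p1).
have [rs ns] := regular_rev reg.
exists (rev s); split=> //; first by rewrite size_rev sz cm.
  by move=> x; rewrite mem_rev => /sm.
apply: (finlen_of_primes chR noeth g1T pM (stable_seqideal chR _ _)) => P pP sub.
have PM := prime_sub_max local_unit pP; apply/seteqP; split=> //.
apply: contrapT => nMP.
have [d0|d0] := posnP (krull_dim R).
  apply: nMP => x Mx; have [->|x0] := eqVneq x 0.
    by have [sP _ _] := pP; exact: (stable0 sP).
  have : T 1%N by exists [:: x]; split=> //; [move=> y; rewrite inE => /eqP -> | exact: regular_single].
  by move=> /dmax; rewrite cm d0.
have [_ kmax] := nat_sup_pos d0.
have [C [Cs Cp Ci]] := prime_chain_below chR noeth rs pP sub.
suff /kmax : prime_chain R (krull_dim R).+1 by rewrite ltnn.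
rewrite size_rev sz cm in Cs Cp Ci.
apply: (prime_chain_of_sets (C := fun i => if (i <= krull_dim R)%N then C i else M)).
  by move=> i _; case: leqP => // /Cp.
move=> i; rewrite ltnS => le; rewrite le; case: ltnP => [lt|ge]; first exact: Ci.
have -> : i = krull_dim R by apply/eqP; rewrite eqn_leq le.
by rewrite Cs.
Qed.

End CohenMacaulay.

(** * Rationality of the Hilbert-Kunz multiplicity *)

Section HilbertKunz.
Variables (K : realType) (R : idomainType) (p : nat) (chR : p \in [pchar R]).
Hypothesis noeth : forall J : set R^o, stable p 0 J -> fgen p 0 J.
Variable g1 : seq R^o.
Hypothesis g1T : forall v, fspan p 1 g1 v.
Variable m : set R^o.
Hypothesis pm : primeS p m.
Hypothesis m_local : forall s : R, ~ m s -> exists t : R, t * s = 1.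
Local Notation stable e N := (@stable R p _ e N).
Local Notation finlen := (@finlen R p).
Local Notation len := (@len R p).
Local Notation rho := (@rho R p).
Variable xs : seq R.
Hypotheses (reg : revregular p xs) (xm : forall x, x \in xs -> m x).
Hypothesis xfin : finlen m 0 (setT : set R^o) (seqideal p xs 1).
Local Notation dim := (size xs).
Variable I : set R^o.
Hypotheses (sI : stable 0 I) (Im : I `<=` m) (Ifin : finlen m 0 setT I).
Hypothesis coh : coherent_ring (perfect_closure chR).

Let p_gt0 : (0 < p)%N. Proof. by rewrite prime_gt0 // (pcharf_prime chR). Qed.

Lemma finlen_frob_primary n : finlen m 0 setT (frobI p I n).
Proof.
apply: (finlen_of_primes chR noeth g1T pm (stable_frobI p I n)) => P pP sub.
apply: (prime_over_finite chR pm m_local sI Ifin pP) => x Ix.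
by apply: (prime_exp pP (n := (p ^ n)%N)); apply: sub; exact: mem_frobI.
Qed.

Let growth := parameter_growth chR pm reg xm xfin.
Let rho_bound Q (pQ : primeS p Q) (Q0 : Q != [set 0]) : (rho Q * p <= rho m * p ^ dim)%N :=
  rho_nonzero_bound chR noeth g1T pm m_local growth pQ Q0.
Let kappa_gt0 : (0 < rho m)%N := rho_gt0 chR noeth g1T pm.

Section Complex.
Variables (fs : seq R) (n0 L : nat) (b : nat -> nat) (d : forall i, 'M[R]_(b i.+1, b i)).
Hypothesis EI : I = @fspan R p R^o 0 fs.
Hypotheses (b0 : b 0 = 0%N) (b1 : b 1 = 1%N) (b2 : b 2 = size fs) (bL : b L.+1 = 0%N).
Hypothesis d1 : forall j k, d 1 j k = fs`_j ^+ (p ^ n0).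
Hypothesis dd : forall i, d i.+1 *m d i = 0.
Local Notation hlen := (@hlen R p b d).
Local Notation hfin := (@hfin R p b d).

(** The cokernel of the twisted complex is R modulo a Frobenius power of I.  Since b 1 is
    only provably equal to 1, elements of R enter the rows of size b 1 as constant
    rows. *)
Lemma hlen_frobI n : hlen m 0 n setT [set 0%R : R^o] 0 = len m 0 setT (frobI p I (n0 + n)).
Proof.
have sT : stable 0 (setT : set R^o) by [].
have s0 : stable 0 [set 0%R : R^o] by exact: stable_zero.
set Z := @cyc R p b d n setT [set 0%R : R^o] 0; set B := @bnd R p b d n setT [set 0%R : R^o] 0.
have sB : stable 0 B by exact: stable_bnd.
have ZT v : Z v by split=> // j; exfalso; have := ltn_ord j; rewrite {2}b0.
have BP v : B v <-> exists w, v = w *m fmx p n (d 1).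
  split=> [[w _ h]|[w ->]]; last by exists w => // j; rewrite subrr mxE.
  by exists w; apply/eqP; rewrite -subr_eq0; apply/eqP/rowP => j; rewrite h mxE.
pose f (r : R^o) : 'rV[R]_(b 1) := const_mx (r : R).
have j1 (i j : 'I_(b 1)) : i = j.
  by apply/val_inj => /=; have := ltn_ord i; have := ltn_ord j; rewrite {2 4}b1; lia.
have [E _] : len m 0 setT (frobI p I (n0 + n)) = len m 0 Z B /\
    (finlen m 0 setT (frobI p I (n0 + n)) <-> finlen m 0 Z B).
  apply: (@len_iso R p m _ _ 0 0 f).
  - by move=> r s; apply/rowP => j; rewrite !mxE.
  - by move=> r s; apply/rowP => j; rewrite !mxE.
  split; first by split=> //; exact: stable_cyc.
  split=> //.
  - move=> v _; have j0 : 'I_(b 1) by rewrite b1; exact: ord0.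
    exists (v 0 j0) => //; apply/BP; exists 0; rewrite mul0mx; apply/rowP => j.
    by rewrite !mxE (j1 j j0) subrr.
  move=> r; split=> [hr|[_ /BP[w E]]].
    split=> //; apply: (hr (fun r : R^o => B (f r))).
      split.
      - by rewrite (_ : f 0 = 0); [exact: (stable0 sB) | apply/rowP => j; rewrite !mxE].
      - move=> u v hu hv; rewrite (_ : f _ = f u - f v); first exact: (stableB sB).
        by apply/rowP => j; rewrite !mxE.
      - move=> a v hv; rewrite (_ : f _ = a ^+ (p ^ 0) *: f v); first exact: (stableZ _ sB).
        by apply/rowP => j; rewrite !mxE.
    move=> x; rewrite EI => hx; apply: (hx (fun x : R^o => B (f ((x : R) ^+ (p ^ (n0 + n)))))).
      split.
      - rewrite (_ : f _ = 0); first exact: (stable0 sB).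
        by apply/rowP => j; rewrite !mxE (frob0 chR).
      - move=> u v hu hv; rewrite (_ : f _ = f ((u : R) ^+ (p ^ (n0 + n))) - f ((v : R) ^+ (p ^ (n0 + n)))).
          exact: (stableB sB).
        by apply/rowP => j; rewrite !mxE (frobD chR) (frobN chR).
      - move=> a v hv; rewrite (_ : f _ = (a ^+ (p ^ (n0 + n))) ^+ (p ^ 0) *: f ((v : R) ^+ (p ^ (n0 + n)))).
          exact: (stableZ _ sB).
        by apply/rowP => j; rewrite !mxE expn0 !expr1 scaler_regular exprMn.
    move=> u ufs; apply/BP.
    have il : (index u fs < b 2)%N by rewrite b2 index_mem.
    exists (delta_mx 0 (Ordinal il)); rewrite -rowE; apply/rowP => j.
    by rewrite !mxE d1 nth_index // -exprM -expnD.
  have j0 : 'I_(b 1) by rewrite b1; exact: ord0.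
  have sF := stable_frobI p I (n0 + n).
  have -> : r = (w *m fmx p n (d 1)) 0 j0 by rewrite -E mxE.
  rewrite mxE; apply: (stable_sum _ sF) => k _; rewrite mxE d1 -exprM -expnD.
  apply: (stable0M sF); apply: mem_frobI; rewrite EI; apply: mem_fspan; apply: mem_nth.
  by have := ltn_ord k; rewrite {2}b2.
by rewrite /hlen -/Z -/B -E.
Qed.

Hypothesis frob_exact : forall n i (z : 'rV[R]_(b i.+2)), z *m fmx p n (d i.+1) = 0 ->
  exists e w, fmx p e z = w *m fmx p (n + e) (d i.+2).
Hypothesis homotopy : forall f, f \in fs -> exists s : forall i, 'M[R]_(b i, b i.+1),
  forall i, d i *m s i + s i.+1 *m d i.+1 = (f ^+ (p ^ n0))%:M.

Lemma hfin_complex n P i : stable 0 P -> hfin m 0 n setT P i.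
Proof.
apply: (homology_finite chR noeth g1T pm (fs := [seq f ^+ (p ^ n0) | f <- fs])).
  by move=> _ /mapP[f ff ->]; exact: homotopy.
move=> Q pQ hQ; apply: (prime_over_finite chR pm m_local sI Ifin pQ); rewrite EI.
apply: fspan_least; first by case: pQ.
by move=> f ff; apply: (prime_exp pQ (n := (p ^ n0)%N)); apply: hQ; exact: map_f.
Qed.

Let rec i P l n (pP : primeS p P) (hl : pfilt p 1 P l) :
  (rho m * hlen m 0 n.+1 setT P i <= \sum_(P' <- l) hlen m 0 n setT P' i)%N.
Proof.
have [sP _ _] := pP; apply: (hlen_recurrence chR noeth g1T pm dd n sP hl).
by move=> k P' sP'; exact: hfin_complex.
Qed.

(** The length of R modulo the Frobenius powers of I is at least a constant times
    p ^ (n * dim), because xs is regular. *)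
Lemma rho_zero : rho [set 0%R : R^o] = (rho m * p ^ dim)%N.
Proof.
apply/eqP; rewrite eqn_leq (rho_zero_bound chR noeth g1T pm m_local growth) /=.
have [s low] := parameter_lower chR noeth pm m_local reg xm xfin.
have D0 : (0 : K) < (p ^ dim)%N%:R by rewrite ltr0n expn_gt0 p_gt0.
apply: (@rho_zero_exact K R p chR noeth g1 g1T m dim kappa_gt0 rho_bound
  (fun n P => hlen m 0 n setT P 0) (((p ^ dim)%N%:R ^+ s)^-1)).
- by move=> P l n pP hl; exact: rec.
- by rewrite invr_gt0 exprn_gt0.
exists s => // n /= sn; rewrite hlen_frobI.
rewrite ler_pdivlMr ?exprn_gt0 // mulrC ler_pdivrMr ?exprn_gt0 // -!natrX -natrM ler_nat.
have -> : (n0 + n = s + (n0 + n - s))%N by rewrite subnKC // (leq_trans sn) // leq_addl.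
apply: (@leq_trans (p ^ ((n0 + n - s) * dim) * (p ^ dim) ^ s)%N); last first.
  by rewrite leq_mul2r; apply/orP; right; apply: low => //; exact: finlen_frob_primary.
by rewrite -!expnM -expnD leq_pexp2l // [(dim * s)%N]mulnC -mulnDl [(dim * n)%N]mulnC leq_mul2r; apply/orP; right; lia.
Qed.

(** By hlen_killed the length is bounded by homology with coefficients in R / c R, and
    a prime filtration of R / c R involves nonzero primes only. *)
Lemma higher_homology_negligible i :
  ((hlen m 0 n setT [set 0%R : R^o] i.+1)%:R / (p ^ dim)%N%:R ^+ n) @[n --> \oo] --> (0 : K).
Proof.
have [c c0 hc] := frobenius_functionals chR noeth g1T.
have sM := stable_multiples p c.
have [l hl] := gens_stable_exists chR noeth g1T (stable_ideal 0 sM).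
have lP P : P \in l -> primeS p P /\ P != [set 0%R].
  move=> Pl; split; first exact: pfilt_prime hl Pl.
  apply/eqP => E; move/eqP: c0; apply.
  have : P c by apply: (pfilt_sup chR hl sM Pl); exists 1; rewrite mul1r.
  by rewrite E.
have D0 : (0 : K) < (p ^ dim)%N%:R by rewrite ltr0n expn_gt0 p_gt0.
apply: (@squeeze_cvgr _ _ _ _ (fun=> 0) (fun n => \sum_(P <- l)
  (hlen m 0 n setT P i.+2)%:R / (p ^ dim)%N%:R ^+ n)).
- near=> n; rewrite divr_ge0 //=.
  rewrite -mulr_suml ler_pM2r ?invr_gt0 ?exprn_gt0 // -natr_sum ler_nat.
  have fP P : P \in l -> hfin m 0 n setT P i.+2.
    by move=> Pl; apply: hfin_complex; have [[]] := lP _ Pl.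
  have [fM le] := homology_subadditive chR dd (n := n) (i := i.+2) pm hl sM fP.
  rewrite addn0 in fM le; apply: leq_trans le.
  exact: (hlen_killed chR dd frob_exact c0 hc).
- exact: cvg_cst.
- apply: cvg0_sum => P /lP[pP P0].
  apply: (@growth_negligible K R p chR noeth g1 g1T m dim kappa_gt0 rho_bound
    (fun n P => hlen m 0 n setT P i.+2)) => //.
  by move=> P' l' n pP' hl'; exact: rec.
Unshelve. all: by end_near.
Qed.

(** The normalized Euler characteristic has a rational limit, and differs from the
    length of the cokernel by higher homology, which is negligible. *)
Lemma hilbert_kunz_shifted : rat_limit (fun n =>
  (len m 0 setT (frobI p I (n0 + n)))%:R / (p ^ dim)%N%:R ^+ n : K).
Proof.
pose X n P := euler p d m L 0 n setT P.
have [q hq] : rat_limit (fun n => (X n [set 0%R : R^o])%:~R / (p ^ dim)%N%:R ^+ n : K).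
  apply: (@limit_rational K R p chR noeth g1 g1T m dim kappa_gt0 rho_bound X) rho_zero.
  move=> P l n pP hl; have [sP _ _] := pP.
  apply: (euler_recurrence chR noeth g1T pm dd n b0 bL sP hl).
  by move=> i k P' sP'; exact: hfin_complex.
exists q.
have L0 : (0 < L)%N by rewrite lt0n; apply/eqP => L0; move: bL; rewrite L0 b1.
pose Y n : K := \sum_(i <- index_iota 1 L)
  (-1) ^+ i * ((hlen m 0 n setT [set 0%R : R^o] i)%:R / (p ^ dim)%N%:R ^+ n).
have E n : (len m 0 setT (frobI p I (n0 + n)))%:R / (p ^ dim)%N%:R ^+ n =
    (X n [set 0%R : R^o])%:~R / (p ^ dim)%N%:R ^+ n - Y n.
  rewrite -hlen_frobI /X /euler -(big_mkord xpredT (fun i => (-1) ^+ i * (hlen m 0 n setT [set 0%R : R^o] i)%:Z)).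
  rewrite big_ltn // mul1r intrD mulrDl rmorph_sum /= mulr_suml -addrA.
  rewrite [X in _ + X](_ : _ = 0) ?addr0 //; apply/eqP; rewrite subr_eq0; apply/eqP.
  by apply: eq_bigr => i _; rewrite intrM rmorphXn rmorphN1 mulrA.
have -> : (fun n => (len m 0 setT (frobI p I (n0 + n)))%:R / (p ^ dim)%N%:R ^+ n) =
    (fun n => (X n [set 0%R : R^o])%:~R / (p ^ dim)%N%:R ^+ n - Y n) by apply/funext.
rewrite -[ratr q]subr0; apply: cvgB => //.
apply: (@cvg0_sum K _ (index_iota 1 L) (fun i n =>
  (-1) ^+ i * ((hlen m 0 n setT [set 0%R : R^o] i)%:R / (p ^ dim)%N%:R ^+ n))) => i; rewrite mem_index_iota => /andP[i0 _].
have := higher_homology_negligible i.-1; rewrite prednK // => neg.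
have := cvgM (cvg_cst ((-1) ^+ i : K)) neg; rewrite mulr0; exact.
Qed.

End Complex.

Theorem hilbert_kunz_rational :
  rat_limit (fun n => (len m 0 setT (frobI p I n))%:R / (p ^ (n * dim))%:R : K).
Proof.
have [l El] := noeth sI; have [lm Elm] := noeth (let: And3 h _ _ := pm in h).
have [b [d [L [n0 [[b0 b1 b2 bL] d1 dd fex hom]]]]] :=
  frobenius_exact_complex pm m_local Elm l coh.
have [q hq] := hilbert_kunz_shifted El b0 b1 b2 bL d1 dd fex hom.
exists (q / (p ^ (n0 * dim))%:R).
rewrite -(cvg_shiftn n0) fmorph_div rmorph_nat.
have -> : [sequence (len m 0 setT (frobI p I (n + n0)))%:R / (p ^ ((n + n0) * dim))%:R]_n =
  (fun n => (len m 0 setT (frobI p I (n0 + n)))%:R / (p ^ dim)%N%:R ^+ n / (p ^ (n0 * dim))%:R) :> (nat -> K).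
  apply/funext => n /=; rewrite [(n + n0)%N]addnC mulnDl expnD natrM -natrX -expnM [(dim * n)%N]mulnC.
  by rewrite invfM mulrA mulrAC.
exact: (cvgM hq (cvg_cst _)).
Qed.

End HilbertKunz.

Theorem proposition1p7 (K : realType) (R : idomainType) (p : nat)
    (chR : p \in [pchar R]) (m : ideal R) (I : ideal R) :
  local_ring m ->
  F_finite chR ->
  F_coherent chR ->
  finite_length (quotient_module I) ->
  cohen_macaulay m ->
  cvgn (HK_sequence p K I) /\ rational (HK_multiplicity p K I).
Proof.
move=> locR finF cohF finI cm.
have noeth : forall J : set R^o, stable p 0 J -> fgen p 0 J.
  by case: locR => h _ _; exact: noetherian_fgen.
have [g1 g1T] := F_finite_gens finF.
have pm := local_prime chR locR; have m_local := local_unit chR locR.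
have [xs [xdim reg xm xfin]] := cohen_macaulay_parameters locR finF cm.
have sI := stable_submod p I.
have Ifin := quotient_finite_length pm m_local finI.
have frobE n : set_of_submod (frobenius_power p I n) = frobI p (set_of_submod I) n.
  by apply/seteqP; split=> x /mem_frobenius_power.
have HKE n : HK_sequence p K I n =
    (len p (set_of_submod m) 0 setT (frobI p (set_of_submod I) n))%:R / (p ^ (n * size xs))%:R.
  by rewrite /HK_sequence (quotient_length pm m_local) frobE xdim.
suff [q hq] : rat_limit (HK_sequence p K I).
  split; first by apply/cvg_ex; exists (ratr q).
  by exists q => //; rewrite /HK_multiplicity; apply/esym/cvg_lim.
have -> : HK_sequence p K I = (fun n =>
    (len p (set_of_submod m) 0 setT (frobI p (set_of_submod I) n))%:R / (p ^ (n * size xs))%:R).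
  by apply/funext => n; exact: HKE.
have [Im|nIm] := EM (set_of_submod I `<=` set_of_submod m).
  exact: (hilbert_kunz_rational K noeth g1T pm m_local reg xm xfin sI Im Ifin cohF).
exists 0; rewrite rmorph0.
have I1 : set_of_submod I 1.
  apply: contrapT => nI1; apply: nIm => x Ix; apply: contrapT => /m_local[t tx].
  by apply: nI1; rewrite -tx; exact: (stable0M sI).
have z n : len p (set_of_submod m) 0 setT (frobI p (set_of_submod I) n) = 0%N.
  apply: (proj2 (len_torsion_ideal chR 0 (stable_frobI p _ n) (s := 1) _ _)).
    by rewrite -(expr1n _ (p ^ n)); exact: mem_frobI.
  by case: pm.
have -> : (fun n => (len p (set_of_submod m) 0 setT (frobI p (set_of_submod I) n))%:R
    / (p ^ (n * size xs))%:R) = (fun=> 0 : K).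
  by apply/funext => n; rewrite z mul0r.
exact: cvg_cst.
Qed.
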